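(* Let $\mathcal X\subset\mathcal X'\times\mathcal X''$ be a subset of a product of two spaces of homogeneous type satisfying conditions (a) and (b) of the context, with a dyadic filtration $\{\mathbb C_n\}_{n\in\mathbb Z}$ on $\mathcal X$. Let $p,q,p',q'\in(1,\infty)$ (here $p',q'$ are arbitrary exponents, not conjugates), $K_0\ge1$, $w_1=w_1(x')\in A_{p'}(\mu_1)$, $w_2=w_2(x'')\in A_{q'}(\mu_2)$, $[w_1]_{A_{p'}}\le K_0$, $[w_2]_{A_{q'}}\le K_0$, $w=w(x)=w_1(x')w_2(x'')$, and $f,g\in L_{p,q}(w\,d\mu)$. Suppose that either $\mu(\mathcal X)=\infty$, or $\operatorname{supp}f\subset B_{r_0}(x_0)$ and $\mu(B_{r_0}(x_0))\le\varepsilon\mu(\mathcal X)$ for some $r_0\in(0,\infty]$ and $x_0\in\mathcal X$, where $\varepsilon>0$ is a constant depending on $K_1,K_2,p,p',q,q'$, and $K_0$. Moreover, suppose that for each $n\in\mathbb Z$ and $Q\in\mathbb C_n$ there exists a measurable function $f^Q$ on $Q$ (integrable on $Q$, so that its average is defined) such that $|f|\le f^Q\le K_3|f|$ on $Q$ for some constant $K_3>0$ and $$\frac1{\mu(Q)}\int_Q|f^Q(x)-(f^Q)_Q|\,\mu(dx)\le g(y)\qquad\forall\,y\in Q,$$ where $(f^Q)_Q=\frac1{\mu(Q)}\int_Qf^Q\,d\mu$. Then $$\|f\|_{L_{p,q}(w\,d\mu)}\le N\|g\|_{L_{p,q}(w\,d\mu)},$$ where $N=N(K_1,K_2,K_3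,p,q,p',q',K_0)>0$.
   Context: Space of homogeneous type $(\mathcal X,\rho,\mu)$: $\rho$ is a quasi-metric, i.e. a nonnegative symmetric function with $\rho(x,y)=0$ iff $x=y$ and $\rho(x,y)\le K_1(\rho(x,z)+\rho(z,y))$; $B_r(x)=\{y:\rho(x,y)<r\}$; balls are assumed open; $\mu$ is a complete Borel measure on a $\sigma$-algebra containing all balls, with $0<\mu(B_{2r}(x))\le K_2\mu(B_r(x))<\infty$; the Lebesgue differentiation theorem is assumed to hold. $K_1,K_2$ denote the constants in these two inequalities for the spaces of homogeneous type involved. For $p\in(1,\infty)$, $A_p(\mu)$ is the set of nonnegative measurable $w$ with $$[w]_{A_p}=\sup_{x_0,\,r>0}\Big(\frac1{\mu(B_r(x_0))}\int_{B_r(x_0)}w\,d\mu\Big)\Big(\frac1{\mu(B_r(x_0))}\int_{B_r(x_0)}w^{-1/(p-1)}\,d\mu\Big)^{p-1}<\infty.$$ Product setting: $(\mathcal X',\rho_1,\mu_1)$ and $(\mathcal X'',\rho_2,\mu_2)$ are spaces of homogeneous type; points are $x=(x',x'')$; $\mu$ is the completion of the product measure on $\mathcal X'\times\mathcal X''$ (and also denotes its restriction to $\mathcal X$) and $\rho((x',x''),(y',y''))=\rho_1(x',y')+\rho_2(x'',y'')$. $\mathcal X\subset\mathcal X'\times\mathcal X''$ satisfies: (a) $(\mathcal X,\rho|_{\mathcal X\times\mathcal X},\mu|_{\mathcal X})$ is of homogeneous type; (b) for any $p\in(1,\infty)$, $w_1=w_1(x')\in A_p(\mu_1)$ and $w_2=w_2(x'')\in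 A_p(\mu_2)$, the function $w(x)=w_1(x')w_2(x'')$ is an $A_p$ weight on $(\mathcal X,\rho|_{\mathcal X\times\mathcal X},\mu|_{\mathcal X})$. Mixed norm: for $w=w_1(x')w_2(x'')$, $$\|f\|_{L_{p,q}(w\,d\mu)}=\Big(\int_{\mathcal X''}\Big(\int_{\mathcal X'}|f|^pI_{\mathcal X}\,w_1(x')\,\mu_1(dx')\Big)^{q/p}w_2(x'')\,\mu_2(dx'')\Big)^{1/q}.$$ Dyadic filtration on $\mathcal X$ (exists by Christ's theorem): for each $n\in\mathbb Z$ a collection $\mathbb C_n=\{Q^n_\alpha:\alpha\in I_n\}$ of disjoint open subsets such that (1) $\mu(\mathcal X\setminus\bigcup_\alpha Q^n_\alpha)=0$; (2) for each $n$ and $\alpha\in I_n$ there is a unique $\beta\in I_{n-1}$ with $Q^n_\alpha\subset Q^{n-1}_\beta$; (3) $\operatorname{diam}(Q^n_\alpha)\le N_0\delta^n$; (4) each $Q^n_\alpha$ contains a ball $B_{\varepsilon_0\delta^n}(z^n_\alpha)$; $\delta\in(0,1)$, $\varepsilon_0>0$, $N_0$ depend only on the constants $K_1,K_2$.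
   Formalization: Condition (b) is taken quantitatively: the A_p constant of w_1w_2 on X is bounded by a function Phi of p and a common bound on [w_1],[w_2]; ε and N may also depend on Phi. With (b) only qualitative, no N depending on the listed constants alone exists (thin strips about the diagonal in R×R). *)

(* Defs.v *)
From HB Require Import structures.
From mathcomp Require Import all_boot all_order all_algebra.
From mathcomp Require Import all_classical all_reals all_analysis.

Set Implicit Arguments.
Unset Strict Implicit.
Unset Printing Implicit Defensive.

Import Order.TTheory GRing.Theory Num.Theory.
Import numFieldNormedType.Exports.

Local Open Scope classical_set_scope.
Local Open Scope ring_scope.

(* A space carried by a subset D of a measurable type T: the quasi-metric, the
   balls and the measure are those of T restricted to D.  Taking D = setT gives
   a whole space; since D is a countable union of its balls, the axioms below
   force D to be measurable, so that the restriction of mu to D makes sense. *)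

Section homogeneous_type.
Context d (T : measurableType d) (R : realType).
Variables (D : set T) (rho : T -> T -> R) (mu : {measure set T -> \bar R}).

Definition qball (x : T) (r : \bar R) : set T :=
  [set y | D y /\ ((rho x y)%:E < r)%E].

Definition qopen (U : set T) : Prop :=
  U `<=` D /\ forall x, U x -> exists2 r : R, 0 < r & qball x r%:E `<=` U.

Record quasi_metric (K1 : R) : Prop := QuasiMetric {
  qm_ge0 : forall x y, D x -> D y -> 0 <= rho x y ;
  qm_sym : forall x y, D x -> D y -> rho x y = rho y x ;
  qm_eq0 : forall x y, D x -> D y -> (rho x y = 0 <-> x = y) ;
  qm_triangle : forall x y z, D x -> D y -> D z ->
    rho x y <= K1 * (rho x z + rho z y) }.

Definition avg (A : set T) (f : T -> R) : R :=
  (fine (mu A))^-1 * \int[mu]_(y in A) f y.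

Definition lebesgue_differentiation_property : Prop :=
  forall f : T -> R, measurable_fun D f ->
    (forall x r, D x -> 0 < r -> mu.-integrable (qball x r%:E) (EFin \o f)) ->
    {ae mu, forall x, D x -> avg (qball x r%:E) f @[r --> 0^'+] --> f x}.

Record homogeneous_type (K1 K2 : R) : Prop := HomogeneousType {
  ht_quasi_metric : quasi_metric K1 ;
  ht_ball_open : forall x r, D x -> 0 < r -> qopen (qball x r%:E) ;
  ht_ball_measurable : forall x r, D x -> 0 < r -> measurable (qball x r%:E) ;
  ht_borel : forall U, qopen U -> measurable U ;
  ht_complete : forall A, A `<=` D -> mu.-negligible A -> measurable A ;
  ht_doubling : forall x r, D x -> 0 < r ->
    [/\ (0 < mu (qball x (2 * r)%:E))%E,
        (mu (qball x (2 * r)%:E) <= K2%:E * mu (qball x r%:E))%E &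
        (K2%:E * mu (qball x r%:E) < +oo)%E] ;
  ht_lebesgue : lebesgue_differentiation_property }.

Definition eavg (A : set T) (h : T -> \bar R) : \bar R :=
  ((mu A)^-1 * \int[mu]_(y in A) h y)%E.

(* w^(-1/(p-1)); powR sends 0 to 0 for a negative exponent, so the inverse is
   taken in \bar R, where 0^-1 = +oo. *)
Definition dual_weight (p : R) (w : T -> R) (x : T) : \bar R :=
  (((w x `^ (p - 1)^-1)%:E)^-1)%E.

Definition Ap_const (p : R) (w : T -> R) : \bar R :=
  ereal_sup [set c | exists x r, [/\ D x, 0 < r &
    c = (eavg (qball x r%:E) (EFin \o w) *
         (eavg (qball x r%:E) (dual_weight p w)) `^ (p - 1))%E]].

Definition is_Ap (p : R) (w : T -> R) : Prop :=
  [/\ forall x, D x -> 0 <= w x, measurable_fun D w &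
      (Ap_const p w < +oo)%E].

Record dyadic_filtration (delta eps0 N0 : R) (I : int -> Type)
    (Q : forall n, I n -> set T) : Prop := DyadicFiltration {
  df_open : forall n a, qopen (Q n a) ;
  df_disjoint : forall n, trivIset setT (Q n) ;
  df_cover : forall n, mu (D `\` \bigcup_a Q n a) = 0%E ;
  df_nested : forall n (a : I n), exists! b : I (n - 1), Q n a `<=` Q (n - 1) b ;
  df_diam : forall n (a : I n) x y, Q n a x -> Q n a y ->
    rho x y <= N0 * delta ^ n ;
  df_ball : forall n (a : I n), exists2 z, D z &
    qball z (eps0 * delta ^ n)%:E `<=` Q n a }.

End homogeneous_type.

Section product.
Context d1 d2 (T1 : measurableType d1) (T2 : measurableType d2) (R : realType).
(* Sigma-finiteness, which is needed to form the product measure, is automatic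
   for a space of homogeneous type. *)
Variables (mu1 : {sigma_finite_measure set T1 -> \bar R})
          (mu2 : {sigma_finite_measure set T2 -> \bar R}).
Variables (rho1 : T1 -> T1 -> R) (rho2 : T2 -> T2 -> R).

(* T1 * T2 with the sigma-algebra of Caratheodory-measurable sets of the product
   measure, which, by sigma-finiteness, is the completed sigma-algebra. *)
Definition cprod : measurableType _ := caratheodory_type ((mu1 \x mu2)%E^*)%mu.

Definition cprod_measure : {measure set cprod -> \bar R} :=
  @completed_measure_extension _ _ _ (mu1 \x mu2)%E.

Definition prod_rho (x y : cprod) : R := rho1 x.1 y.1 + rho2 x.2 y.2.

Definition prod_weight (w1 : T1 -> R) (w2 : T2 -> R) (x : cprod) : R :=
  w1 x.1 * w2 x.2.

Definition mixed_norm (X : set cprod) (p q : R) (w1 : T1 -> R) (w2 : T2 -> R)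
    (f : cprod -> R) : \bar R :=
  ((\int[mu2]_y
      ((\int[mu1]_x (`|f (x, y)| `^ p * \1_X (x, y) * w1 x)%:E) `^ (q / p)
       * (w2 y)%:E)) `^ q^-1)%E.

Definition in_Lpq (X : set cprod) (p q : R) (w1 : T1 -> R) (w2 : T2 -> R)
    (f : cprod -> R) : Prop :=
  measurable_fun X f /\ (mixed_norm X p q w1 w2 f < +oo)%E.

(* Phi bounds the A_s constant on X of a product weight in terms of s and of a
   common bound on the A_s constants of the two factors.  Without such a bound
   the A_s constants of product weights on X are not controlled by those of
   their factors and by K1, K2: see the sets {|x' - x''| < eta, |x' + x''| < 2}
   of R x R as eta tends to 0. *)
Definition prod_weights_Ap (X : set cprod) (Phi : R -> R -> R) : Prop :=
  forall (s K : R) (w1 : T1 -> R) (w2 : T2 -> R), 1 < s ->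
    is_Ap setT rho1 mu1 s w1 -> is_Ap setT rho2 mu2 s w2 ->
    (Ap_const setT rho1 mu1 s w1 <= K%:E)%E ->
    (Ap_const setT rho2 mu2 s w2 <= K%:E)%E ->
    is_Ap X prod_rho cprod_measure s (prod_weight w1 w2) /\
    (Ap_const X prod_rho cprod_measure s (prod_weight w1 w2) <= (Phi s K)%:E)%E.

End product.

(* Main.v *)
(* For one exponent p and one weight w in A_s on X the inequality comes from a
   stopping-time argument.  If g is small at some point of a cube, the mean
   oscillation of f^Q there is small, so the weak-type bound for the dyadic
   maximal function confines the next stopping level to a small part of the
   cube; the A_s condition turns this into small w-measure, and summing over the
   levels gives a local inequality.  It is applied on increasing chains of cubes:
   either the cubes grow to infinite measure or the smallness of the support of f
   applies, and in both cases the averages of |f| over the large cubes are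
   absorbed.

   Only the second variable is then extrapolated.  By Tonelli, the inequality
   with w = w_1(x') v(x'') reads int phi v dmu_2 <= N int gamma v dmu_2 for every
   v in A_s(mu_2), where phi and gamma are the integrals of |f|^p w_1 and
   |g|^p w_1 over the slices.  Let r = q/p and let G be a majorant of h, with
   int G^t w_2 <= 2 int h^t w_2, whose averages with respect to w_2 dmu_2 over
   balls are bounded by a constant times its values there (Rubio de Francia
   iteration).  For r > 1 one takes h = phi^(r-1) and v = G w_2; for r < 1 one takes
   h = max(e phi, gamma)^(r/2) and v = G^(-a) w_2 with a = 2(1-r)/r, and the term
   with phi is absorbed for small e.  Since A_s increases with s, keeping the
   constant, one exponent s serves all the weights. *)
Require Import Defs.
From HB Require Import structures.
From mathcomp Require Import all_boot all_order all_algebra.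
From mathcomp Require Import all_classical all_reals all_analysis.
From mathcomp Require Import measurable_realfun.
From mathcomp Require Import ring lra.

Set Implicit Arguments.
Unset Strict Implicit.
Unset Printing Implicit Defensive.

Import Order.TTheory GRing.Theory Num.Theory.
Import numFieldNormedType.Exports.

Local Open Scope classical_set_scope.
Local Open Scope ring_scope.

(** The passage from small [mu]-measure to small [nu]-measure uses no reverse Hölder inequality. The
    [A_s] condition only says that half of a cube cannot carry almost all of its weight; iterated
    through stopping cubes, this gives a factor [c0 ^+ n.+1] for sets of relative measure at most
    [(2 * (2 * Cd) ^+ n)^-1], and [n] is taken so large that this factor beats the growth (K3 + 2)^p
    from one level to the next. Every absorption needs finite quantities: level sums are truncated,
    and in the extrapolation the integral of [phi * v] must be finite before the one-weight
    inequality applies. For r > 1 Hölder's inequality ensures this; for r < 1 it is the reason why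
    [phi] enters the majorized function. Increasing chains of cubes need not exhaust [X] (think of
    quadrants in the plane), so the global estimate is proved on the union of each chain and then
    summed. The norms live on the completed product, to which Tonelli's theorem must first be
    carried over. *)

Import HBNNSimple.

(** * Measures given by a density *)

Section density.
Local Open Scope ereal_scope.
Context d (T : measurableType d) (R : realType).
Variables (mu : {measure set T -> \bar R}) (w : T -> \bar R).
Hypotheses (mw : measurable_fun setT w) (w_ge0 : forall x, 0 <= w x).

Let dens (A : set T) : \bar R := \int[mu]_(x in A) w x.

Let dens0 : dens set0 = 0. Proof. exact: integral_set0. Qed.

Let dens_ge0 A : 0 <= dens A. Proof. exact: integral_ge0. Qed.

Let dens_sigma_additive : semi_sigma_additive dens.
Proof.
move=> F mF tF mUF; rewrite /dens ge0_integral_bigcup//.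
  apply: is_cvg_nneseries => n _ _; exact: integral_ge0.
exact: measurable_funTS.
Qed.

HB.instance Definition _ :=
  isMeasure.Build _ _ _ dens dens0 dens_ge0 dens_sigma_additive.

Let dens_nnsfun (h : {nnsfun T >-> R}) :
  \int[dens]_x (h x)%:E = \int[mu]_x ((h x)%:E * w x).
Proof.
have ind_ge0 r x : 0 <= (r * \1_(h @^-1` [set r]) x)%:E.
  rewrite indicE lee_fin; case: (boolP (x \in _)) => [|_]; last by rewrite mulr0.
  by rewrite inE /= => <-; rewrite mulr1.
rewrite integralT_nnsfun sintegralE.
under [RHS]eq_integral => x _.
  rewrite fimfunE -fsumEFin// ge0_mule_fsuml; last first.
    by move=> y; exact: ind_ge0.
  over.
rewrite ge0_integral_fsum//; last 2 first.
  - move=> y; apply: emeasurable_funM => //; apply/measurable_EFinP.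
    by apply: measurable_funM => //; apply: measurable_indic.
  - by move=> n x _; rewrite mule_ge0// ind_ge0.
apply: eq_fsbigr => r; rewrite inE => -[x0 _ rh].
under [RHS]eq_integral do rewrite EFinM -muleA.
rewrite ge0_integralZl//; last 3 first.
- apply: emeasurable_funM => //; exact/measurable_EFinP.
- by move=> x _; rewrite mule_ge0// lee_fin.
- by rewrite -rh lee_fin.
congr (_ * _).
transitivity (\int[mu]_(x in h @^-1` [set r]) w x) => //.
rewrite integral_mkcond; apply: eq_integral => x _.
by rewrite epatch_indic muleC.
Qed.

(** Weights act through a genuine measure, so that monotonicity, null sets and countable additivity
    hold for [w dmu]. The integral formula is checked on simple functions and passes to limits by
    monotone convergence; [w] may take the value +oo. *)
Lemma density_measure : exists nu : {measure set T -> \bar R},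
  (forall A, nu A = \int[mu]_(x in A) w x) /\
  forall D h, measurable D -> measurable_fun D h -> (forall x, D x -> 0 <= h x) ->
    \int[nu]_(x in D) h x = \int[mu]_(x in D) (h x * w x).
Proof.
exists (dens : {measure set T -> \bar R}); split=> // D h mD mh h0.
rewrite integral_mkcond [RHS]integral_mkcond.
have -> : (fun x => h x * w x) \_ D = (fun x => (h \_ D) x * w x).
  by apply/funext => x; rewrite /patch; case: ifP => // _; rewrite mul0e.
have mg : measurable_fun setT (h \_ D) by exact/(measurable_restrictT h).
have g0 x : setT x -> 0 <= (h \_ D) x by move=> _; exact: erestrict_ge0.
set g := h \_ D in mg g0 *.
pose G := nnsfun_approx measurableT mg.
have Gg x : EFin \o G ^~ x @ \oo --> g x by exact: cvg_nnsfun_approx.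
have Gnd x : {homo (fun n => G n x) : n m / (n <= m)%N >-> (n <= m)%R}.
  by move=> n m nm; exact/lefP/nd_nnsfun_approx.
transitivity (limn (fun n => \int[dens]_x (G n x)%:E)).
  rewrite -monotone_convergence//; last 3 first.
  - by move=> n; exact/measurable_EFinP.
  - by move=> n x _; rewrite lee_fin.
  - by move=> x _ n m nm; rewrite lee_fin; exact: Gnd.
  by apply: eq_integral => x _; apply/esym/cvg_lim => //; exact: Gg.
under eq_fun do rewrite dens_nnsfun.
rewrite -monotone_convergence//; last 3 first.
- by move=> n; apply: emeasurable_funM => //; exact/measurable_EFinP.
- by move=> n x _; rewrite mule_ge0// lee_fin.
- by move=> x _ n m nm; rewrite lee_wpmul2r// lee_fin; exact: Gnd.
apply: eq_integral => x _; apply/cvg_lim => //.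
(* Products are not continuous at 0 times +oo. If one factor is 0, the approximating products are
   constantly 0, since the approximants lie below [g]. *)
have [wx0|wx0] := eqVneq (w x) 0.
  rewrite wx0 mule0; under eq_fun do rewrite mule0; exact: cvg_cst.
have [gx0|gx0] := eqVneq (g x) 0.
  have Gx0 n : G n x = 0%R.
    suff : (G n x)%:E <= 0.
      by rewrite lee_fin => Gn; apply/eqP; rewrite eq_le Gn fun_ge0.
    rewrite -gx0 -(cvg_lim _ (Gg x))//.
    rewrite (cvg_lim _ (ereal_nondecreasing_cvgn _))//.
      by apply: ereal_sup_ubound; exists n.
    by move=> i j ij; rewrite /= lee_fin; exact: Gnd.
  rewrite gx0 mul0e; under eq_fun do rewrite Gx0 mul0e; exact: cvg_cst.
apply: cvgeM => //; last exact: cvg_cst.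
rewrite /mule_def; move: gx0 wx0; case: (g x) => [a| |]; case: (w x) => [b| |] //=;
  by rewrite ?eqe => /negbTE-> /negbTE->; rewrite ?andbF ?orbF.
exact: Gg.
Qed.

End density.

(** * Young and Hölder inequalities for extended values *)

Section holder.
Local Open Scope ereal_scope.
Context d (T : measurableType d) (R : realType).
Implicit Types (mu : {measure set T -> \bar R}) (u v : T -> \bar R).

Lemma young_powR (th a b : R) : (0 < th < 1 -> 0 <= a -> 0 <= b ->
  a `^ th * b `^ (1 - th) <= th * a + (1 - th) * b)%R.
Proof.
move=> /andP[th0 th1] a0 b0.
have th1' : (0 < 1 - th)%R by rewrite subr_gt0.
have := @conjugate_powR R (a `^ th)%R (b `^ (1 - th))%R th^-1%R (1 - th)^-1%R
  (powR_ge0 _ _) (powR_ge0 _ _).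
rewrite !invr_gt0 !invrK => /(_ th0 th1').
rewrite addrCA subrr addr0 => /(_ erefl) /le_trans; apply.
by rewrite -!powRrM !divff ?gt_eqF// !powRr1// mulrC [(b * _)%R]mulrC.
Qed.

Lemma poweR_le (r : R) (a b : \bar R) : (0 <= r)%R -> 0 <= a -> a <= b ->
  a `^ r <= b `^ r.
Proof.
move=> r0 a0 ab; apply: gt0_ler_poweR => //; rewrite in_itv /= leey andbT//.
exact: le_trans ab.
Qed.

(** Young's inequality for [a / U] and [b / V]. With [U] and [V] the integrals of the two factors,
    the right side integrates to exactly the Hölder bound. *)
Lemma young_poweR (th U V : R) (a b : \bar R) : (0 < th < 1)%R ->
  (0 < U)%R -> (0 < V)%R -> 0 <= a -> 0 <= b ->
  a `^ th * b `^ (1 - th) <=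
  (U `^ th * V `^ (1 - th))%:E * ((th / U)%:E * a + ((1 - th) / V)%:E * b).
Proof.
move=> th01 U0 V0; have /andP[th0 th1] := th01.
have th1' : (0 < 1 - th)%R by rewrite subr_gt0.
have UV0 : (0 < U `^ th * V `^ (1 - th))%R by rewrite mulr_gt0// powR_gt0.
have tU0 : (0 < th / U)%R by rewrite divr_gt0.
have tV0 : (0 < (1 - th) / V)%R by rewrite divr_gt0.
case: a => [a| |]// => [|_].
  case: b => [b| |]// => [a0 b0|_ _]; last first.
    by rewrite gt0_muley ?lte_fin// addey// gt0_muley ?leey.
  rewrite !poweR_EFin -!EFinM lee_fin.
  have := @young_powR th (a / U) (b / V) th01 (divr_ge0 a0 (ltW U0)) (divr_ge0 b0 (ltW V0)).
  have VP x r : (0 < x -> x^-1 `^ r = (x `^ r)^-1)%R.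
    by move=> x0; rewrite -[(x^-1)%R]powR_inv1 ?ltW// -powRrM mulN1r powRN.
  rewrite !powRM ?invr_ge0// ?(ltW U0)// ?(ltW V0)// !VP// => H.
  rewrite -ler_pdivrMl//; apply: le_trans (le_trans H _).
    rewrite le_eqVlt; apply/orP; left; apply/eqP; rewrite invfM; ring.
  rewrite le_eqVlt; apply/orP; left; apply/eqP; ring.
move=> b0; rewrite [X in _ * (X + _)]gt0_muley ?lte_fin// addye; last first.
  by rewrite gt_eqF// (@lt_le_trans _ _ 0)// mule_ge0// lee_fin ltW.
by rewrite gt0_muley ?leey.
Qed.

(** Complementary exponents [th] and [1 - th] suit products of powers of weights and dual weights. A
    zero integral makes one factor vanish a.e.; an infinite one meets a positive partner, so the
    right side is +oo; otherwise the normalized Young inequality is integrated. *)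
Lemma holder_ereal mu (D : set T) u v (th : R) : (0 < th < 1)%R ->
  measurable D -> measurable_fun D u -> measurable_fun D v ->
  (forall x, D x -> 0 <= u x) -> (forall x, D x -> 0 <= v x) ->
  \int[mu]_(x in D) (u x `^ th * v x `^ (1 - th)) <=
  (\int[mu]_(x in D) u x) `^ th * (\int[mu]_(x in D) v x) `^ (1 - th).
Proof.
move=> th01 mD mu' mv u0 v0; have /andP[th0 th1] := th01.
have th1' : (0 < 1 - th)%R by rewrite subr_gt0.
have mP r h : measurable_fun D h -> measurable_fun D (fun x => h x `^ r).
  by move=> mh; exact: (measurableT_comp (measurable_poweR r)).
have mF : measurable_fun D (fun x => u x `^ th * v x `^ (1 - th)).
  by apply: emeasurable_funM; exact: mP.
have F0 x : D x -> 0 <= u x `^ th * v x `^ (1 - th).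
  by move=> _; rewrite mule_ge0// poweR_ge0.
have ae0 h r : (0 < r)%R -> measurable_fun D h -> (forall x, D x -> 0 <= h x) ->
    \int[mu]_(x in D) h x = 0 -> ae_eq mu D (fun x => h x `^ r) (cst 0).
  move=> r0 mh h0 ih.
  have /(ae_eq_integral_abs mu mD mh) : \int[mu]_(x in D) `|h x| = 0.
    by rewrite -ih; apply: eq_integral => x; rewrite inE => Dx; rewrite gee0_abs// h0.
  by apply: filterS => x H Dx; rewrite H//= powR0 ?gt_eqF.
have Fz : ae_eq mu D (fun x => u x `^ th * v x `^ (1 - th)) (cst 0) ->
    \int[mu]_(x in D) (u x `^ th * v x `^ (1 - th)) = 0.
  move=> H; rewrite -(integral0 mu D); apply: ge0_ae_eq_integral => //.
have [U0|U0] := eqVneq (\int[mu]_(x in D) u x) 0.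
  rewrite Fz ?mule_ge0 ?poweR_ge0//.
  by apply: filterS (ae0 u th th0 mu' u0 U0) => x H Dx; rewrite H// mul0e.
have [V0|V0] := eqVneq (\int[mu]_(x in D) v x) 0.
  rewrite Fz ?mule_ge0 ?poweR_ge0//.
  by apply: filterS (ae0 v (1 - th)%R th1' mv v0 V0) => x H Dx; rewrite H// mule0.
have {}U0 : 0 < \int[mu]_(x in D) u x by rewrite lt0e U0 integral_ge0.
have {}V0 : 0 < \int[mu]_(x in D) v x by rewrite lt0e V0 integral_ge0.
have [->|Uoo] := eqVneq (\int[mu]_(x in D) u x) +oo.
  by rewrite poweRyr ?gt_eqF// gt0_mulye ?leey// poweR_gt0.
have [->|Voo] := eqVneq (\int[mu]_(x in D) v x) +oo.
  by rewrite poweRyr ?gt_eqF// gt0_muley ?leey// poweR_gt0.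
set U := fine (\int[mu]_(x in D) u x); set V := fine (\int[mu]_(x in D) v x).
have UE : \int[mu]_(x in D) u x = U%:E by rewrite fineK// gt0_fin_numE ?ltey.
have VE : \int[mu]_(x in D) v x = V%:E by rewrite fineK// gt0_fin_numE ?ltey.
rewrite UE lte_fin in U0; rewrite VE lte_fin in V0.
have tU0 : (0 < th / U)%R by rewrite divr_gt0.
have tV0 : (0 < (1 - th) / V)%R by rewrite divr_gt0.
have UV0 : (0 < U `^ th * V `^ (1 - th))%R by rewrite mulr_gt0// powR_gt0.
have mU : measurable_fun D (fun x => (th / U)%:E * u x) by exact: measurable_funeM.
have mV : measurable_fun D (fun x => ((1 - th) / V)%:E * v x) by exact: measurable_funeM.
have U1 x : D x -> 0 <= (th / U)%:E * u x.
  by move=> Dx; rewrite mule_ge0 ?u0// lee_fin ltW.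
have V1 x : D x -> 0 <= ((1 - th) / V)%:E * v x.
  by move=> Dx; rewrite mule_ge0 ?v0// lee_fin ltW.
apply: (@le_trans _ _ (\int[mu]_(x in D) ((U `^ th * V `^ (1 - th))%:E *
    ((th / U)%:E * u x + ((1 - th) / V)%:E * v x)))).
  apply: ge0_le_integral => //.
  - by apply: measurable_funeM; exact: emeasurable_funD.
  - by move=> x Dx; apply: young_poweR; rewrite ?u0 ?v0//.
rewrite ge0_integralZl//; [|exact: emeasurable_funD|by move=> x Dx; rewrite adde_ge0 ?U1 ?V1|
  by rewrite lee_fin ltW].
rewrite ge0_integralD// !ge0_integralZl//; try by rewrite lee_fin ltW.
rewrite UE VE.
have -> : (th / U)%:E * U%:E + ((1 - th) / V)%:E * V%:E = 1 :> \bar R.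
  by rewrite -!EFinM -EFinD !divfK ?gt_eqF// addrCA subrr addr0.
by rewrite mule1 EFinM.
Qed.

End holder.

(** * Countable disjoint families of sets *)

Section countable_families.
Local Open Scope ereal_scope.
Context d (T : measurableType d) (R : realType).
Implicit Types (mu : {measure set T -> \bar R}) (C : set (set T)).

Definition pairwise_disjoint C :=
  forall A B, C A -> C B -> A `&` B !=set0 -> A = B.

Lemma countable_disjoint_seq C : countable C -> exists F : (set T)^nat,
  [/\ forall n, F n = set0 \/ C (F n), \bigcup_n F n = \bigcup_(A in C) A,
      (forall A, C A -> exists n, F n = A) &
      pairwise_disjoint C -> trivIset setT F].
Proof.
move=> /countable_injP[f finj].
pose F n : set T := [set x | exists A, [/\ C A, f A = n & A x]].
have FE A : C A -> F (f A) = A.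
  move=> CA; apply/seteqP; split=> [x [B [CB fBA Bx]]|x Ax]; last by exists A.
  by rewrite -(finj _ _ _ _ fBA)// inE.
exists F; split.
- move=> n; have [[A [CA fA]]|H] := pselect (exists A, C A /\ f A = n).
    by right; rewrite -fA FE.
  by left; apply/seteqP; split=> // x [A [CA fA _]]; apply: H; exists A.
- apply/seteqP; split=> x [n].
    by move=> _ [A [CA _ Ax]]; exists A.
  by move=> Cn nx; exists (f n) => //; rewrite FE.
- by move=> A CA; exists (f A); exact: FE.
- move=> dC i j _ _ [x [[A [CA <- Ax]] [B [CB <- Bx]]]].
  by rewrite (dC A B)//; exists x.
Qed.

Lemma bigcup_countable_measurable C : countable C -> C `<=` measurable ->
  measurable (\bigcup_(A in C) A).
Proof.
move=> /countable_disjoint_seq[F [FC <- _ _]] mC; apply: bigcupT_measurable => n.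
by have [->|/mC//] := FC n.
Qed.

(** This is how an estimate on each stopping cube, or on each component, is summed. *)
Lemma le_measure_bigcup (m1 m2 : {measure set T -> \bar R}) (c : R) C E1 E2 :
  (0 <= c)%R -> countable C -> C `<=` measurable -> pairwise_disjoint C ->
  measurable E1 -> measurable E2 ->
  (forall A, C A -> m1 (A `&` E1) <= c%:E * m2 (A `&` E2)) ->
  m1 (\bigcup_(A in C) A `&` E1) <= c%:E * m2 (\bigcup_(A in C) A `&` E2).
Proof.
move=> c0 /countable_disjoint_seq[F [FC FE _ tF]] mC /tF{}tF mE1 mE2 H.
have mF n : measurable (F n) by have [->|/mC//] := FC n.
rewrite -FE !setI_bigcupl !measure_bigcup//; [|by move=> i _; exact: measurableI|
  exact: trivIset_setIr|by move=> i _; exact: measurableI|exact: trivIset_setIr].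
rewrite -nneseriesZl//; apply: lee_nneseries => // n _.
have [->|/H] := FC n; last by [].
by rewrite !set0I !measure0 mule0.
Qed.

(** In a set [F k] of finite measure only finitely many disjoint members can leave a trace of
    measure at least 1 / (n + 1), and a member of positive measure leaves such a trace for some [k]
    and [n]. *)
Lemma countable_positive_disjoint mu C (F : (set T)^nat) :
  (forall k, measurable (F k) /\ mu (F k) < +oo) ->
  (forall A, C A -> [/\ measurable A, 0 < mu A & A `<=` \bigcup_k F k]) ->
  pairwise_disjoint C -> countable C.
Proof.
move=> hF hC dC.
pose D (k n : nat) := [set A | C A /\ (n.+1%:R^-1)%:E <= mu (A `&` F k)].
suff fD k n : finite_set (D k n).
  apply: (@sub_countable _ _ C (\bigcup_k \bigcup_n D k n)); last first.
    by apply: bigcup_countable => // k _; apply: bigcup_countable => // n _;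
       exact: finite_set_countable.
  apply: subset_card_le => A CA; have [mA A0 AF] := hC A CA.
  have [k k0] : exists k, 0 < mu (A `&` F k).
    apply/not_existsP => H.
    have : mu A = 0.
      have -> : A = \bigcup_k (A `&` F k).
        by rewrite -setI_bigcupr; apply/esym/setIidPl.
      apply/negligibleP.
        by apply: bigcupT_measurable => k; apply: measurableI => //; exact: (hF k).1.
      apply: negligible_bigcup => k; apply/negligibleP.
        by apply: measurableI => //; exact: (hF k).1.
      by apply/eqP; rewrite eq_le measure_ge0 andbT leNgt; apply/negP/(H k).
    by move=> mA0; rewrite mA0 ltxx in A0.
  exists k => //.
  have finAF : mu (A `&` F k) \is a fin_num.
    rewrite ge0_fin_numE//; apply: le_lt_trans (hF k).2.
    by apply: le_measure; rewrite ?inE//; [apply: measurableI => //|]; exact: (hF k).1.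
  have r0 : (0 < fine (mu (A `&` F k)))%R by rewrite fine_gt0// k0 ltey_eq finAF.
  have [n _ Hn] := near_infty_natSinv_lt (PosNum r0).
  exists n => //; split => //; rewrite -(fineK finAF) lee_fin.
  exact/ltW/(Hn n)/leqnn.
apply: contrapT => /infiniteP/ppcard_leP[f].
pose A i : set T := f i.
have DA i : D k n (A i) by exact: (@funS _ _ _ _ f).
have tA : trivIset setT (fun i => A i `&` F k).
  apply: trivIset_setIr => i j _ _ Aij.
  have := dC _ _ (DA i).1 (DA j).1 Aij.
  by move=> /(@inj _ _ _ f); rewrite !inE; exact.
have mA i : measurable (A i `&` F k).
  by apply: measurableI; [have [] := hC _ (DA i).1|exact: (hF k).1].
have : \sum_(0 <= i <oo) mu (A i `&` F k) <= mu (F k).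
  rewrite [X in X <= _](_ : _ = mu (\bigcup_i (A i `&` F k))); last first.
    rewrite measure_bigcup//.
    by apply: eq_eseriesl => i; rewrite in_setT.
  apply: le_measure; rewrite ?inE; last by move=> x [i _ []].
    exact: bigcupT_measurable.
  exact: (hF k).1.
have Fkfin : mu (F k) \is a fin_num by rewrite ge0_fin_numE//; exact: (hF k).2.
pose M := fine (mu (F k)); rewrite -(fineK Fkfin) -/M => H.
have M0 : (0 <= M)%R by exact: fine_ge0.
(* More than M (n + 1) disjoint traces would have total measure above [M]. *)
pose N := (Num.truncn (M * n.+1%:R)).+1.
have : (N%:R / n.+1%:R)%:E <= M%:E.
  apply: (@le_trans _ _ (\sum_(0 <= i < N) mu (A i `&` F k))).
    have -> : (N%:R / n.+1%:R = \sum_(0 <= i < N) n.+1%:R^-1 :> R)%R.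
      by rewrite sumr_const_nat subn0 mulr_natl.
    rewrite -sumEFin.
    by apply: lee_sum => i _; have [] := DA i.
  by apply: le_trans H; apply: nneseries_lim_ge.
rewrite lee_fin ler_pdivrMr// leNgt => /negP; apply.
by rewrite truncnS_gt// mulr_ge0.
Qed.

End countable_families.

(** * Discrete layer-cake sums *)

Section levels.
Variable R : realType.
Implicit Types (A B s tau z : R) (a : \bar R).

(** A geometric sum with ratio above 1 is comparable to its largest term, and the largest term
    counted is at most [z]. *)
Lemma geometric_sum_threshold B z n : 1 < B -> 0 <= z ->
  \sum_(k < n) B ^+ k * (B ^+ k <= z)%R%:R <= B / (B - 1) * z.
Proof.
move=> B1 z0; have B10 : 0 < B - 1 by rewrite subr_gt0.
have B0 : 0 < B by exact: lt_trans B1.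
have bound m : \sum_(k < m) B ^+ k * (B ^+ k <= z)%R%:R <= (B ^+ m - 1) / (B - 1).
  elim: m => [|m IH]; first by rewrite big_ord0 expr0 subrr mul0r.
  rewrite big_ord_recr /=.
  apply: (@le_trans _ _ ((B ^+ m - 1) / (B - 1) + B ^+ m)).
    by apply: lerD => //; case: (_ <= z); rewrite ?mulr1// mulr0 exprn_ge0// ltW.
  rewrite le_eqVlt exprS; apply/orP; left; apply/eqP; field.
  by rewrite gt_eqF.
elim: n => [|n IH].
  by rewrite big_ord0 mulr_ge0// divr_ge0// ltW.
have [Bz|Bz] := leP (B ^+ n) z; last first.
  by rewrite big_ord_recr /= (lt_geF Bz) mulr0 addr0.
apply: le_trans (bound _) _; rewrite exprS mulrAC ler_pM2r ?invr_gt0//.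
by rewrite (@le_trans _ _ (B * B ^+ n))// ?gerBl// ler_pM2l.
Qed.

Lemma powR_scale_level A s tau k : 0 < A -> 0 <= tau ->
  (A ^+ k * tau) `^ s = (A `^ s) ^+ k * tau `^ s.
Proof.
move=> A0 tau0; rewrite powRM ?exprn_ge0 ?(ltW A0)//; congr (_ * _).
by rewrite -(powR_mulrn _ (ltW A0)) -(powR_mulrn _ (powR_ge0 A s)); exact: powRAC.
Qed.

Lemma level_sum_le A s tau a n : 1 < A -> 0 < s -> 0 < tau -> (0 <= a)%E ->
  ((\sum_(k < n) (A ^+ k * tau) `^ s * ((A ^+ k * tau)%:E <= a)%E%:R)%:E <=
  (A `^ s / (A `^ s - 1))%:E * a `^ s)%E.
Proof.
move=> A1 s0 tau0; have A0 : 0 < A by exact: lt_trans A1.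
have B1 : 1 < A `^ s.
  have <- : 1 `^ s = 1 :> R by rewrite powR1.
  by rewrite gt0_ltr_powR// nnegrE ltW.
have c0 : 0 < A `^ s / (A `^ s - 1).
  by rewrite divr_gt0 ?subr_gt0// (lt_trans _ B1).
case: a => [a| |]// => [|_]; last by rewrite poweRyr ?gt_eqF// gt0_muley ?lte_fin// leey.
rewrite lee_fin => a0; rewrite poweR_EFin -EFinM lee_fin.
have t0 : 0 < tau `^ s by rewrite powR_gt0.
have := @geometric_sum_threshold (A `^ s) (a `^ s / tau `^ s) n B1.
rewrite divr_ge0 ?powR_ge0// => /(_ isT).
rewrite mulrA ler_pdivlMr// mulr_suml; apply: le_trans.
apply: ler_sum => k _; rewrite powR_scale_level// ?(ltW tau0)// -mulrA -[leRHS]mulrA.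
rewrite ler_pM2l ?exprn_gt0// ?(lt_trans _ B1)// mulrC ler_pM2r//.
rewrite ler_nat; case: (leP (A ^+ k * tau)%:E a%:E) => //; rewrite lee_fin => Aa.
rewrite ler_pdivlMr//.
have H : (A `^ s) ^+ k * tau `^ s <= a `^ s.
  rewrite -powR_scale_level ?(ltW tau0)//; apply: ge0_ler_powR; rewrite ?nnegrE ?(ltW s0)//.
  by rewrite mulr_ge0 ?(ltW tau0)// exprn_ge0// ltW.
by rewrite H.
Qed.

(** When [tau < a], the last level below [a], moved up by one factor [A], dominates the truncated
    value. The truncation makes finitely many levels suffice, which keeps the sums to be absorbed
    finite. *)
Lemma level_cover A s tau a n : 1 < A -> 0 < s -> 0 < tau -> (0 <= a)%E ->
  (0 < n)%N ->
  ((Order.min a (A ^+ n * tau)%:E) `^ s * (tau%:E < a)%E%:R%:E <=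
  (\sum_(k < n) (A ^+ k.+1 * tau) `^ s * ((A ^+ k * tau)%:E < a)%E%:R)%:E)%E.
Proof.
move=> A1 s0 tau0 a0; have A0 : 0 < A by exact: lt_trans A1.
have l0 k : 0 <= A ^+ k * tau by rewrite ltW// mulr_gt0// exprn_gt0.
have minc0 k : (0 <= Order.min a (A ^+ k * tau)%:E)%E by rewrite le_min a0 lee_fin l0.
have top m : ((Order.min a (A ^+ m * tau)%:E) `^ s <= ((A ^+ m * tau) `^ s)%:E)%E.
  by rewrite -poweR_EFin poweR_le ?(ltW s0)// ge_min lexx orbT.
have S0 m : (0 <= (\sum_(k < m) (A ^+ k.+1 * tau) `^ s * ((A ^+ k * tau)%:E < a)%E%:R))%R.
  by apply: sumr_ge0 => k _; rewrite mulr_ge0// powR_ge0.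
elim: n => // -[_ _|n IH _].
  rewrite big_ord1 /= expr0 mul1r.
  by case: (tau%:E < a)%E; rewrite ?mule1 ?mulr1 ?mulr0 ?mule0.
rewrite big_ord_recr /=; case: (ltP (A ^+ n.+1 * tau)%:E a) => [la|al].
  rewrite mulr1; case: (tau%:E < a)%E; last first.
    by rewrite mule0 lee_fin addr_ge0 ?powR_ge0 ?S0.
  rewrite mule1 EFinD.
  apply: (le_trans (top _)); rewrite leeDr// lee_fin; exact: S0.
rewrite mulr0 addr0; apply: le_trans (IH isT).
rewrite lee_wpmul2r ?lee_fin// poweR_le ?(ltW s0)//.
by rewrite le_min ge_min lexx/= (le_trans _ al)// ge_min lexx.
Qed.


End levels.

(** * Stopping cubes in a dyadic tree *)

Section dyadic_tree.
Local Open Scope ereal_scope.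
Context d (T : measurableType d) (R : realType).
Variables (mu : {measure set T -> \bar R}) (D : nat -> set (set T)) (Q0 : set T)
  (Cd : R).

(** What the stopping argument uses of the cubes below [Q0]. Almost everywhere covering enters
    later, through density points with respect to [nu]. The same set may occur in several
    generations. *)
Record dyadic_tree : Prop := DyadicTree {
  dt_root : D 0%N = [set Q0] ;
  dt_measurable : forall k A, D k A -> measurable A ;
  dt_gt0 : forall k A, D k A -> 0 < mu A ;
  dt_fin : forall k A, D k A -> mu A < +oo ;
  dt_disjoint : forall k, pairwise_disjoint (D k) ;
  dt_parent : forall k A, D k.+1 A ->
    exists P, [/\ D k P, A `<=` P & mu P <= Cd%:E * mu A] ;
  dt_countable : forall k, countable (D k) }.

Hypotheses (tree : dyadic_tree) (Cd_ge1 : (1 <= Cd)%R).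

Definition cube (A : set T) := exists k, D k A.

Let cube_measurable A : cube A -> measurable A.
Proof. by move=> [k]; exact: dt_measurable. Qed.

Let cube_neq0 A : cube A -> A !=set0.
Proof.
move=> [k DA]; apply/set0P/eqP => A0.
by have := dt_gt0 tree DA; rewrite A0 measure0 ltxx.
Qed.

Let cube_countable : countable cube.
Proof.
apply: (@sub_countable _ _ _ (\bigcup_k D k)).
  by apply: subset_card_le => A [k DA]; exists k.
by apply: bigcup_countable => // k _; exact: dt_countable.
Qed.

Lemma dt_nested k l A B : (k <= l)%N -> D k A -> D l B -> A `&` B !=set0 ->
  B `<=` A.
Proof.
move=> /subnK <-; elim: (l - k)%N B => [|n IH] B DA DB AB.
  by rewrite (dt_disjoint tree DA DB AB).
have [P [DP BP _]] := dt_parent tree DB.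
apply: (subset_trans BP); apply: IH => //.
by case: AB => x [Ax Bx]; exists x; split => //; exact: BP.
Qed.

Section stopping.
Variables (P : set T) (m : {measure set T -> \bar R}).

(** [Omega] is the level set of the dyadic maximal function of [m] relative to [mu] inside [P].
    Taking a measure for [m] covers |f| dmu, |fP - a| dmu and the restriction of [mu] to a set. *)
Definition bad (lam : R) := [set A | [/\ cube A, A `<=` P & lam%:E * mu A < m A]].

Definition maxbad (lam : R) :=
  [set A | bad lam A /\ forall B, bad lam B -> B `&` A !=set0 -> B `<=` A].

Definition Omega (lam : R) := \bigcup_(A in bad lam) A.

(** Generations are bounded below by 0, so among the bad cubes containing [A] there is one of least
    generation; by nesting it contains every bad cube that it meets. *)
Lemma maxbad_cover lam A : bad lam A -> exists2 M, maxbad lam M & A `<=` M.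
Proof.
move=> bA; pose S k := `[< exists M, [/\ D k M, bad lam M & A `<=` M] >].
have [k0 Sk0] : exists k, S k.
  by have [[k DA] _ _] := bA; exists k; apply/asboolP; exists A; split.
have exS : exists k, S k by exists k0.
case: (ex_minnP exS) => k /asboolP[M [DM bM AM]] kmin.
exists M => //; split => // B bB BM.
have [[l DB] BP _] := bB.
have [kl|lk] := leqP k l; first by apply: (dt_nested kl DM DB); rewrite setIC.
have MB : M `<=` B by apply: (dt_nested (ltnW lk) DB DM).
have := kmin l; rewrite leqNgt lk => /(_ _)/negP H.
by exfalso; apply: H => //; apply/asboolP; exists B; split => // x /AM/MB.
Qed.

Lemma OmegaE lam : Omega lam = \bigcup_(A in maxbad lam) A.
Proof.
apply/seteqP; split=> [x [A bA Ax]|x [A [bA _] Ax]]; last by exists A.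
by have [M mM AM] := maxbad_cover bA; exists M => //; exact: AM.
Qed.

Lemma maxbad_cube lam A : maxbad lam A -> cube A.
Proof. by move=> [[]]. Qed.

Lemma maxbad_disjoint lam : pairwise_disjoint (maxbad lam).
Proof.
move=> A B [bA mA] [bB mB] AB; apply/seteqP; split; first exact: mB.
by apply: mA => //; rewrite setIC.
Qed.

Lemma maxbad_countable lam : countable (maxbad lam).
Proof.
apply: (sub_countable _ cube_countable); apply: subset_card_le => A.
exact: maxbad_cube.
Qed.

Lemma maxbad_measurable lam : maxbad lam `<=` measurable.
Proof. by move=> A /maxbad_cube; exact: cube_measurable. Qed.

Lemma Omega_measurable lam : measurable (Omega lam).
Proof.
rewrite OmegaE; apply: bigcup_countable_measurable; first exact: maxbad_countable.
exact: maxbad_measurable.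
Qed.

Lemma Omega_sub lam : Omega lam `<=` P.
Proof. by move=> x [A [_ AP _] /AP]. Qed.

(** The stopping rule fails one generation up. This turns bounds for averages over the parent into
    estimates on [A], at the price of [Cd]. *)
Lemma maxbad_parent lam A : cube P -> m P <= lam%:E * mu P -> maxbad lam A ->
  exists Pa, [/\ cube Pa, A `<=` Pa, Pa `<=` P, m Pa <= lam%:E * mu Pa &
     mu Pa <= Cd%:E * mu A].
Proof.
move=> [l DP] mP [bA Amax]; have [cA AP lA] := bA.
pose S k := `[< D k A >].
have [k0 Sk0] : exists k, S k by have [k DA] := cA; exists k; apply/asboolP.
have exS : exists k, S k by exists k0.
(* Taking the first generation in which [A] occurs makes its parent a strictly larger set, which by
   maximality of [A] is not bad. *)
case: (ex_minnP exS) => k /asboolP DA kmin.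
have [x Ax] := cube_neq0 cA.
have PA : P <> A by move=> PA; move: lA; rewrite -PA ltNge mP.
have [lk|kl] := ltnP l k; last first.
  exfalso; apply: PA; apply/seteqP; split => //.
  by apply: (dt_nested kl DA DP); exists x; split => //; exact: AP.
case: k kmin DA lk => // k kmin DA lk.
have [Pa [DPa APa muPa]] := dt_parent tree DA.
have PaP : Pa `<=` P.
  by apply: (dt_nested _ DP DPa) => //; exists x; split; [exact: AP|exact: APa].
exists Pa; split => //; first by exists k.
rewrite leNgt; apply/negP => lPa.
have bPa : bad lam Pa by split => //; exists k.
have PaA : Pa = A.
  by apply/seteqP; split => //; apply: Amax => //; exists x; split => //; exact: APa.
have /kmin : S k by apply/asboolP; rewrite -PaA.
by rewrite ltnn.
Qed.

Lemma Omega_weak_type lam : (0 <= lam)%R -> measurable P ->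
  lam%:E * mu (Omega lam) <= m P.
Proof.
move=> lam0 mP.
apply: (@le_trans _ _ (m (Omega lam))); last first.
  by apply: le_measure; rewrite ?inE//; [exact: Omega_measurable|exact: Omega_sub].
have [->|lamN0] := eqVneq lam 0%R; first by rewrite mul0e.
have {}lam0 : (0 < lam)%R by rewrite lt_neqAle eq_sym lamN0.
rewrite -lee_pdivlMl// OmegaE -[X in mu X]setIT -[X in m X]setIT.
apply: le_measure_bigcup => //; first by rewrite invr_ge0 ltW.
- exact: maxbad_countable.
- exact: maxbad_measurable.
- exact: maxbad_disjoint.
by move=> A [[_ _ lA] _]; rewrite !setIT lee_pdivlMl// ltW.
Qed.

(** A cube bad at level [lam'] is bad at level [lam]; if it meets the maximal cube [A], it lies in
    [A]. *)
Lemma Omega_localize lam lam' A : (lam <= lam')%R -> maxbad lam A ->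
  forall x, A x -> Omega lam' x -> exists B, [/\ cube B, B `<=` A, B x &
    lam'%:E * mu B < m B].
Proof.
move=> ll [_ Amax] x Ax [B [cB BP lB] Bx]; exists B; split => //.
apply: Amax; last by exists x.
by split => //; apply: le_lt_trans lB; rewrite lee_wpmul2r// lee_fin.
Qed.

End stopping.

Section Ainfty.
Variables (nu : {measure set T -> \bar R}) (c0 : R).
Hypotheses (c0_ge0 : (0 <= c0)%R) (c0_lt1 : (c0 < 1)%R).
Hypothesis nu_half : forall P E, cube P -> measurable E -> E `<=` P ->
  2%:E * mu E <= mu P -> nu E <= c0%:E * nu P.
Hypothesis nu_density : forall k E, measurable E -> E `<=` Q0 ->
  nu (E `\` \bigcup_(A in [set A | (exists2 l, (k <= l)%N & D l A) /\
                                   mu A < 2%:E * mu (A `&` E)]) A) = 0.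

Lemma cube_sub_root A : cube A -> A `<=` Q0.
Proof.
move=> cA; have [k DA] := cA; have [x Ax] := cube_neq0 cA.
elim: k A DA {cA} x Ax => [A|k IH A DA x Ax]; first by rewrite (dt_root tree) => -> x _ y.
have [P [DP AP _]] := dt_parent tree DA.
by apply: (subset_trans AP); apply: (IH _ DP x); exact: AP.
Qed.

Lemma density_measurable k E : measurable E ->
  measurable (\bigcup_(A in [set A | (exists2 l, (k <= l)%N & D l A) /\
                                   mu A < 2%:E * mu (A `&` E)]) A).
Proof.
move=> mE; apply: bigcup_countable_measurable.
  apply: (sub_countable _ cube_countable); apply: subset_card_le.
  by move=> A [[l _ DA] _]; exists l.
by move=> A [[l _ DA] _]; apply: cube_measurable; exists l.
Qed.

(** The stopping cubes of the indicator of [E] fill at most half of [P], hence carry at most the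
    fraction [c0] of its weight, and they contain [nu]-almost all of [E]. In each of them [E] is
    still sparse, with a factor [2 * Cd] less to spare, and the induction hypothesis supplies the
    remaining powers of [c0]. *)
Lemma tree_Ainfty n P E : cube P -> measurable E -> E `<=` P ->
  (2 * (2 * Cd) ^+ n)%:E * mu E <= mu P -> nu E <= (c0 ^+ n.+1)%:E * nu P.
Proof.
elim: n P E => [|n IH] P E cP mE EP muE.
  by rewrite expr1; apply: nu_half => //; move: muE; rewrite expr0 mulr1.
have C0 : (0 < Cd)%R by exact: lt_le_trans Cd_ge1.
(* Stopping at density 1 / L: the weak-type bound loses [L], which leaves the factor 2 for
   [nu_half]; passing from a parent to a stopping cube loses [Cd], which leaves the hypothesis for
   [n]. *)
pose L : R := (2 * (2 * Cd) ^+ n * Cd)%R.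
have L0 : (0 < L)%R by rewrite /L !mulr_gt0// exprn_gt0// mulr_gt0.
have LE : (2 * (2 * Cd) ^+ n.+1 = 2 * L)%R by rewrite /L exprS; ring.
rewrite LE in muE.
pose lam : R := L^-1%R.
have lam0 : (0 < lam)%R by rewrite invr_gt0.
pose mE' := mrestr mu mE : {measure set T -> \bar R}.
have mE'P : mE' P = mu E by rewrite /mE' /= /mrestr; congr (mu _); exact/setIidPr.
have muEP : mE' P <= lam%:E * mu P.
  rewrite mE'P -lee_pdivrMl ?invr_gt0// invrK; apply: le_trans muE.
  by rewrite lee_wpmul2r// lee_fin ler_peMl ?(ltW L0)// ler1n.
have OmP : nu (Omega P mE' lam) <= c0%:E * nu P.
  apply: nu_half => //; [exact: Omega_measurable|exact: Omega_sub|].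
  have := @Omega_weak_type P mE' lam (ltW lam0) (cube_measurable cP).
  rewrite mE'P -lee_pdivlMl ?invr_gt0// invrK => H.
  apply: le_trans muE; rewrite EFinM -muleA lee_pmul2l ?lte_fin//.
have [k DP] := cP.
(* By [nu_density], almost every point of [E] lies in a cube deep enough to be inside [P] and more
   than half filled by [E]; such a cube is bad because [L] is at least 2. *)
have EO : nu E <= nu (Omega P mE' lam `&` E).
  have := nu_density k mE (subset_trans EP (cube_sub_root cP)).
  set U := \bigcup_(A in _) A => nuEU.
  have mU : measurable U by exact: density_measurable.
  rewrite [leLHS](measureDI nu mE mU) [X in X + _](_ : _ = 0) ?add0e//.
  apply: le_measure; rewrite ?inE.
  - exact: measurableI.
  - by apply: measurableI => //; exact: Omega_measurable.
  move=> x [Ex [A [[l kl DA] muA] Ax]]; split => //; exists A => //; split.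
  + by exists l.
  + by apply: (dt_nested kl DP DA); exists x; split => //; exact: EP.
  + rewrite /mE' /= /mrestr -lte_pdivlMl ?invr_gt0// invrK.
    apply: lt_le_trans muA _; rewrite lee_wpmul2r// lee_fin /L -mulrA ler_peMr//.
    by rewrite mulr_ege1// exprn_ege1// mulr_ege1// ler1n.
apply: (le_trans EO).
apply: (@le_trans _ _ ((c0 ^+ n.+1)%:E * nu (Omega P mE' lam))); last first.
  rewrite [(c0 ^+ n.+2)%R]exprSr EFinM -muleA lee_wpmul2l// lee_fin exprn_ge0//.
rewrite OmegaE -[X in _ <= _ * nu X]setIT.
apply: le_measure_bigcup => //; first by rewrite exprn_ge0.
- exact: maxbad_countable.
- exact: maxbad_measurable.
- exact: maxbad_disjoint.
move=> A mA; rewrite setIT; apply: IH.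
- exact: maxbad_cube mA.
- by apply: measurableI => //; exact: maxbad_measurable mA.
- exact: subIsetl.
have [Pa [cPa APa PaP lPa muPa]] := maxbad_parent cP muEP mA.
have : mu (A `&` E) <= lam%:E * (Cd%:E * mu A).
  apply: (@le_trans _ _ (mE' Pa)).
    apply: le_measure; rewrite ?inE; last exact: setSI.
      by apply: measurableI => //; exact: maxbad_measurable mA.
    by apply: measurableI => //; exact: cube_measurable.
  by apply: (le_trans lPa); rewrite lee_wpmul2l// lee_fin ltW.
rewrite muleA -EFinM -lee_pdivrMl ?mulr_gt0//; congr (_%:E * _ <= _).
by rewrite /lam invfM invrK /L mulfK// gt_eqF.
Qed.

End Ainfty.
End dyadic_tree.

(** * Monotone limits and level sets under the integral *)

Section integral_limit.
Local Open Scope ereal_scope.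
Context d (T : measurableType d) (R : realType).

Lemma integral_lim_le (mu : {measure set T -> \bar R}) (D : set T)
    (u_ : (T -> \bar R)^nat) (u : T -> \bar R) (M : \bar R) :
  measurable D -> (forall n, measurable_fun D (u_ n)) ->
  (forall n x, D x -> 0 <= u_ n x) ->
  (forall x, D x -> {homo u_ ^~ x : n m / (n <= m)%N >-> n <= m}) ->
  (forall x, D x -> u_ n x @[n --> \oo] --> u x) ->
  (forall n, \int[mu]_(x in D) u_ n x <= M) -> \int[mu]_(x in D) u x <= M.
Proof.
move=> mD mu_ u0 und ucvg uM.
rewrite (eq_integral (fun x => limn (u_ ^~ x))); last first.
  by move=> x; rewrite inE => Dx; apply/esym/cvg_lim => //; exact: ucvg.
rewrite monotone_convergence//; apply: lime_le; last exact: nearW.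
apply: ereal_nondecreasing_is_cvgn => n m nm; apply: ge0_le_integral => //.
- by move=> x Dx; exact: u0.
- by move=> x Dx; exact: und.
Qed.

Lemma integral_level (nu : {measure set T -> \bar R}) (D : set T) (P : T -> bool)
    (c : R) : (0 <= c)%R -> measurable D -> measurable (D `&` [set x | P x]) ->
  measurable_fun D (fun x => (c * (P x)%:R)%:E) /\
  \int[nu]_(x in D) (c * (P x)%:R)%:E = c%:E * nu (D `&` [set x | P x]).
Proof.
move=> c0 mD mP.
have E x : x \in D -> (c * \1_(D `&` [set x | P x]) x)%:E = (c * (P x)%:R)%:E.
  rewrite inE => Dx; rewrite indicE.
  have -> // : (x \in D `&` [set x | P x]) = P x.
  by apply/idP/idP => [|Px]; rewrite inE// => -[].
split.
  apply: (eq_measurable_fun _ E); apply/measurable_EFinP.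
  by apply: measurable_funM => //; exact: measurable_indic.
rewrite -(eq_integral _ _ E); under eq_integral do rewrite EFinM.
rewrite ge0_integralZl//; last by apply/measurable_EFinP; exact: measurable_indic.
by rewrite integral_indic// -setIA [X in _ `&` X]setIC setIA setIid.
Qed.

End integral_limit.

(** Summing the recursion and shifting the index returns half of the sum on the right. All terms are
    real numbers, so this half can be moved to the left. *)
Lemma absorb_sum (R : realType) (B : R) (ra rb : nat -> R) (N : nat) :
  0 < B -> (forall k, 0 <= ra k) -> (forall k, 0 <= rb k) ->
  (forall k, B ^+ k.+1 * ra k.+1 <= 2^-1 * (B ^+ k * ra k) + B * (B ^+ k * rb k)) ->
  \sum_(k < N) B ^+ k * ra k <= 2 * ra 0%N + 2 * B * \sum_(k < N) B ^+ k * rb k.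
Proof.
move=> B0 ra0 rb0 H; set S := \sum_(k < N) _; set S' := \sum_(k < N) _.
have : S <= ra 0%N + (2^-1 * S + B * S').
  apply: (@le_trans _ _ (\sum_(k < N.+1) B ^+ k * ra k)).
    by rewrite big_ord_recr /= lerDl mulr_ge0// exprn_ge0// ltW.
  rewrite big_ord_recl expr0 mul1r lerD2l /S /S' !mulr_sumr -big_split /=.
  by apply: ler_sum => k _; exact: H.
lra.
Qed.

Lemma expr2_eventually_ge (R : realType) (z : R) : exists N, forall n, (N <= n)%N ->
  z <= 2 ^+ n.
Proof.
exists (Num.truncn `|z|).+1 => n Nn; apply: (le_trans (ler_norm z)).
apply/ltW/(lt_le_trans (truncnS_gt _)).
by rewrite -natrX ler_nat (leq_trans Nn)// ltnW// ltn_expl.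
Qed.

(** * The local estimate on one cube *)

Section local_fefferman_stein.
Local Open Scope ereal_scope.
Context d (T : measurableType d) (R : realType).
Variables (mu nu : {measure set T -> \bar R}) (D : nat -> set (set T)) (Q0 : set T)
  (Cd c0 : R).
Hypotheses (tree : dyadic_tree mu D Q0 Cd) (Cd_ge1 : (1 <= Cd)%R).
Hypotheses (c0_ge0 : (0 <= c0)%R) (c0_lt1 : (c0 < 1)%R).
Hypothesis nu_half : forall P E, cube D P -> measurable E -> E `<=` P ->
  2%:E * mu E <= mu P -> nu E <= c0%:E * nu P.
Hypothesis nu_density : forall k E, measurable E -> E `<=` Q0 ->
  nu (E `\` \bigcup_(A in [set A | (exists2 l, (k <= l)%N & D l A) /\
                                   mu A < 2%:E * mu (A `&` E)]) A) = 0.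
Hypothesis nuQ0 : nu Q0 < +oo.
Variables (K3 p : R) (f g : T -> R).
Hypotheses (K3_gt0 : (0 < K3)%R) (p_gt0 : (0 < p)%R).
Hypotheses (mf : measurable_fun Q0 f) (mg : measurable_fun Q0 g).
Hypothesis osc : forall P, cube D P -> exists (fP : T -> R) (m : R),
  [/\ measurable_fun P fP, forall x, P x -> (`|f x| <= fP x <= K3 * `|f x|)%R,
      \int[mu]_(x in P) (fP x)%:E = m%:E * mu P &
      forall y, P y -> \int[mu]_(x in P) `|fP x - m|%:E <= (g y)%:E * mu P].

Let cQ0 : cube D Q0. Proof. by exists 0%N; rewrite (dt_root tree). Qed.

Let cm A : cube D A -> measurable A.
Proof. by move=> [k DA]; exact: (dt_measurable tree DA). Qed.

Let cpos A : cube D A -> 0 < mu A.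
Proof. by move=> [k DA]; exact: (dt_gt0 tree DA). Qed.

Let cfin A : cube D A -> mu A \is a fin_num.
Proof. by move=> [k DA]; rewrite ge0_fin_numE//; exact: (dt_fin tree DA). Qed.

Let mQ0 : measurable Q0. Proof. exact: cm. Qed.

Let csub A : cube D A -> A `<=` Q0. Proof. exact: (cube_sub_root tree). Qed.

Let mnf : measurable_fun Q0 (fun x => `|f x|%:E).
Proof. by apply/measurable_EFinP; exact: measurableT_comp. Qed.

Let fmeas : exists m : {measure set T -> \bar R}, forall A, A `<=` Q0 ->
  m A = \int[mu]_(x in A) `|f x|%:E.
Proof.
have mpf : measurable_fun setT ((fun x => `|f x|%:E) \_ Q0).
  exact/(measurable_restrictT _ _).1.
have pf0 x : 0 <= ((fun x => `|f x|%:E) \_ Q0) x by exact: erestrict_ge0.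
have [m [mE _]] := density_measure mu mpf pf0.
exists m => A AQ; rewrite mE; apply: eq_integral => x; rewrite inE => Ax.
by rewrite patchE mem_set//; exact: AQ.
Qed.

Let mu_le_factor (a b : R) P : cube D P -> a%:E * mu P <= b%:E * mu P -> (a <= b)%R.
Proof.
by move=> cP; rewrite -(fineK (cfin cP)) -!EFinM lee_fin ler_pM2r// fine_gt0// ltey_eq cfin// cpos.
Qed.

Section step.
Variables (m : {measure set T -> \bar R}) (lam : R) (n : nat).
Hypothesis mE : forall A, A `<=` Q0 -> m A = \int[mu]_(x in A) `|f x|%:E.
Hypotheses (lam_gt0 : (0 < lam)%R) (mlam : m Q0 <= lam%:E * mu Q0).
Let eta : R := (2 * (2 * Cd) ^+ n)^-1.
Let Cd_gt0 : (0 < Cd)%R. Proof. exact: lt_le_trans Cd_ge1. Qed.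
Let eta_gt0 : (0 < eta)%R.
Proof. by rewrite invr_gt0 mulr_gt0// exprn_gt0// mulr_gt0. Qed.

(* If [g] is small somewhere on a stopping cube [A], then on the parent of [A]
   the function [fP] is close to its mean, hence the next level set occupies
   only a small part of [A]. *)
Lemma stopping_small A : maxbad mu D Q0 m lam A ->
  (exists2 y, A y & (g y < eta / Cd * lam)%R) ->
  nu (A `&` Omega mu D Q0 m ((K3 + 2) * lam)) <= (c0 ^+ n.+1)%:E * nu A.
Proof.
move=> mA [y Ay gy]; have cA := maxbad_cube mA.
have [Pa [cPa APa PaQ lPa muPa]] := maxbad_parent tree cQ0 mlam mA.
have [fP [a [mfP fPf aE oscP]]] := osc cPa.
have mPa := cm cPa.
have mfPE : measurable_fun Pa (fun x => (fP x)%:E) by exact/measurable_EFinP.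
have fP0 x : Pa x -> (0 <= fP x)%R.
  by move=> Px; have /andP[+ _] := fPf x Px; apply: le_trans.
(* The parent is not bad, so the average of |f| over it is at most [lam], and [fP] is at most [K3]
   times |f|. *)
have aK : (a <= K3 * lam)%R.
  apply: (mu_le_factor cPa); rewrite -aE EFinM -muleA.
  apply: (@le_trans _ _ (K3%:E * m Pa)); last by rewrite lee_wpmul2l// lee_fin ltW.
  rewrite mE// -ge0_integralZl//; [|exact: measurable_funS mnf|by rewrite lee_fin ltW].
  apply: ge0_le_integral => //.
  - by apply: measurable_funeM; exact: measurable_funS mnf.
  - by move=> x Px; rewrite -EFinM lee_fin; have /andP[] := fPf x Px.
have mosc : measurable_fun Pa (fun x => `|fP x - a|%:E).
  apply/measurable_EFinP; apply: measurableT_comp => //.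
  by apply: measurable_funB => //; exact: measurable_cst.
have mposc : measurable_fun setT ((fun x => `|fP x - a|%:E) \_ Pa).
  exact/(measurable_restrictT _ _).1.
have posc0 x : 0 <= ((fun x => `|fP x - a|%:E) \_ Pa) x by exact: erestrict_ge0.
have [h [hE _]] := density_measure mu mposc posc0.
have {}hE B : B `<=` Pa -> h B = \int[mu]_(x in B) `|fP x - a|%:E.
  move=> BP; rewrite hE; apply: eq_integral => x; rewrite inE => Bx.
  by rewrite patchE mem_set//; exact: BP.
apply: (tree_Ainfty tree Cd_ge1 c0_ge0 nu_half nu_density) => //.
- by apply: measurableI; [exact: cm|exact: (Omega_measurable tree)].
(* This fixes the level ratio [K3 + 2]: where the average of |f| exceeds [(K3 + 2) * lam] while
   [a <= K3 * lam], the average of |fP - a| exceeds [2 * lam]. *)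
have sub : A `&` Omega mu D Q0 m ((K3 + 2) * lam) `<=` Omega mu D A h (2 * lam).
  move=> x [Ax Ox].
  have lle : (lam <= (K3 + 2) * lam)%R by rewrite ler_peMl ?(ltW lam_gt0)//; have := K3_gt0; lra.
  have [B [cB BA Bx lB]] := Omega_localize lle mA Ax Ox.
  have BPa := subset_trans BA APa.
  exists B => //; split => //; rewrite hE//.
  have mB := cm cB.
  rewrite ltNge; apply/negP => hB; move: lB; apply/negP; rewrite -leNgt.
  rewrite mE; last exact: csub.
  apply: (@le_trans _ _ (\int[mu]_(x in B) (`|fP x - a|%:E + `|a|%:E))).
    apply: ge0_le_integral => //.
    - by apply: measurable_funS mnf => //; exact: csub.
    - apply: emeasurable_funD; last exact: measurable_cst.
      exact: measurable_funS mosc.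
    - move=> z Bz; rewrite -EFinD lee_fin.
      have /andP[ffz _] := fPf z (BPa z Bz); apply: (le_trans ffz).
      rewrite -[X in (X <= _)%R](subrK a); apply: le_trans (ler_normD _ _).
      exact: ler_norm.
  rewrite ge0_integralD//; last exact: measurable_funS mosc.
  rewrite integral_cst// mulrDl EFinD muleDl ?cfin//.
  rewrite addeC leeD// lee_wpmul2r// lee_fin ger0_norm//.
  apply: (mu_le_factor cPa); rewrite mul0e -aE integral_ge0// .
(* The point [y] lies in the parent too, whose mean oscillation is thus below [eta / Cd * lam]; the
   division by [Cd] pays for the measure of the parent. *)
have weak : (2 * lam)%:E * mu (A `&` Omega mu D Q0 m ((K3 + 2) * lam)) <=
    (eta * lam)%:E * mu A.
  apply: (@le_trans _ _ ((2 * lam)%:E * mu (Omega mu D A h (2 * lam)))).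
    rewrite lee_wpmul2l ?lee_fin ?mulr_ge0 ?(ltW lam_gt0)//.
    apply: le_measure => //; rewrite inE; last exact: (Omega_measurable tree).
    by apply: measurableI; [exact: cm|exact: (Omega_measurable tree)].
  apply: (le_trans (Omega_weak_type tree _ _ _)); [|exact: cm|].
    by rewrite mulr_ge0// ltW.
  rewrite hE//; apply: (@le_trans _ _ (\int[mu]_(x in Pa) `|fP x - a|%:E)).
    by apply: ge0_subset_integral => //; exact: cm.
  apply: (le_trans (oscP y (APa y Ay))).
  apply: (@le_trans _ _ ((eta / Cd * lam)%:E * mu Pa)).
    by rewrite lee_wpmul2r// lee_fin ltW.
  apply: (@le_trans _ _ ((eta / Cd * lam)%:E * (Cd%:E * mu A))).
    by rewrite lee_wpmul2l// lee_fin mulr_ge0 ?divr_ge0 ?(ltW eta_gt0) ?(ltW Cd_gt0) ?(ltW lam_gt0).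
  rewrite muleA -EFinM (_ : eta / Cd * lam * Cd = eta * lam)%R//.
  by rewrite mulrAC divfK// gt_eqF.
rewrite -lee_pdivlMl in weak; last by rewrite mulr_gt0.
apply: (@le_trans _ _ ((eta^-1)%:E * (eta%:E * mu A))); last first.
  by rewrite muleA -EFinM mulVf ?gt_eqF// mul1e.
have etaV : (2 * (2 * Cd) ^+ n = eta^-1)%R by rewrite /eta invrK.
rewrite etaV; apply: lee_wpmul2l; first by rewrite lee_fin invr_ge0 ltW.
apply: (le_trans weak); rewrite muleA -EFinM lee_wpmul2r// lee_fin.
rewrite ler_pdivrMl ?mulr_gt0// -mulrA [(lam * eta)%R]mulrC ler_peMl ?ler1n//.
by rewrite ltW// mulr_gt0.
Qed.

(** A good-lambda inequality: a stopping cube either contains a point where [g] is small, and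
    [stopping_small] applies, or lies in the set where [g] is large. *)
Lemma level_set_step :
  nu (Omega mu D Q0 m ((K3 + 2) * lam)) <=
  (c0 ^+ n.+1)%:E * nu (Omega mu D Q0 m lam) +
  nu (Q0 `&` [set x | eta / Cd * lam <= g x]%R).
Proof.
set O' := Omega _ _ _ _ _; set O := Omega _ _ _ _ lam.
have mO' : measurable O' by exact: (Omega_measurable tree).
have mO : measurable O by exact: (Omega_measurable tree).
pose S := [set A | maxbad mu D Q0 m lam A /\ exists2 y, A y & (g y < eta / Cd * lam)%R].
have cS : countable S.
  by apply: (sub_countable _ (maxbad_countable tree Q0 m lam)); apply: subset_card_le => A [].
have mS : S `<=` measurable by move=> A [mA _]; exact: (maxbad_measurable tree mA).
have dS : pairwise_disjoint S by move=> A B [mA _] [mB _]; exact: (maxbad_disjoint mA mB).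
have mUS : measurable (\bigcup_(A in S) A) by exact: bigcup_countable_measurable.
have mG : measurable (Q0 `&` [set x | eta / Cd * lam <= g x]%R).
  have := measurable_fun_le mQ0 (@measurable_cst _ _ _ _ Q0 (eta / Cd * lam)%R) mg.
  by [].
apply: (@le_trans _ _ (nu ((\bigcup_(A in S) A `&` O') `|` (Q0 `&` [set x | eta / Cd * lam <= g x]%R)))).
  apply: le_measure; rewrite ?inE//.
    by apply: measurableU => //; exact: measurableI.
  move=> x O'x; have OQ := Omega_sub O'x.
  have lle : (lam <= (K3 + 2) * lam)%R by rewrite ler_peMl ?(ltW lam_gt0)//; have := K3_gt0; lra.
  have : O x.
    case: O'x => B [cB BQ lB] Bx; exists B => //; split => //.
    by apply: le_lt_trans lB; rewrite lee_wpmul2r// lee_fin.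
  rewrite /O (OmegaE tree) => -[A mA Ax].
  have [H|H] := pselect (exists2 y, A y & (g y < eta / Cd * lam)%R).
    by left; split => //; exists A.
  right; split => //=; rewrite leNgt; apply/negP => gx; apply: H; by exists x.
apply: (le_trans (measureU2 _ _ _)) => //; first exact: measurableI.
apply: leeD => //.
apply: (@le_trans _ _ ((c0 ^+ n.+1)%:E * nu (\bigcup_(A in S) A `&` setT))).
  apply: le_measure_bigcup => //; first by rewrite exprn_ge0.
  by move=> A [mA H]; rewrite setIT; exact: stopping_small.
rewrite setIT lee_wpmul2l ?lee_fin ?exprn_ge0//.
apply: le_measure; rewrite ?inE//.
by rewrite /O (OmegaE tree) => x [A [mA _] Ax]; exists A.
Qed.

End step.

(** [nu]-almost all points of the set on the left lie in cubes more than half filled by it, and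
    there the average of |f| exceeds [lam]. The factor 2 is what makes density points of sets
    suffice. *)
Lemma level_set_cover (m : {measure set T -> \bar R}) (lam : R) :
  (forall A, A `<=` Q0 -> m A = \int[mu]_(x in A) `|f x|%:E) -> (0 < lam)%R ->
  nu (Q0 `&` [set x | (2 * lam)%:E < `|f x|%:E]) <= nu (Omega mu D Q0 m lam).
Proof.
move=> mE lam0; set E := Q0 `&` _.
have mEE : measurable E by exact: emeasurable_fun_o_infty.
have EQ : E `<=` Q0 by exact: subIsetl.
have := nu_density 0 mEE EQ.
have mU := density_measurable tree 0 mEE.
set U := \bigcup_(A in _) A in mU * => nuEU.
rewrite [leLHS](measureDI nu mEE mU) [X in X + _](_ : _ = 0) ?add0e//.
apply: le_measure; rewrite ?inE; [exact: measurableI|exact: (Omega_measurable tree)|].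
move=> x [Ex [A [[l _ DA] muA] Ax]].
have cA : cube D A by exists l.
exists A => //; split => //; first exact: csub.
rewrite mE; last exact: csub.
have mA := cm cA; have mAE : measurable (A `&` E) by exact: measurableI.
have finAE : mu (A `&` E) \is a fin_num.
  rewrite ge0_fin_numE//; apply: le_lt_trans (dt_fin tree DA).
  by apply: le_measure; rewrite ?inE//; exact: subIsetl.
apply: (@lt_le_trans _ _ ((2 * lam)%:E * mu (A `&` E))).
  by rewrite mulrC EFinM -muleA lte_pmul2l// lte_fin.
apply: (@le_trans _ _ (\int[mu]_(x in A `&` E) `|f x|%:E)); last first.
  apply: ge0_subset_integral => //.
  by apply: measurable_funS mnf => //; exact: csub.
rewrite -integral_cst//; apply: ge0_le_integral => //.
- by move=> y _; rewrite lee_fin mulr_ge0// ltW.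
- by apply: measurable_funS mnf => // y [_ /EQ].
- by move=> y [_ [_ /= /ltW]].
Qed.

Variable n : nat.
Let A := (K3 + 2)%R.
Let B := (A `^ p)%R.
Let e := ((2 * (2 * Cd) ^+ n)^-1 / Cd)%R.
Hypothesis c0n : (c0 ^+ n.+1 * B <= 2^-1)%R.

(** The levels [A ^+ k * lam] give a recursion for the [nu]-measures of the level sets. Multiplied
    by [B ^+ k], it has main coefficient [c0 ^+ n.+1 * B], at most 1/2, so the weighted sums can be
    absorbed. The lowest level leaves the term with [nu Q0]. *)
Theorem local_fefferman_stein (lam : R) : (0 < lam)%R ->
  \int[mu]_(x in Q0) `|f x|%:E <= lam%:E * mu Q0 ->
  \int[nu]_(x in Q0) (`|f x| `^ p)%:E <=
  (2 `^ p * (1 + 2 * B + 2 * B ^+ 2 / e `^ p * (B / (B - 1))))%:E *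
    ((lam `^ p)%:E * nu Q0 + \int[nu]_(x in Q0) (`|g x| `^ p)%:E).
Proof.
move=> lam0; have [m mE] := fmeas; rewrite -mE// => mlam.
have A1 : (1 < A)%R by rewrite /A; have := K3_gt0; lra.
have A0 : (0 < A)%R by exact: lt_trans A1.
have B1 : (1 < B)%R.
  have <- : (1 `^ p = 1 :> R)%R by rewrite powR1.
  by rewrite gt0_ltr_powR// nnegrE ltW.
have B0 : (0 < B)%R by exact: lt_trans B1.
have Cd0 : (0 < Cd)%R by exact: lt_le_trans Cd_ge1.
have e0 : (0 < e)%R.
  by rewrite /e divr_gt0// invr_gt0 mulr_gt0// exprn_gt0// mulr_gt0.
pose a k := nu (Omega mu D Q0 m (A ^+ k * lam)).
pose b k := nu (Q0 `&` [set x | (A ^+ k * (e * lam))%:E <= `|g x|%:E]).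
have lk0 k : (0 < A ^+ k * lam)%R by rewrite mulr_gt0// exprn_gt0.
have mng : measurable_fun Q0 (fun x => `|g x|%:E).
  by apply/measurable_EFinP; exact: measurableT_comp.
have mOk k : measurable (Omega mu D Q0 m (A ^+ k * lam)) by exact: (Omega_measurable tree).
have mbk k : measurable (Q0 `&` [set x | (A ^+ k * (e * lam))%:E <= `|g x|%:E]).
  exact: emeasurable_fun_c_infty.
have nuQfin S : measurable S -> S `<=` Q0 -> nu S \is a fin_num.
  move=> mS SQ; rewrite ge0_fin_numE//; apply: le_lt_trans nuQ0.
  by apply: le_measure; rewrite ?inE.
have afin k : a k \is a fin_num by apply: nuQfin => //; exact: Omega_sub.
have bfin k : b k \is a fin_num by apply: nuQfin => //; exact: subIsetl.
have ab k : a k.+1 <= (c0 ^+ n.+1)%:E * a k + b k.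
  have := @level_set_step m (A ^+ k * lam) n mE (lk0 k).
  have ml : m Q0 <= (A ^+ k * lam)%:E * mu Q0.
    by apply: (le_trans mlam); rewrite lee_wpmul2r// lee_fin ler_peMl ?(ltW lam0)// exprn_ege1// ltW.
  move=> /(_ ml); rewrite mulrA -exprS => /le_trans; apply.
  rewrite leeD2l//; apply: le_measure; rewrite ?inE//.
    exact: (measurable_fun_le mQ0 (@measurable_cst _ _ _ _ Q0 _) mg).
  move=> x [Qx /= gx]; split => //=; rewrite lee_fin; apply: le_trans (ler_norm _).
  by apply: le_trans gx; rewrite -/e mulrCA.
pose ra k := fine (a k); pose rb k := fine (b k).
have ra0 k : (0 <= ra k)%R by exact: fine_ge0.
have rb0 k : (0 <= rb k)%R by exact: fine_ge0.
have rab k : (B ^+ k.+1 * ra k.+1 <= 2^-1 * (B ^+ k * ra k) + B * (B ^+ k * rb k))%R.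
  have := ab k; rewrite -(fineK (afin k)) -(fineK (afin k.+1)) -(fineK (bfin k)).
  rewrite -EFinM -EFinD lee_fin -/(ra k) -/(ra k.+1) -/(rb k) => H.
  have Bk0 : (0 < B ^+ k)%R by rewrite exprn_gt0.
  apply: (@le_trans _ _ (B ^+ k.+1 * (c0 ^+ n.+1 * ra k + rb k)))%R.
    by rewrite ler_pM2l// exprn_gt0.
  rewrite mulrDr exprS -mulrA -[X in (_ + X <= _)%R]mulrA lerD2r.
  rewrite [X in (X <= _)%R](_ : _ = (c0 ^+ n.+1 * B) * (B ^+ k * ra k))%R; last by ring.
  by rewrite ler_wpM2r// mulr_ge0// ltW.
have sumle N := @absorb_sum R B ra rb N B0 ra0 rb0 rab.
set Nu := nu Q0; set G := \int[nu]_(x in Q0) (`|g x| `^ p)%:E.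
have Nufin : Nu \is a fin_num by exact: nuQfin.
have mgp : measurable_fun Q0 (fun x => (`|g x| `^ p)%:E).
  apply: (@eq_measurable_fun _ _ _ _ _ (fun x => `|g x|%:E `^ p)) => //.
  exact: (measurableT_comp (measurable_poweR p)).
have sumb N : ((e * lam) `^ p * \sum_(k < N) B ^+ k * rb k)%:E <= (B / (B - 1))%:E * G.
  rewrite /G -ge0_integralZl//; last first.
    by rewrite lee_fin ltW// divr_gt0// subr_gt0.
  have lv k := @integral_level _ T R nu Q0 (fun x => (A ^+ k * (e * lam))%:E <= `|g x|%:E)
    ((A ^+ k * (e * lam)) `^ p)%R (powR_ge0 _ _) mQ0 (mbk k).
  apply: (@le_trans _ _ (\int[nu]_(x in Q0) (\sum_(k < N)
      ((A ^+ k * (e * lam)) `^ p * ((A ^+ k * (e * lam))%:E <= `|g x|%:E)%E%:R)%:E))).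
    rewrite ge0_integral_sum//; last 2 first.
    - by move=> k; exact: (lv k).1.
    - by move=> k x _; rewrite lee_fin mulr_ge0// powR_ge0.
    rewrite mulr_sumr -sumEFin; apply: lee_sum => k _.
    rewrite (lv k).2 -/(b k) -(fineK (bfin k)) -EFinM -/(rb k) lee_fin.
    rewrite (powR_scale_level _ _ A0 (mulr_ge0 (ltW e0) (ltW lam0))).
    by rewrite mulrCA mulrA.
  apply: ge0_le_integral => //.
  - by move=> x _; rewrite sume_ge0// => k _; rewrite lee_fin mulr_ge0// powR_ge0.
  - by apply: emeasurable_sum => k; exact: (lv k).1.
  - by apply: measurable_funeM.
  - move=> x _; rewrite -poweR_EFin sumEFin.
    by apply: level_sum_le => //; rewrite mulr_gt0.
(* Truncating |f| at [A ^+ N.+1 * (2 * lam)] leaves finitely many levels. With [Sle] the bound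
   becomes independent of [N], and [big] lets [N] tend to infinity. *)
have sumf N : \int[nu]_(x in Q0)
    ((Order.min `|f x|%:E (A ^+ N.+1 * (2 * lam))%:E) `^ p *
     ((2 * lam)%:E < `|f x|%:E)%E%:R%:E) <=
    (B * (2 * lam) `^ p * \sum_(k < N.+1) B ^+ k * ra k)%:E.
  have tl0 : (0 < 2 * lam)%R by rewrite mulr_gt0.
  have msk k : measurable (Q0 `&` [set x | (A ^+ k * (2 * lam))%:E < `|f x|%:E]).
    exact: emeasurable_fun_o_infty.
  have lv k := @integral_level _ T R nu Q0 (fun x => (A ^+ k * (2 * lam))%:E < `|f x|%:E)
    ((A ^+ k.+1 * (2 * lam)) `^ p)%R (powR_ge0 _ _) mQ0 (msk k).
  have mlt : measurable_fun Q0 (fun x => ((2 * lam)%:E < `|f x|%:E)%E%:R%:E : \bar R).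
    have ms0 : measurable (Q0 `&` [set x | (2 * lam)%:E < `|f x|%:E]).
      exact: emeasurable_fun_o_infty.
    have [+ _] := @integral_level _ T R nu Q0 _ 1%R ler01 mQ0 ms0.
    by apply: eq_measurable_fun => x _; rewrite mul1r.
  apply: (@le_trans _ _ (\int[nu]_(x in Q0) (\sum_(k < N.+1)
      ((A ^+ k.+1 * (2 * lam)) `^ p * ((A ^+ k * (2 * lam))%:E < `|f x|%:E)%E%:R)%:E))).
    apply: ge0_le_integral => //.
    - by move=> x _; rewrite mule_ge0 ?poweR_ge0// lee_fin.
    - apply: emeasurable_funM => //.
      apply: (measurableT_comp (measurable_poweR p)).
      by apply: measurable_mine => //; exact: measurable_cst.
    - by apply: emeasurable_sum => k; exact: (lv k).1.
    - by move=> x _; rewrite sumEFin; exact: level_cover.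
  rewrite ge0_integral_sum//; last 2 first.
  - by move=> k; exact: (lv k).1.
  - by move=> k x _; rewrite lee_fin mulr_ge0// powR_ge0.
  rewrite mulr_sumr -sumEFin; apply: lee_sum => k _.
  rewrite (lv k).2.
  apply: (@le_trans _ _ (((A ^+ k.+1 * (2 * lam)) `^ p)%:E * a k)).
    rewrite lee_wpmul2l ?lee_fin ?powR_ge0//.
    rewrite (_ : A ^+ k * (2 * lam) = 2 * (A ^+ k * lam))%R; last by rewrite mulrCA.
    exact: level_set_cover.
  rewrite -(fineK (afin k)) -EFinM lee_fin -/(ra k) powR_scale_level ?(ltW tl0)//.
  by rewrite le_eqVlt exprS; apply/orP; left; apply/eqP; rewrite /B; ring.
have G0 : 0 <= G by rewrite integral_ge0// => x _; rewrite lee_fin powR_ge0.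
have BB0 : (0 < B / (B - 1))%R by rewrite divr_gt0// subr_gt0.
have ep0 : (0 < e `^ p)%R by rewrite powR_gt0.
have lp0 : (0 < lam `^ p)%R by rewrite powR_gt0.
have tp0 : (0 < 2 `^ p :> R)%R by rewrite powR_gt0.
pose X := (2 * B ^+ 2 / e `^ p * (B / (B - 1)))%R.
have X0 : (0 < X)%R by rewrite mulr_gt0// divr_gt0// mulr_gt0// exprn_gt0.
have c_gt0 : (0 < 2 `^ p * (1 + 2 * B + X))%R.
  by rewrite mulr_gt0// addr_gt0// addr_gt0// mulr_gt0.
have [->|Goo] := eqVneq G +oo.
  rewrite addey ?gt0_muley ?lte_fin ?leey//.
  by rewrite -(fineK Nufin) -EFinM.
have Gfin : G \is a fin_num by rewrite ge0_fin_numE// ltey.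
pose Gr := fine G; pose Nr := fine Nu.
have Gr0 : (0 <= Gr)%R by exact: fine_ge0.
have Nr0 : (0 <= Nr)%R by apply: fine_ge0; exact: measure_ge0.
have raN : (ra 0%N <= Nr)%R.
  apply: fine_le => //; apply: le_measure; rewrite ?inE//.
  exact: Omega_sub.
have Sle N : (\sum_(k < N) B ^+ k * ra k <=
    2 * Nr + 2 * B * (B / (B - 1) * Gr / (e `^ p * lam `^ p)))%R.
  apply: (le_trans (sumle N)); apply: lerD; first by rewrite ler_pM2l.
  rewrite ler_pM2l; last by rewrite mulr_gt0.
  rewrite ler_pdivlMr; last by rewrite mulr_gt0.
  have := sumb N; rewrite -(fineK Gfin) -EFinM lee_fin powRM ?(ltW e0) ?(ltW lam0)//.
  by rewrite mulrC.
pose M := (B * (2 * lam) `^ p *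
  (2 * Nr + 2 * B * (B / (B - 1) * Gr / (e `^ p * lam `^ p))))%R.
have tl0 : (0 < 2 * lam)%R by rewrite mulr_gt0.
have mlt : measurable_fun Q0 (fun x => ((2 * lam)%:E < `|f x|%:E)%E%:R%:E : \bar R).
  have ms0 : measurable (Q0 `&` [set x | (2 * lam)%:E < `|f x|%:E]).
    exact: emeasurable_fun_o_infty.
  have [+ _] := @integral_level _ T R nu Q0 _ 1%R ler01 mQ0 ms0.
  by apply: eq_measurable_fun => x _; rewrite mul1r.
have mfp : measurable_fun Q0 (fun x => (`|f x| `^ p)%:E).
  apply: (@eq_measurable_fun _ _ _ _ _ (fun x => `|f x|%:E `^ p)) => //.
  exact: (measurableT_comp (measurable_poweR p)).
have big : \int[nu]_(x in Q0) ((`|f x| `^ p)%:E * ((2 * lam)%:E < `|f x|%:E)%E%:R%:E) <= M%:E.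
  apply: (@integral_lim_le _ _ _ nu Q0 (fun N x =>
    (Order.min `|f x|%:E (A ^+ N.+1 * (2 * lam))%:E) `^ p *
     ((2 * lam)%:E < `|f x|%:E)%E%:R%:E)) => //.
  - move=> N; apply: emeasurable_funM => //.
    apply: (measurableT_comp (measurable_poweR p)).
    by apply: measurable_mine => //; exact: measurable_cst.
  - by move=> N x _; rewrite mule_ge0 ?poweR_ge0// lee_fin.
  - move=> x _ N N' NN'; rewrite lee_wpmul2r ?lee_fin// poweR_le ?(ltW p_gt0)//.
      by rewrite le_min !lee_fin normr_ge0 mulr_ge0 ?(ltW tl0)// exprn_ge0// ltW.
    rewrite le_min ge_min lexx/= ge_min; apply/orP; right.
    by rewrite lee_fin ler_pM2r// ler_weXn2l// ltW.
  - move=> x _; apply: cvg_near_cst.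
    have [N0 HN] := expr2_eventually_ge (`|f x| / (2 * lam))%R.
    exists N0 => // N /= NN; congr (_ * _); rewrite min_l//.
    rewrite lee_fin -ler_pdivrMr//; apply: (le_trans (HN N.+1 (leqW NN))).
    by rewrite lerXn2r ?nnegrE ?ltW// /A; have := K3_gt0; lra.
  - move=> N; apply: (le_trans (sumf N)); rewrite lee_fin ler_pM2l ?Sle//.
    by rewrite mulr_gt0// powR_gt0.
(* Values of |f| up to [2 * lam] are bounded trivially and give another term with [nu Q0]. *)
apply: (@le_trans _ _ (\int[nu]_(x in Q0) (((2 * lam) `^ p)%:E +
    (`|f x| `^ p)%:E * ((2 * lam)%:E < `|f x|%:E)%E%:R%:E))).
  apply: ge0_le_integral => //.
  - by apply: emeasurable_funD => //; exact: emeasurable_funM.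
  - move=> x _; case: (ltP (2 * lam)%:E `|f x|%:E) => [_|fl].
      by rewrite mule1 -EFinD lee_fin lerDr powR_ge0.
    rewrite mule0 adde0 lee_fin ge0_ler_powR ?nnegrE ?(ltW p_gt0) ?(ltW tl0)//.
rewrite ge0_integralD//; [|by move=> x _; rewrite lee_fin powR_ge0|
  exact: emeasurable_funM].
rewrite integral_cst// -/Nu -(fineK Nufin) -/Nr -(fineK Gfin) -/Gr.
apply: (@le_trans _ _ (((2 * lam) `^ p)%:E * Nr%:E + M%:E)); first by rewrite leeD2l.
rewrite -!EFinM -!EFinD lee_fin /M -/X powRM ?(ltW lam0)//.
have -> : (2 `^ p * lam `^ p * Nr + B * (2 `^ p * lam `^ p) *
    (2 * Nr + 2 * B * (B / (B - 1) * Gr / (e `^ p * lam `^ p))) =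
    2 `^ p * (1 + 2 * B) * (lam `^ p * Nr) + 2 `^ p * X * Gr)%R.
  rewrite /X; field; rewrite !gt_eqF// subr_gt0//.
have lN0 : (0 <= lam `^ p * Nr)%R by rewrite mulr_ge0// ltW.
rewrite [leRHS]mulrDr lerD//.
  rewrite ler_wpM2r// ler_pM2l//; lra.
rewrite ler_wpM2r// ler_pM2l//; have := B0; lra.
Qed.

End local_fefferman_stein.

(** * Doubling spaces *)

Section doubling_space.
Context d (T : measurableType d) (R : realType).
Variables (D : set T) (rho : T -> T -> R) (mu : {measure set T -> \bar R}).

(** These axioms pass from [mu] to a weighted measure [w dmu], so that the covering arguments serve
    both; the constants are normalized to be at least 1. *)
Record doubling_space (K C : R) : Prop := DoublingSpace {
  ds_K : 1 <= K ;
  ds_C : 1 <= C ;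
  ds_ge0 : forall x y, D x -> D y -> 0 <= rho x y ;
  ds_sym : forall x y, D x -> D y -> rho x y = rho y x ;
  ds_refl : forall x, D x -> rho x x = 0 ;
  ds_triangle : forall x y z, D x -> D y -> D z ->
    rho x y <= K * (rho x z + rho z y) ;
  ds_open : forall x r, D x -> 0 < r -> qopen D rho (qball D rho x r%:E) ;
  ds_borel : forall U, qopen D rho U -> measurable U ;
  ds_gt0 : forall x r, D x -> 0 < r -> (0 < mu (qball D rho x r%:E))%E ;
  ds_fin : forall x r, D x -> 0 < r -> (mu (qball D rho x r%:E) < +oo)%E ;
  ds_doubling : forall x r, D x -> 0 < r ->
    (mu (qball D rho x (2 * r)%:E) <= C%:E * mu (qball D rho x r%:E))%E }.

Lemma homogeneous_doubling K1 K2 : homogeneous_type D rho mu K1 K2 ->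
  doubling_space (Num.max K1 1) (Num.max K2 1).
Proof.
move=> H; have [qge0 qsym qeq0 qtri] := ht_quasi_metric H.
have gt0 x r : D x -> 0 < r -> (0 < mu (qball D rho x r%:E))%E.
  move=> Dx r0; have [] := ht_doubling H (r := r / 2) Dx _; first by rewrite divr_gt0.
  by rewrite mulrC divfK.
have le2 x r : D x -> 0 < r ->
    (mu (qball D rho x (2 * r)%:E) <= (Num.max K2 1)%:E * mu (qball D rho x r%:E))%E.
  move=> Dx r0; have [_ H2 _] := ht_doubling H Dx r0; apply: (le_trans H2).
  by rewrite lee_wpmul2r// lee_fin le_max lexx.
split=> //.
- by rewrite le_max lexx orbT.
- by rewrite le_max lexx orbT.
- by move=> x Dx; apply/qeq0.
- move=> x y z Dx Dy Dz; apply: (le_trans (qtri _ _ z _ _ _)) => //.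
  by rewrite ler_wpM2r ?addr_ge0 ?qge0// le_max lexx.
- by move=> x r; exact: (ht_ball_open H).
- by move=> U; exact: (ht_borel H).
- move=> x r Dx r0; have [H0 H2 H3] := ht_doubling H Dx r0.
  rewrite ltey; apply/eqP => E; move: H2 H3; rewrite E.
  (* For positive [K2] the finiteness in the doubling axiom excludes +oo; otherwise doubling would
     make the larger ball null. *)
  have [K20|K20] := ltP 0 K2; first by rewrite gt0_muley// ltxx.
  move=> H2 _; have : (mu (qball D rho x (2 * r)%:E) <= 0)%E.
    apply: (le_trans H2); rewrite muleC mule_ge0_le0//.
  by rewrite leNgt H0.
Qed.

Section theory.
Variables (K C : R).
Hypothesis S : doubling_space K C.
Local Notation ball x r := (qball D rho x r%:E).

Let K0 : 0 < K. Proof. exact: lt_le_trans (ds_K S). Qed.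
Let C0 : 0 < C. Proof. exact: lt_le_trans (ds_C S). Qed.

Lemma ball_in x r : ball x r `<=` D. Proof. by move=> y []. Qed.

Lemma ball_measurable x r : D x -> 0 < r -> measurable (ball x r).
Proof. by move=> Dx r0; apply: (ds_borel S); exact: (ds_open S). Qed.

Lemma ball_center x r : D x -> 0 < r -> ball x r x.
Proof. by move=> Dx r0; split => //; rewrite (ds_refl S)// lte_fin. Qed.

Lemma subset_ball x y s r : D x -> D y -> rho x y <= s ->
  ball y r `<=` ball x (K * (s + r)).
Proof.
move=> Dx Dy xy z [Dz]; rewrite lte_fin => yz; split => //; rewrite lte_fin.
apply: (le_lt_trans (ds_triangle S Dx Dz Dy)).
by rewrite ltr_pM2l// ler_ltD.
Qed.

Lemma ball_mono x r s : r <= s -> ball x r `<=` ball x s.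
Proof.
by move=> rs z [Dz xz]; split => //; apply: lt_le_trans xz _; rewrite lee_fin.
Qed.

(** A number of doublings that covers dilation by [L]; n < 2^n stands in for a logarithm. *)
Definition dbl_exp (L : R) : nat := (Num.truncn `|L|).+1.

Lemma le_dbl_exp L : L <= 2 ^+ dbl_exp L.
Proof.
apply: (le_trans (ler_norm _)); apply/ltW/(lt_le_trans (truncnS_gt _)).
by rewrite -natrX ler_nat ltnW// ltn_expl.
Qed.

Lemma doubling_iter x r k : D x -> 0 < r ->
  (mu (ball x (2 ^+ k * r)) <= (C ^+ k)%:E * mu (ball x r))%E.
Proof.
move=> Dx r0; elim: k => [|k IH]; first by rewrite !expr0 mul1r mul1e.
rewrite exprS -mulrA; apply: (le_trans (ds_doubling S Dx _)).
  by rewrite mulr_gt0// exprn_gt0.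
by rewrite exprS (EFinM C) -muleA lee_wpmul2l// lee_fin ltW.
Qed.

Lemma doubling_ball x r L : D x -> 0 < r -> 0 < L ->
  (mu (ball x (L * r)) <= (C ^+ dbl_exp L)%:E * mu (ball x r))%E.
Proof.
move=> Dx r0 L0; apply: le_trans (doubling_iter _ Dx r0).
apply: le_measure; rewrite ?inE.
- by apply: ball_measurable => //; rewrite mulr_gt0.
- by apply: ball_measurable => //; rewrite mulr_gt0// exprn_gt0.
- by apply: ball_mono; rewrite ler_pM2r// le_dbl_exp.
Qed.

Lemma bigcup_ball x : D x -> D = \bigcup_n ball x n.+1%:R.
Proof.
move=> Dx; apply/seteqP; split=> [y Dy|y [n _ []//]].
exists (Num.truncn `|rho x y|) => //; split => //; rewrite lte_fin.
exact: (le_lt_trans (ler_norm _) (truncnS_gt _)).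
Qed.

Lemma space_measurable : measurable D.
Proof.
have [[x Dx]|D0] := pselect (exists x, D x).
  rewrite (bigcup_ball Dx); apply: bigcupT_measurable => n.
  exact: ball_measurable.
by rewrite (_ : D = set0)//; apply/seteqP; split => // x Dx; apply: D0; exists x.
Qed.

Lemma qopen_bigcup (I : Type) (P : set I) (F : I -> set T) :
  (forall i, P i -> qopen D rho (F i)) -> qopen D rho (\bigcup_(i in P) F i).
Proof.
move=> oF; split=> [x [i Pi Fx]|x [i Pi Fx]]; first exact: (oF i Pi).1.
have [r r0 rF] := (oF i Pi).2 x Fx.
by exists r => //; apply: (subset_trans rF) => z Fz; exists i.
Qed.

Lemma positive_disjoint_countable F : F `<=` measurable ->
  (forall A, F A -> (0 < mu A)%E /\ A `<=` D) -> pairwise_disjoint F ->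
  countable F.
Proof.
move=> mF F0 dF.
have [[x Dx]|D0] := pselect (exists x, D x); last first.
  rewrite (_ : F = set0)//; apply/seteqP; split => // A FA.
  have [A0 AD] := F0 A FA; have A0' : A = set0.
    by apply/seteqP; split => // x /AD Dx; apply: D0; exists x.
  by move: A0; rewrite A0' measure0 ltxx.
apply: (@countable_positive_disjoint _ _ _ mu _ (fun n => ball x n.+1%:R)) => //.
- by move=> k; split; [exact: ball_measurable|exact: (ds_fin S)].
- move=> A FA; have [A0 AD] := F0 A FA; split => //; first exact: mF.
  by rewrite -bigcup_ball.
Qed.

End theory.
End doubling_space.

Section positive_integral.
Local Open Scope ereal_scope.
Context d (T : measurableType d) (R : realType).

Lemma integral_eq0_ae (mu : {measure set T -> \bar R}) (D : set T) (f : T -> \bar R) :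
  measurable D -> measurable_fun D f -> (forall x, D x -> 0 <= f x) ->
  \int[mu]_(x in D) f x = 0 -> ae_eq mu D f (cst 0).
Proof.
move=> mD mf f0 f00; apply/(ae_eq_integral_abs mu mD mf); rewrite -f00.
by apply: eq_integral => x; rewrite inE => Dx; rewrite gee0_abs// f0.
Qed.

Lemma integral_gt0 (mu : {measure set T -> \bar R}) (D : set T) (f : T -> \bar R) :
  measurable D -> measurable_fun D f -> (forall x, D x -> 0 < f x) ->
  0 < mu D -> 0 < \int[mu]_(x in D) f x.
Proof.
move=> mD mf f0 muD; rewrite lt0e integral_ge0 ?andbT => [|x /f0/ltW//].
apply/eqP => i0; have H := integral_eq0_ae mD mf (fun x Dx => ltW (f0 x Dx)) i0.
have : mu D = 0.
  apply/(negligibleP mu mD); apply: negligibleS H => x /= Dx /(_ Dx) /= fx.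
  by have := f0 x Dx; rewrite fx ltxx.
by move=> D0; move: muD; rewrite D0 ltxx.
Qed.

Lemma integral_lty_ae (mu : {measure set T -> \bar R}) (D : set T) (f : T -> \bar R) :
  measurable D -> measurable_fun D f -> (forall x, D x -> 0 <= f x) ->
  \int[mu]_(x in D) f x < +oo -> {ae mu, forall x, D x -> f x < +oo}.
Proof.
move=> mD mf f0 fi; have : mu.-integrable D f.
  apply/integrableP; split => //; apply: le_lt_trans fi; apply: ge0_le_integral => //.
  - exact: measurableT_comp.
  - by move=> x Dx; rewrite gee0_abs// f0.
move=> /(integrable_ae mD); apply: filterS => x H Dx.
by have := H Dx; rewrite ge0_fin_numE// f0.
Qed.

End positive_integral.

Lemma measurable_dual_weight d (T : measurableType d) (R : realType) (D : set T)
  (s : R) (w : T -> R) : measurable_fun D w -> measurable_fun D (dual_weight s w).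
Proof.
move=> mw; rewrite /dual_weight.
pose h (t : R) : \bar R := (((t `^ (s - 1)^-1)%:E)^-1)%E.
suff mh : measurable_fun setT h by exact: (measurableT_comp mh mw).
have -> : h = fun t : R => if t `^ (s - 1)^-1 == 0 then +oo%E
    else (t `^ (- (s - 1)^-1))%:E.
  by apply/funext => t; rewrite /h inver powRN.
apply: measurable_fun_ifT => //.
  apply: measurable_fun_eqr => //; exact: measurable_powR.
apply/measurable_EFinP; exact: measurable_powR.
Qed.

(** * The A_s condition on one ball *)

Section Ap_ball.
Context d (T : measurableType d) (R : realType).
Variables (D : set T) (rho : T -> T -> R) (mu : {measure set T -> \bar R}).
Variables (K C s Kw : R) (w : T -> R).
Hypotheses (S : doubling_space D rho mu K C) (s_gt1 : 1 < s).
Hypotheses (w_ge0 : forall x, D x -> 0 <= w x) (mw : measurable_fun D w).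
Hypothesis Apw : (Ap_const D rho mu s w <= Kw%:E)%E.
Local Notation ball x r := (qball D rho x r%:E).
Local Open Scope ereal_scope.

Lemma dual_weight_gt0 x : 0 < dual_weight s w x.
Proof.
rewrite /dual_weight inver; case: ifPn => // w0.
by rewrite lte_fin invr_gt0 lt_neqAle eq_sym w0 powR_ge0.
Qed.

Section one_ball.
Variables (x0 : T) (r : R).
Hypotheses (Dx0 : D x0) (r_gt0 : (0 < r)%R).
Let B := ball x0 r.

Let mB : measurable B. Proof. exact: (ball_measurable S). Qed.
Let BD : B `<=` D. Proof. exact: ball_in. Qed.
Let mwB : measurable_fun B (fun x => (w x)%:E).
Proof. by apply/measurable_EFinP; apply: measurable_funS mw; [exact: (space_measurable S)|]. Qed.
Let mdB : measurable_fun B (dual_weight s w).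
Proof.
by apply: measurable_dual_weight; apply: measurable_funS mw; [exact: (space_measurable S)|].
Qed.
Let w0B x : B x -> 0 <= (w x)%:E.
Proof. by move=> Bx; rewrite lee_fin w_ge0//; exact: BD. Qed.

Let W := \int[mu]_(x in B) (w x)%:E.
Let sg := \int[mu]_(x in B) dual_weight s w x.
Let m := fine (mu B).

Let muB_gt0 : 0 < mu B. Proof. exact: (ds_gt0 S). Qed.

Let mE : mu B = m%:E.
Proof. by rewrite fineK// gt0_fin_numE// (ds_fin S). Qed.

Let m_gt0 : (0 < m)%R.
Proof. by rewrite -lte_fin -mE. Qed.

Let W_ge0 : 0 <= W. Proof. exact: integral_ge0. Qed.

Let sg_gt0 : 0 < sg.
Proof. by apply: integral_gt0 => // x _; exact: dual_weight_gt0. Qed.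

Lemma Ap_ball_product : W * sg `^ (s - 1) <= (Kw * m `^ s)%:E.
Proof.
have : eavg mu B (EFin \o w) * (eavg mu B (dual_weight s w)) `^ (s - 1) <= Kw%:E.
  by apply: le_trans Apw; apply: ereal_sup_ubound; exists x0, r.
rewrite /eavg mE inver gt_eqF// -/sg poweRM ?lee_fin ?invr_ge0 ?(ltW m_gt0) ?(ltW sg_gt0)//.
have -> : \int[mu]_(x in B) (EFin \o w) x = W by [].
rewrite poweR_EFin muleACA -EFinM.
have -> : (m^-1 * m^-1 `^ (s - 1) = (m `^ s)^-1)%R.
  rewrite mulr_powRB1 ?invr_ge0 ?(ltW m_gt0) ?(lt_trans _ s_gt1)//.
  by rewrite -[m^-1%R]powR_inv1 ?ltW// -powRrM mulN1r powRN.
by rewrite lee_pdivrMl ?powR_gt0// -EFinM mulrC.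
Qed.

(** The dual integral is strictly positive, so an infinite [W] would make the bounded product
    infinite. *)
Lemma Ap_weight_lty : W < +oo.
Proof.
rewrite ltey; apply/eqP => WE; have := Ap_ball_product.
by rewrite WE gt0_mulye ?poweR_gt0.
Qed.

Lemma Ap_dual_lty : 0 < W -> sg < +oo.
Proof.
move=> W0; rewrite ltey; apply/eqP => sE; have := Ap_ball_product.
by rewrite sE poweRyr ?gt0_muley// gt_eqF// subr_gt0.
Qed.

Lemma Ap_weight_gt0_ae : 0 < W -> {ae mu, forall x, B x -> (0 < w x)%R}.
Proof.
move=> /Ap_dual_lty sfin.
have := integral_lty_ae mB mdB (fun x _ => ltW (dual_weight_gt0 x)) sfin.
apply: filterS => x H Bx; have := H Bx; rewrite /dual_weight inver.
case: ifPn => // wx0 _; rewrite lt_neqAle eq_sym -lee_fin w0B// andbT.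
apply: contraNneq wx0 => ->; rewrite powR0// invr_eq0 subr_eq0 gt_eqF//.
Qed.

(** Hölder's inequality for powers of [w] and its dual weight whose product is 1 bounds [mu E] by
    the weight of [E] and the dual weight of [B]; the [A_s] condition removes the latter. In this
    form [A_s] says that a large part of a ball carries a fixed share of its weight. *)
Lemma Ap_subset_lower E : measurable E -> E `<=` B ->
  (mu E) `^ s * W <= (Kw * m `^ s)%:E * \int[mu]_(x in E) (w x)%:E.
Proof.
move=> mE' EB.
have Kw0 : (0 <= Kw * m `^ s)%R.
  rewrite -lee_fin; apply: le_trans Ap_ball_product.
  by rewrite mule_ge0// poweR_ge0.
have wE0 : 0 <= \int[mu]_(x in E) (w x)%:E.
  by apply: integral_ge0 => x Ex; apply: w0B; exact: EB.
have [->|W0] := eqVneq W 0; first by rewrite mule0 mule_ge0.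
have {}W0 : 0 < W by rewrite lt0e W0.
have s0 : (0 < s)%R by exact: lt_trans s_gt1.
have th : (0 < s^-1 < 1)%R by rewrite invr_gt0 s0/= invf_lt1.
have mwE := measurable_funS mB EB mwB; have mdE := measurable_funS mB EB mdB.
have H := holder_ereal mu th mE' mwE mdE (fun x Ex => w0B (EB x Ex))
  (fun x _ => ltW (dual_weight_gt0 x)).
have muE : mu E <= (\int[mu]_(x in E) (w x)%:E) `^ s^-1 * sg `^ (1 - s^-1).
  (* The integrand is 1 wherever [w] is positive, which is a.e. in [B] because the dual weight is
     integrable there. *)
  apply: (@le_trans _ _ (\int[mu]_(x in E) ((w x)%:E `^ s^-1 * dual_weight s w x `^ (1 - s^-1)))).
    rewrite -[X in X <= _]mul1e -[X in X <= _]integral_cst//.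
    apply: ae_ge0_le_integral => //.
    - by move=> x _; rewrite mule_ge0 ?poweR_ge0.
    - by apply: emeasurable_funM; exact: (measurableT_comp (measurable_poweR _)).
    apply: filterS (Ap_weight_gt0_ae W0) => x wx Ex; have {}wx := wx (EB x Ex).
    rewrite /dual_weight inver gt_eqF ?powR_gt0// !poweR_EFin -EFinM lee_fin.
    rewrite -powRN -powRrM -powRD ?(gt_eqF wx) ?implybT//.
    have -> : (s^-1 + - (s - 1)^-1 * (1 - s^-1) = 0)%R.
      by field; rewrite gt_eqF// subr_eq0 gt_eqF.
    by rewrite powRr0.
  apply: (le_trans H); rewrite lee_wpmul2l ?poweR_ge0// poweR_le//.
  - by rewrite subr_ge0; have /andP[_ /ltW] := th.
  - by apply: integral_ge0 => x _; exact/ltW/dual_weight_gt0.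
  - by apply: ge0_subset_integral => // x _; exact/ltW/dual_weight_gt0.
have muEs : mu E `^ s <= (\int[mu]_(x in E) (w x)%:E) * sg `^ (s - 1).
  apply: (le_trans (poweR_le (ltW s0) (measure_ge0 _ _) muE)).
  rewrite poweRM ?poweR_ge0// -!poweRrM mulVf ?gt_eqF// poweRe1// mulrBl mul1r.
  by rewrite mulVf ?gt_eqF.
apply: (@le_trans _ _ ((\int[mu]_(x in E) (w x)%:E) * sg `^ (s - 1) * W)).
  by rewrite lee_wpmul2r.
rewrite -muleA [X in _ * X]muleC muleC lee_wpmul2r// muleC.
by rewrite muleC; exact: Ap_ball_product.
Qed.

End one_ball.
End Ap_ball.

(** * Dyadic cubes, their comparison with balls, and density points *)

Section filtration.
Context d (T : measurableType d) (R : realType).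
Variables (X : set T) (rho : T -> T -> R) (mu : {measure set T -> \bar R}).
Variables (K C delta eps0 N0 : R) (I : int -> Type) (Q : forall n, I n -> set T).
Hypotheses (S : doubling_space X rho mu K C) (delta01 : 0 < delta < 1)
  (eps0_gt0 : 0 < eps0).
Hypothesis df : dyadic_filtration X rho mu delta eps0 N0 Q.
Local Notation ball x r := (qball X rho x r%:E).

Definition cubes (n : int) : set (set T) := [set A | exists a : I n, Q a = A].

(** Strictly above [N0] and positive whatever the sign of [N0], so that a cube lies in an open ball
    of this radius, in units of [delta ^ n], about each of its points. *)
Definition cube_size : R := `|N0| + 1.

(** The doubling factor from the inner ball of a cube, of radius [eps0], to the concentric ball of
    radius [K * (cube_size + L)], in units of [delta ^ n]. *)
Definition cube_ratio (L : R) : R := C ^+ dbl_exp (K * (cube_size + L) / eps0).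

Definition parent_ratio : R := cube_ratio (cube_size / delta).

Local Notation L0 := cube_size.

Let K_gt0 : 0 < K. Proof. exact: lt_le_trans (ds_K S). Qed.
Let L0_gt0 : 0 < L0. Proof. by rewrite ltr_wpDl. Qed.
Let delta_gt0 : 0 < delta. Proof. by case/andP: delta01. Qed.
Let dn_gt0 (n : int) : 0 < delta ^ n. Proof. exact: exprz_gt0. Qed.

Lemma cube_ratio_ge1 L : 1 <= cube_ratio L.
Proof. by rewrite exprn_ege1// (ds_C S). Qed.

Lemma cubes_open n A : cubes n A -> qopen X rho A.
Proof. by move=> [a <-]; exact: (df_open df). Qed.

Lemma cubes_sub n A : cubes n A -> A `<=` X.
Proof. by move=> /cubes_open[]. Qed.

Lemma cubes_measurable n A : cubes n A -> measurable A.
Proof. by move=> /cubes_open; exact: (ds_borel S). Qed.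

Lemma cubes_disjoint n : pairwise_disjoint (cubes n).
Proof. by move=> A B [a <-] [b <-] ab; rewrite ((df_disjoint df (n := n)) a b). Qed.

Lemma cubes_diam n A x y : cubes n A -> A x -> A y -> rho x y < L0 * delta ^ n.
Proof.
move=> [a <-] Ax Ay; apply: (le_lt_trans (df_diam df Ax Ay)).
by rewrite ltr_pM2r// (le_lt_trans (ler_norm _))// ltrDl.
Qed.

Lemma cubes_center n A : cubes n A ->
  exists z, [/\ X z, A z & ball z (eps0 * delta ^ n) `<=` A].
Proof.
move=> [a <-]; have [z Xz zA] := df_ball df a; exists z; split => //.
by apply: zA; apply: (ball_center S) => //; rewrite mulr_gt0.
Qed.

Lemma cubes_sub_ball n A x : cubes n A -> A x -> A `<=` ball x (L0 * delta ^ n).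
Proof.
move=> nA Ax y Ay; split; first exact: (cubes_sub nA).
by rewrite lte_fin; exact: (cubes_diam nA).
Qed.

Lemma cubes_gt0 n A : cubes n A -> (0 < mu A)%E.
Proof.
move=> nA; have [z [Xz _ zA]] := cubes_center nA.
have e0 : 0 < eps0 * delta ^ n by rewrite mulr_gt0.
apply: (lt_le_trans (ds_gt0 S Xz e0)); apply: le_measure; rewrite ?inE//.
  exact: (ball_measurable S).
exact: (cubes_measurable nA).
Qed.

Lemma cubes_fin n A : cubes n A -> (mu A < +oo)%E.
Proof.
move=> nA; have [z [Xz Az _]] := cubes_center nA.
have e0 : 0 < L0 * delta ^ n by rewrite mulr_gt0.
apply: le_lt_trans (ds_fin S Xz e0); apply: le_measure; rewrite ?inE.
- exact: (cubes_measurable nA).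
- exact: (ball_measurable S).
- exact: cubes_sub_ball.
Qed.

Lemma cubes_countable n : countable (cubes n).
Proof.
apply: (positive_disjoint_countable S).
- by move=> A; exact: cubes_measurable.
- by move=> A nA; split; [exact: cubes_gt0 nA|exact: cubes_sub nA].
- exact: cubes_disjoint.
Qed.

(** The quasi-triangle inequality moves the ball to the centre [z] of the cube; doubling then
    shrinks it to the ball inside [A]. *)
Lemma cube_comparable n A x L : cubes n A -> A x -> 0 < L ->
  (mu (ball x (L * delta ^ n)) <= (cube_ratio L)%:E * mu A)%E.
Proof.
move=> nA Ax L_gt0; have [z [Xz Az zA]] := cubes_center nA.
have Xx := cubes_sub nA Ax.
have e0 : 0 < eps0 * delta ^ n by rewrite mulr_gt0.
have k0 : 0 < K * (L0 + L) / eps0 by rewrite divr_gt0// mulr_gt0// addr_gt0.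
apply: (@le_trans _ _ (mu (ball z (K * (L0 + L) / eps0 * (eps0 * delta ^ n))))).
  apply: le_measure; rewrite ?inE.
  - by apply: (ball_measurable S) => //; rewrite mulr_gt0.
  - by apply: (ball_measurable S) => //; rewrite mulr_gt0.
  - have -> : K * (L0 + L) / eps0 * (eps0 * delta ^ n) =
        K * (L0 * delta ^ n + L * delta ^ n).
      by field; rewrite gt_eqF.
    by apply: (subset_ball S) => //; exact/ltW/(cubes_diam nA).
apply: (le_trans (doubling_ball S Xz e0 k0)).
rewrite lee_wpmul2l ?lee_fin ?exprn_ge0 ?(le_trans _ (ds_C S))//.
apply: le_measure; rewrite ?inE//.
  exact: (ball_measurable S).
exact: (cubes_measurable nA).
Qed.

Lemma cubes_parent n A : cubes n A -> exists P, [/\ cubes (n - 1) P, A `<=` P &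
  (mu P <= parent_ratio%:E * mu A)%E].
Proof.
move=> nA; case: (nA) => a Qa; have [b [aP _]] := df_nested df a.
have nP : cubes (n - 1) (Q b) by exists b.
exists (Q b); split => //; first by rewrite -Qa.
have [z [Xz Az _]] := cubes_center nA.
have Pz : Q b z by apply: aP; rewrite Qa.
apply: le_trans (cube_comparable nA Az _); last by rewrite divr_gt0.
apply: le_measure; rewrite ?inE.
- exact: cubes_measurable nP.
- by apply: (ball_measurable S) => //; rewrite mulr_gt0// divr_gt0.
- rewrite (_ : L0 / delta * delta ^ n = L0 * delta ^ (n - 1)).
    exact: cubes_sub_ball.
  by rewrite expfzDr ?gt_eqF// exprN1; ring.
Qed.

Lemma cubes_ancestor n A k : cubes n A -> exists2 P, cubes (n - k%:Z) P & A `<=` P.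
Proof.
move=> nA; elim: k => [|k [P nP AP]]; first by exists A => //; rewrite subr0.
have [P' [nP' PP' _]] := cubes_parent nP.
exists P'; last exact: subset_trans PP'.
by rewrite (_ : n - _ = n - k%:Z - 1)//; rewrite -addn1 PoszD; ring.
Qed.

Lemma cubes_nested n k A B : cubes n A -> cubes (n + k%:Z) B -> A `&` B !=set0 ->
  B `<=` A.
Proof.
move=> nA nB [x [Ax Bx]]; have [P nP BP] := cubes_ancestor k nB.
rewrite addrK in nP; rewrite (_ : A = P)//.
by apply: (cubes_disjoint nA nP); exists x; split => //; exact: BP.
Qed.

Definition subcubes (n : int) (A : set T) (k : nat) : set (set T) :=
  [set B | cubes (n + k%:Z) B /\ B `<=` A].

Lemma cubes_tree n A : cubes n A -> dyadic_tree mu (subcubes n A) A parent_ratio.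
Proof.
move=> nA; split.
- apply/seteqP; split => [B [nB BA]|_ ->]; last by split => //; rewrite addr0.
  rewrite addr0 in nB; apply: (cubes_disjoint nB nA).
  by have [z [_ Bz _]] := cubes_center nB; exists z; split => //; exact: BA.
- by move=> k B [nB _]; exact: cubes_measurable nB.
- by move=> k B [nB _]; exact: cubes_gt0 nB.
- by move=> k B [nB _]; exact: cubes_fin nB.
- by move=> k B B' [nB _] [nB' _]; exact: (cubes_disjoint nB nB').
- move=> k B [nB BA]; have [P [nP BP muP]] := cubes_parent nB.
  have {}nP : cubes (n + k%:Z) P.
    by rewrite (_ : n + k%:Z = n + k.+1%:Z - 1)//; rewrite -addn1 PoszD; ring.
  exists P; split => //; split => //; apply: (cubes_nested nA nP).
  by have [z [_ Bz _]] := cubes_center nB; exists z; split; [exact: BA|exact: BP].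
- move=> k; apply: (sub_countable _ (cubes_countable (n + k%:Z))).
  by apply: subset_card_le => B [].
Qed.

Lemma cubes_ae_cover n : mu (X `\` \bigcup_(A in cubes n) A) = 0%E.
Proof.
rewrite -(df_cover df n); congr (mu (_ `\` _)).
apply/seteqP; split => [x [A [a <-] Ax]|x [a _ ax]]; first by exists a.
by exists (Q a) => //; exists a.
Qed.

Lemma cubes_cover_measurable n : measurable (\bigcup_(A in cubes n) A).
Proof.
apply: bigcup_countable_measurable; first exact: cubes_countable.
by move=> A; exact: cubes_measurable.
Qed.

(** Countably many generations, so one null set serves all of them; the integers are run through as
    [k] and [- k]. *)
Lemma ae_in_cubes : {ae mu, forall x, X x -> forall n : int, exists2 A, cubes n A & A x}.
Proof.
have H (b : bool) (k : nat) : {ae mu, forall x, X x ->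
    exists2 A, cubes (if b then k%:Z else - k%:Z) A & A x}.
  set n := if b then _ else _.
  exists (X `\` \bigcup_(A in cubes n) A); split.
  - by apply: measurableD; [exact: (space_measurable S)|exact: cubes_cover_measurable].
  - exact: cubes_ae_cover.
  - move=> x /= /not_implyP[Xx H]; split => // -[A nA Ax]; apply: H; by exists A.
have : {ae mu, forall x, (forall k, X x -> exists2 A, cubes k%:Z A & A x) /\
   (forall k, X x -> exists2 A, cubes (- k%:Z) A & A x)}.
  apply: filterI.
  + by apply: ae_foralln => k; exact: (H true k).
  + by apply: ae_foralln => k; exact: (H false k).
apply: filterS => x [Hp Hn] Xx [k|k]; first exact: Hp.
by rewrite NegzE; exact: Hn.
Qed.

Hypothesis LD : lebesgue_differentiation_property X rho mu.

Lemma ball_density (E : set T) : measurable E -> E `<=` X ->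
  {ae mu, forall x, E x -> forall kappa : R, 0 < kappa -> exists2 r0 : R, 0 < r0 &
     forall r, 0 < r -> r < r0 ->
     (mu (ball x r `\` E) <= kappa%:E * mu (ball x r))%E}.
Proof.
move=> mE EX.
have mindic : measurable_fun X (\1_E : T -> R) by exact: measurable_indic.
have fin x r : X x -> 0 < r -> mu (ball x r) \is a fin_num.
  by move=> Xx r0; rewrite ge0_fin_numE// (ds_fin S).
have intE x r : X x -> 0 < r -> mu.-integrable (ball x r) (EFin \o (\1_E : T -> R)).
  move=> Xx r0; have mB := ball_measurable S Xx r0.
  apply/integrableP; split.
    by apply/measurable_EFinP; exact: measurable_indic.
  under eq_integral do rewrite /= ger0_norm//.
  rewrite integral_indic//; apply: le_lt_trans (ds_fin S Xx r0).
  by apply: le_measure; rewrite ?inE//; exact: measurableI.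
have := LD mindic intE; apply: filterS => x H Ex kappa kappa0.
have Xx := EX _ Ex; have {}H := H Xx.
have E1 : \1_E x = 1 :> R by rewrite indicE mem_set.
rewrite E1 in H.
have Hk0 := @cvgr_dist_lt _ _ _ _ _ _ _ H kappa kappa0.
have /nbhs_ballP[r0 /= r00 Hr] : nbhs (0:R) (fun r => 0 < r -> `|1 - avg mu (qball X rho x r%:E) (\1_E : T -> R)| < kappa) by exact: Hk0.
exists r0 => // r r_gt0 rr0.
have := Hr r; rewrite /= -ball_normE /= sub0r normrN gtr0_norm// => /(_ rr0 r_gt0).
have mB := ball_measurable S Xx r_gt0.
rewrite /avg /Rintegral.
have -> : (\int[mu]_(y in ball x r) (\1_E y)%:E = mu (E `&` ball x r))%E.
  by rewrite integral_indic.
have finI : mu (E `&` ball x r) \is a fin_num.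
  rewrite ge0_fin_numE//; apply: le_lt_trans (ds_fin S Xx r_gt0).
  by apply: le_measure; rewrite ?inE//; exact: measurableI.
have mpos : 0 < fine (mu (ball x r)).
  by rewrite fine_gt0// (ds_gt0 S)// (ds_fin S).
move=> /(le_lt_trans (ler_norm _)); rewrite ltrBlDr => Hk.
have -> : (mu (ball x r `\` E) = mu (ball x r) - mu (E `&` ball x r))%E.
  by rewrite measureD//; [rewrite setIC|exact: (ds_fin S)].
rewrite -(fineK (fin x r Xx r_gt0)) -(fineK finI) -EFinB -EFinM lee_fin.
move: Hk; rewrite -ltrBlDl ltr_pdivlMl// mulrBr mulr1 => /ltW.
rewrite lerBlDr lerBlDr addrC mulrC; lra.
Qed.

(** Small cubes about a density point lie in balls of comparable measure, so balls almost filled by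
    [E] force the cubes to be more than half filled. *)
Lemma cube_density n A E k : cubes n A -> measurable E -> E `<=` A ->
  mu.-negligible (E `\` \bigcup_(B in [set B | (exists2 l, (k <= l)%N & subcubes n A l B) /\
                                   (mu B < 2%:E * mu (B `&` E))%E]) B).
Proof.
move=> nA mE EA; have EX := subset_trans EA (cubes_sub nA).
have Hae := @filterI _ (almost_everywhere mu) _ _ _ ae_in_cubes (ball_density mE EX).
apply: (negligibleS _ (Hae _)) => x [Ex nU] [/= /(_ (EX _ Ex)) Hc /(_ Ex) Hd]; apply: nU.
have Xx := EX _ Ex.
(* The cube [B] has at least the fraction [1 / cube_ratio L0] of the ball, so at most a quarter of
   [B] lies outside [E]. *)
pose kap : R := (4 * cube_ratio L0)^-1.
have cr0 : 0 < cube_ratio L0 by exact: lt_le_trans (cube_ratio_ge1 _).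
have kap0 : 0 < kap by rewrite invr_gt0 mulr_gt0.
have [r0 r00 Hr] := Hd kap kap0.
have [l [kl lr]] : exists l, (k <= l)%N /\ L0 * delta ^ (n + l%:Z) < r0.
  have d1 : `|delta| < 1 by rewrite gtr0_norm//; case/andP: delta01.
  have e0 : 0 < r0 / (L0 * delta ^ n) by rewrite divr_gt0// mulr_gt0.
  have := @cvgr0_norm_lt _ _ _ _ _ _ (cvg_expr d1) _ e0.
  move=> [N _ HN]; exists (maxn k N); split; first exact: leq_maxl.
  have := HN (maxn k N) (leq_maxr _ _); rewrite /= ger0_norm ?exprn_ge0 ?(ltW delta_gt0)//.
  rewrite ltr_pdivlMr ?mulr_gt0// => H; rewrite expfzDr ?gt_eqF// mulrA mulrC; exact: H.
have [B nB Bx] := Hc (n + l%:Z).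
have rl0 : 0 < L0 * delta ^ (n + l%:Z) by rewrite mulr_gt0.
have BA : B `<=` A.
  by apply: (cubes_nested nA nB); exists x; split => //; exact: EA.
exists B => //; split; first by exists l.
have mB := cubes_measurable nB.
have finB : mu B \is a fin_num by rewrite ge0_fin_numE// (cubes_fin nB).
have Bb := cubes_sub_ball nB Bx.
have le1 : (mu (B `\` E) <= (4^-1)%:E * mu B)%E.
  apply: (@le_trans _ _ (mu (ball x (L0 * delta ^ (n + l%:Z)) `\` E))).
    apply: le_measure; rewrite ?inE; [exact: measurableD| |exact: setSD].
    by apply: measurableD => //; exact: (ball_measurable S).
  apply: (le_trans (Hr _ rl0 lr)).
  apply: (@le_trans _ _ (kap%:E * ((cube_ratio L0)%:E * mu B))%E).
    by rewrite lee_wpmul2l ?lee_fin ?(ltW kap0)//; exact: cube_comparable.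
  by rewrite muleA -EFinM /kap invfM mulfVK ?gt_eqF.
have finBE : mu (B `&` E) \is a fin_num.
  rewrite ge0_fin_numE//; apply: le_lt_trans (cubes_fin nB).
  by apply: le_measure; rewrite ?inE//; exact: measurableI.
have finBD : mu (B `\` E) \is a fin_num.
  rewrite ge0_fin_numE//; apply: le_lt_trans (cubes_fin nB).
  by apply: le_measure; rewrite ?inE//; exact: measurableD.
have B0 : 0 < fine (mu B) by rewrite fine_gt0// (cubes_gt0 nB) (cubes_fin nB).
have mBE : (mu B = mu (B `\` E) + mu (B `&` E))%E by exact: measureDI.
move: le1 B0 mBE.
rewrite -(fineK finB) -(fineK finBE) -(fineK finBD) -EFinD -!EFinM lee_fin lte_fin.
by move=> + + [] /=; lra.
Qed.

End filtration.

(** * Weighted measure of cubes *)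

Section weighted_cubes.
Context d (T : measurableType d) (R : realType).
Variables (X : set T) (rho : T -> T -> R) (mu nu : {measure set T -> \bar R}).
Variables (K C delta eps0 N0 : R) (I : int -> Type) (Q : forall n, I n -> set T).
Hypotheses (S : doubling_space X rho mu K C) (delta01 : 0 < delta < 1)
  (eps0_gt0 : 0 < eps0).
Hypothesis df : dyadic_filtration X rho mu delta eps0 N0 Q.
Hypothesis LD : lebesgue_differentiation_property X rho mu.
Variables (s Kw : R) (w : T -> R).
Hypotheses (s_gt1 : 1 < s) (w_ge0 : forall x, X x -> 0 <= w x)
  (mw : measurable_fun X w) (Apw : (Ap_const X rho mu s w <= Kw%:E)%E).
Hypothesis nuE : forall A, measurable A -> A `<=` X -> nu A = (\int[mu]_(x in A) (w x)%:E)%E.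
Local Notation ball x r := (qball X rho x r%:E).
Local Notation cubes := (cubes Q).
Local Notation cr := (cube_ratio K C eps0 N0).
Local Notation L0 := (cube_size N0).

(** [cr L0] compares the ball around a cube with the cube, and 2 accounts for a set filling half of
    the cube; the maximum makes the ratio exceed 1. *)
Definition weight_ratio : R := Num.max Kw 1 * (2 * cr L0) `^ s.

Let delta_gt0 : 0 < delta. Proof. by case/andP: delta01. Qed.
Let L0_gt0 : 0 < L0. Proof. by rewrite ltr_wpDl. Qed.
Let cr0 : 0 < cr L0. Proof. exact: lt_le_trans (cube_ratio_ge1 _ _ S _). Qed.
Let s_gt0 : 0 < s. Proof. exact: lt_trans s_gt1. Qed.

Lemma weight_ratio_gt1 : 1 <= C -> 1 < weight_ratio.
Proof.
move=> C1; have cr1 : 1 <= cr L0 by rewrite exprn_ege1.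
have h2 : 1 < (2 * cr L0) `^ s.
  have p1 : 1 `^ s = 1 :> R by rewrite powR1.
  have s0 : 0 < s by exact: lt_trans s_gt1.
  by rewrite -[X in X < _]p1 gt0_ltr_powR ?nnegrE//; lra.
apply: (lt_le_trans h2); rewrite /weight_ratio ler_peMl ?powR_ge0//.
by rewrite le_max lexx orbT.
Qed.

Let wr0 : 0 < weight_ratio. Proof. exact: lt_trans (weight_ratio_gt1 (ds_C S)). Qed.

Lemma cubes_nu_fin n P : cubes n P -> (nu P < +oo)%E.
Proof.
move=> nP; have [z [Xz Pz _]] := cubes_center S delta01 eps0_gt0 df nP.
have r0 : 0 < L0 * delta ^ n by rewrite mulr_gt0// exprz_gt0.
have mB := ball_measurable S Xz r0; have mP := cubes_measurable S df nP.
apply: (@le_lt_trans _ _ (nu (ball z (L0 * delta ^ n)))).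
  apply: le_measure; rewrite ?inE//.
  exact: (cubes_sub_ball delta01 df nP Pz).
rewrite nuE//; last exact: ball_in.
exact: (Ap_weight_lty S s_gt1 mw Apw Xz r0).
Qed.

Lemma nu_negligible N : measurable N -> N `<=` X -> mu N = 0%E -> nu N = 0%E.
Proof.
move=> mN NX N0'; rewrite nuE//; apply: null_set_integral => //.
apply/measurable_EFinP; apply: measurable_funS mw => //.
exact: (space_measurable S).
Qed.

Lemma cube_nu_lower n P E : cubes n P -> measurable E -> E `<=` P ->
  (mu P <= 2%:E * mu E)%E -> (nu P <= weight_ratio%:E * nu E)%E.
Proof.
move=> nP mE EP muE; have [z [Xz Pz _]] := cubes_center S delta01 eps0_gt0 df nP.
have r0 : 0 < L0 * delta ^ n by rewrite mulr_gt0// exprz_gt0.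
have mB := ball_measurable S Xz r0; have mP := cubes_measurable S df nP.
have PB := cubes_sub_ball delta01 df nP Pz.
have BX := @ball_in _ _ _ X rho z (L0 * delta ^ n).
have H := Ap_subset_lower S s_gt1 w_ge0 mw Apw Xz r0 mE (subset_trans EP PB).
have PX := cubes_sub df nP.
rewrite -!nuE// in H; last exact: (subset_trans EP PX).
have finP : mu P \is a fin_num by rewrite ge0_fin_numE// (cubes_fin S delta01 eps0_gt0 df nP).
have finE : mu E \is a fin_num.
  rewrite ge0_fin_numE//; apply: le_lt_trans (cubes_fin S delta01 eps0_gt0 df nP).
  by apply: le_measure; rewrite ?inE.
have finB : mu (ball z (L0 * delta ^ n)) \is a fin_num by rewrite ge0_fin_numE// (ds_fin S).
have := cube_comparable S delta01 eps0_gt0 df nP Pz L0_gt0.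
have P0 : 0 < fine (mu P).
  by rewrite fine_gt0// (cubes_gt0 S delta01 eps0_gt0 df nP) (cubes_fin S delta01 eps0_gt0 df nP).
move: H muE; rewrite -(fineK finP) -(fineK finE) -(fineK finB) -!EFinM !lee_fin /=.
set a := fine (mu P) in P0 *; set b := fine (mu (ball _ _)); set e := fine (mu E).
move=> H ae ba.
have e0 : 0 < e by nra.
have b0 : 0 <= b by exact: fine_ge0.
have es0 : 0 < e `^ s by rewrite powR_gt0.
apply: (@le_trans _ _ (nu (ball z (L0 * delta ^ n)))).
  by apply: le_measure; rewrite ?inE.
apply: (@le_trans _ _ ((e `^ s)^-1%:E * ((Kw * b `^ s)%:E * nu E))%E).
  by rewrite lee_pdivlMl.
rewrite muleA -EFinM lee_wpmul2r// lee_fin ler_pdivrMl//.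
have bs : b `^ s <= (2 * cr L0) `^ s * e `^ s.
  rewrite -powRM ?mulr_ge0 ?(ltW cr0) ?(ltW e0)//.
  rewrite ge0_ler_powR ?nnegrE ?(ltW s_gt0)//.
    by rewrite !mulr_ge0 ?(ltW cr0) ?(ltW e0).
  by apply: (le_trans ba); nra.
apply: (@le_trans _ _ (Num.max Kw 1 * b `^ s)).
  by rewrite ler_wpM2r ?powR_ge0// le_max lexx.
apply: (@le_trans _ _ (Num.max Kw 1 * ((2 * cr L0) `^ s * e `^ s))).
  by rewrite ler_wpM2l// le_max ler01 orbT.
by rewrite le_eqVlt /weight_ratio; apply/orP; left; apply/eqP; ring.
Qed.

(** The complement of [E] fills at least half of [P], hence carries at least the fraction
    [1 / weight_ratio] of its weight. *)
Lemma cube_nu_half n P E : cubes n P -> measurable E -> E `<=` P ->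
  (2%:E * mu E <= mu P)%E -> (nu E <= (1 - weight_ratio^-1)%:E * nu P)%E.
Proof.
move=> nP mE EP muE; have mP := cubes_measurable S df nP.
have finP : mu P \is a fin_num by rewrite ge0_fin_numE// (cubes_fin S delta01 eps0_gt0 df nP).
have fin (m : {measure set T -> \bar R}) A : measurable A -> A `<=` P ->
    m P \is a fin_num -> m A \is a fin_num.
  move=> mA AP; rewrite !ge0_fin_numE//; apply: le_lt_trans.
  by apply: le_measure; rewrite ?inE.
have nfinP : nu P \is a fin_num by rewrite ge0_fin_numE// (cubes_nu_fin nP).
have PEE : P `&` E = E by apply/setIidPr.
have split (m : {measure set T -> \bar R}) : (m P = m (P `\` E) + m E)%E.
  by rewrite -[in m E]PEE; exact: measureDI.
have mPE : measurable (P `\` E) by exact: measurableD.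
have half : (mu P <= 2%:E * mu (P `\` E))%E.
  move: muE; have := split mu.
  rewrite -(fineK (fin mu P mP _ finP))// -(fineK (fin mu E mE EP finP)).
  rewrite -(fineK (fin mu (P `\` E) mPE (@subDsetl _ _ _) finP)) -EFinD -!EFinM !lee_fin.
  by move=> [] ->; lra.
have := cube_nu_lower nP mPE (@subDsetl _ _ _) half; have := split nu.
rewrite -(fineK nfinP) -(fineK (fin nu E mE EP nfinP)).
rewrite -(fineK (fin nu (P `\` E) mPE (@subDsetl _ _ _) nfinP)) -EFinD -!EFinM !lee_fin.
move=> [] ->; set u := fine _; set v := fine _ => H.
have u0 : 0 <= u by exact: fine_ge0.
have := H; rewrite -ler_pdivrMl// => H2; lra.
Qed.

End weighted_cubes.

Definition local_const (R : realType) (Cd K3 p : R) (n : nat) : R :=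
  let B := (K3 + 2) `^ p in let e := (2 * (2 * Cd) ^+ n)^-1 / Cd in
  2 `^ p * (1 + 2 * B + 2 * B ^+ 2 / e `^ p * (B / (B - 1))).

Lemma local_const_gt0 (R : realType) (Cd K3 p : R) n : 1 <= Cd -> 0 < K3 -> 0 < p ->
  0 < local_const Cd K3 p n.
Proof.
move=> Cd1 K30 p0; rewrite /local_const; set B := (K3 + 2) `^ p.
have B1 : 1 < B.
  have p1 : 1 `^ p = 1 :> R by rewrite powR1.
  by rewrite -[X in X < _]p1 gt0_ltr_powR ?nnegrE//; lra.
have B0 : 0 < B by exact: lt_trans B1.
have Cd0 : 0 < Cd by exact: lt_le_trans Cd1.
have e0 : 0 < (2 * (2 * Cd) ^+ n)^-1 / Cd.
  by rewrite divr_gt0// invr_gt0 mulr_gt0// exprn_gt0// mulr_gt0.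
rewrite mulr_gt0 ?powR_gt0// addr_gt0//; last first.
  rewrite mulr_gt0//; last by rewrite divr_gt0// subr_gt0.
  by rewrite divr_gt0 ?powR_gt0// mulr_gt0// exprn_gt0.
by rewrite addr_gt0// mulr_gt0.
Qed.

(** [Q] is the part of [F] outside a large cube. Eliminating it leaves [F] on the right with a
    smaller coefficient than [A] has on the left, and [A] will tend to [F]. *)
Lemma absorb_remainder (R : realType) (c1 c2 c3 A F G Q : R) :
  F = A + Q -> A <= c1 * (c2 * G + c3 * Q) -> A * (1 + c1 * c3) <= c1 * c2 * G + c1 * c3 * F.
Proof. by move=> ->; lra. Qed.

(** * From one cube to an increasing chain of cubes *)

Section global_fefferman_stein.
Context d (T : measurableType d) (R : realType).
Variables (X : set T) (rho : T -> T -> R) (mu nu : {measure set T -> \bar R}).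
Variables (K C delta eps0 N0 : R) (I : int -> Type) (Q : forall n, I n -> set T).
Hypotheses (S : doubling_space X rho mu K C) (delta01 : 0 < delta < 1)
  (eps0_gt0 : 0 < eps0).
Hypothesis df : dyadic_filtration X rho mu delta eps0 N0 Q.
Hypothesis LD : lebesgue_differentiation_property X rho mu.
Variables (s Kw : R) (w : T -> R).
Hypotheses (s_gt1 : 1 < s) (w_ge0 : forall x, X x -> 0 <= w x)
  (mw : measurable_fun X w) (Apw : (Ap_const X rho mu s w <= Kw%:E)%E).
Hypothesis nuE : forall A, measurable A -> A `<=` X -> nu A = (\int[mu]_(x in A) (w x)%:E)%E.
Local Notation ball x r := (qball X rho x r%:E).
Local Notation cubes := (cubes Q).
Local Notation cr := (cube_ratio K C eps0 N0).
Local Notation L0 := (cube_size N0).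
Local Notation wr := (weight_ratio K C eps0 N0 s Kw).
Local Notation Cd := (parent_ratio K C delta eps0 N0).
Variables (K3 p : R) (f g : T -> R) (n0 : nat).
Hypotheses (K3_gt0 : 0 < K3) (p_gt0 : 0 < p).
Hypotheses (mf : measurable_fun X f) (mg : measurable_fun X g).
Local Open Scope ereal_scope.
Hypothesis osc : forall n P, cubes n P -> exists (fP : T -> R) (m : R),
  [/\ measurable_fun P fP, forall x, P x -> (`|f x| <= fP x <= K3 * `|f x|)%R,
      \int[mu]_(x in P) (fP x)%:E = m%:E * mu P &
      forall y, P y -> \int[mu]_(x in P) `|fP x - m|%:E <= (g y)%:E * mu P].
Hypothesis n0_large : forall k, (n0 < k)%N -> ((1 - wr^-1) ^+ k * (K3 + 2) `^ p <= 2^-1)%R.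
Local Notation C1 := (local_const Cd K3 p n0).

Let mX : measurable X. Proof. exact: (space_measurable S). Qed.
Let mfp (h : T -> R) A : measurable_fun X h -> A `<=` X ->
  measurable_fun A (fun x => (`|h x| `^ p)%:E).
Proof.
move=> mh AX; apply: (measurable_funS mX AX).
apply: (@eq_measurable_fun _ _ _ _ _ (fun x => `|h x|%:E `^ p)) => //.
apply: (measurableT_comp (measurable_poweR p)).
by apply/measurable_EFinP; exact: measurableT_comp.
Qed.
Let hp0 (h : T -> R) x : 0 <= (`|h x| `^ p)%:E.
Proof. by rewrite lee_fin powR_ge0. Qed.
Let wr1 : (1 < wr)%R. Proof. exact: (weight_ratio_gt1 K eps0 N0 Kw s_gt1 (ds_C S)). Qed.
Let wr0 : (0 < wr)%R. Proof. exact: lt_trans wr1. Qed.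
Let Cd1 : (1 <= Cd)%R. Proof. exact: (cube_ratio_ge1 _ _ S). Qed.
Let C10 : (0 < C1)%R. Proof. exact: local_const_gt0. Qed.

Lemma cube_local_fs n P lam : cubes n P -> (0 < lam)%R ->
  \int[mu]_(x in P) `|f x|%:E <= lam%:E * mu P ->
  \int[nu]_(x in P) (`|f x| `^ p)%:E <=
  C1%:E * ((lam `^ p)%:E * nu P + \int[nu]_(x in P) (`|g x| `^ p)%:E).
Proof.
move=> nP lam0 flam; have PX := cubes_sub df nP.
apply: (@local_fefferman_stein _ _ _ mu nu (subcubes Q n P) P Cd (1 - wr^-1)%R) => //.
- exact: (cubes_tree S delta01 eps0_gt0 df).
- by rewrite subr_ge0 invf_le1// ltW.
- move=> B E [k [nB _]]; exact: (cube_nu_half S delta01 eps0_gt0 df s_gt1 w_ge0 mw Apw nuE nB).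
- move=> k E mE EP; have := cube_density S delta01 eps0_gt0 df LD k nP mE EP.
  have mU := density_measurable (cubes_tree S delta01 eps0_gt0 df nP) k mE.
  move=> /negligibleP H; apply: (nu_negligible S mw nuE).
  + exact: measurableD.
  + by move=> x [/EP/PX].
  + by apply: H; exact: measurableD.
- exact: (cubes_nu_fin S delta01 eps0_gt0 df s_gt1 mw Apw nuE nP).
- exact: measurable_funS mf.
- exact: measurable_funS mg.
- by move=> B [k [nB _]]; exact: osc nB.
- exact: n0_large.
Qed.

Section chain.
Variables (A0 : set T) (P : nat -> set T).
Hypotheses (A0_neq0 : A0 !=set0) (nP : forall k, cubes (- k%:Z) (P k))
  (AP : forall k, A0 `<=` P k).

Let mP k : measurable (P k). Proof. exact: (cubes_measurable S df (nP k)). Qed.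
Let PX k : P k `<=` X. Proof. exact: (cubes_sub df (nP k)). Qed.

Lemma chain_mono : {homo P : n m / (n <= m)%N >-> (n <= m)%O}.
Proof.
move=> n m nm; apply/subsetPset.
apply: (cubes_nested S delta01 eps0_gt0 df (nP m) (k := (m - n)%N)).
  by rewrite -subzn// addrA addNr add0r.
by have [x Ax] := A0_neq0; exists x; split; exact: AP.
Qed.

Let U := \bigcup_k P k.
Let mU : measurable U. Proof. exact: bigcupT_measurable. Qed.
Let UX : U `<=` X. Proof. by move=> x [k _ /PX]. Qed.
Let PU k : P k `<=` U. Proof. by move=> x Px; exists k. Qed.
Let a k := \int[nu]_(x in P k) (`|f x| `^ p)%:E.
Let r k := \int[nu]_(x in U `\` P k) (`|f x| `^ p)%:E.
Let F := \int[nu]_(x in U) (`|f x| `^ p)%:E.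
Let G := \int[nu]_(x in U) (`|g x| `^ p)%:E.

Let UDX k : U `\` P k `<=` X. Proof. by move=> x [/UX]. Qed.

Let r_ge0 k : 0 <= r k. Proof. by apply: integral_ge0 => x _; exact: hp0. Qed.
Let G_ge0 : 0 <= G. Proof. by apply: integral_ge0 => x _; exact: hp0. Qed.

Let mfin k A : measurable A -> A `<=` P k -> mu A \is a fin_num.
Proof.
move=> mA Ak; rewrite ge0_fin_numE//; apply: le_lt_trans (cubes_fin S delta01 eps0_gt0 df (nP k)).
by apply: le_measure; rewrite ?inE.
Qed.

Let c2 : R := (8 `^ p + 1)%R.
Let c3 : R := (wr * (2 * K3) `^ p)%R.

(** The local estimate is applied at the mean [m] of [fP], which leaves m^p times [nu (P k)] to be
    bounded. If [g >= m / 8] on [P k], the integral of |g|^p pays. Otherwise [fP >= m / 2] off a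
    quarter of [P k]. This excludes [f = 0] on half of [P k]; and if [P N] is at most a quarter,
    then half of [P k] lies outside [P N] with |f| comparable to [m], so [A_s] bounds [nu (P k)]
    through [r N]. *)
Lemma chain_step k N : (N <= k)%N ->
  (4%:E * mu (P N) <= mu (P k) \/ 2%:E * mu (P k `&` [set x | f x != 0%R]) <= mu (P k)) ->
  a k <= C1%:E * (c2%:E * G + c3%:E * r N).
Proof.
move=> Nk H; have [fP [m [mfP fPf mE oscP]]] := osc (nP k).
have Gk : \int[nu]_(x in P k) (`|g x| `^ p)%:E <= G.
  apply: ge0_subset_integral => //; exact: mfp.
have c30 : (0 <= c3)%R by rewrite mulr_ge0 ?powR_ge0// ltW.
have fP0 x : P k x -> (0 <= fP x)%R.
  by move=> Px; have /andP[+ _] := fPf x Px; apply: le_trans.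
have mnf : measurable_fun (P k) (fun x => `|f x|%:E).
  by apply/measurable_EFinP; apply: measurableT_comp => //; exact: measurable_funS mf.
have mfPE : measurable_fun (P k) (fun x => (fP x)%:E) by exact/measurable_EFinP.
have Pk0 : 0 < mu (P k) by exact: (cubes_gt0 S delta01 eps0_gt0 df (nP k)).
have finPk : mu (P k) \is a fin_num by exact: (mfin (k := k)) (mP k) _.
have flam : \int[mu]_(x in P k) `|f x|%:E <= m%:E * mu (P k).
  rewrite -mE; apply: ge0_le_integral => //.
  by move=> x Px; rewrite lee_fin; have /andP[] := fPf x Px.
have m0 : (0 <= m)%R.
  have : 0 <= m%:E * mu (P k) by rewrite -mE integral_ge0// => x Px; rewrite lee_fin fP0.
  by rewrite pmule_lge0.
(* The local estimate asks for a positive level. A zero mean forces [f = 0] a.e. on [P k], for [mu]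
   and hence for [nu]. *)
have [mz|mN0] := eqVneq m 0%R.
  suff -> : a k = 0.
    apply: mule_ge0; first by rewrite lee_fin ltW.
    apply: adde_ge0.
      by apply: mule_ge0; [rewrite lee_fin addr_ge0 ?powR_ge0|exact: G_ge0].
    by apply: mule_ge0; [rewrite lee_fin mulr_ge0 ?powR_ge0 ?(ltW wr0)|exact: r_ge0].
  have f0 : \int[mu]_(x in P k) `|f x|%:E = 0.
    apply/eqP; rewrite eq_le integral_ge0// andbT.
    by apply: (le_trans flam); rewrite mz mul0e.
  have aef := integral_eq0_ae (mP k) mnf (fun x _ => normr_ge0 (f x)) f0.
  pose Z := P k `&` [set x | 0 < `|f x|%:E].
  have mZ : measurable Z by exact: emeasurable_fun_o_infty.
  have muZ : mu Z = 0.
    apply/(negligibleP mu mZ); apply: negligibleS aef => x [Px /= fx] /(_ Px) /= [fz].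
    by move: fx; rewrite fz ltxx.
  have nuZ : nu Z = 0.
    by apply: (nu_negligible S mw nuE) => // x [/PX].
  rewrite /a -(integral0 nu (P k)); apply: ge0_ae_eq_integral => //; first exact: mfp.
  exists Z; split => // x /= /not_implyP[Px H0]; split => //=.
  rewrite lt0e lee_fin normr_ge0 andbT; apply/eqP => -[fz]; apply: H0.
  by rewrite fz powR0// gt_eqF.
have {mN0}m0 : (0 < m)%R by rewrite lt_neqAle eq_sym mN0.
have := cube_local_fs (nP k) m0 flam; rewrite -/(a k) => /le_trans; apply.
rewrite lee_wpmul2l ?lee_fin ?(ltW C10)//.
rewrite /c2 EFinD ge0_muleDl ?lee_fin ?powR_ge0//.
rewrite mul1e addeAC leeD//.
have [[y Py gy]|gbig] := pselect (exists2 y, P k y & (g y < m / 8)%R); last first.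
  rewrite -[leLHS]adde0; apply: leeD; last first.
    by apply: mule_ge0; [rewrite lee_fin mulr_ge0 ?powR_ge0 ?(ltW wr0)|exact: r_ge0].
  have gm x : P k x -> (m / 8 <= `|g x|)%R.
    move=> Px; apply: le_trans (ler_norm _); rewrite leNgt; apply/negP => gx.
    by apply: gbig; exists x.
  have gmp : ((m / 8) `^ p)%:E * nu (P k) <= G.
    apply: le_trans Gk; rewrite -(integral_cst _ (mP k)); apply: ge0_le_integral => //.
    - by move=> x _; rewrite lee_fin powR_ge0.
    - exact: mfp.
    - move=> x Px; rewrite lee_fin; apply: ge0_ler_powR; rewrite ?nnegrE ?(ltW p_gt0) ?gm//.
      by rewrite divr_ge0// ltW.
  rewrite -lee_pdivrMl ?powR_gt0//; apply: le_trans gmp.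
  rewrite muleA -EFinM powRM ?invr_ge0 ?(ltW m0)// mulrC.
  rewrite -[8^-1%R in leRHS]powR_inv1// -powRrM mulN1r powRN.
  by rewrite le_eqVlt; apply/orP; left; apply/eqP.
pose E0 := P k `&` [set x | (fP x)%:E < (m / 2)%:E].
have mE0 : measurable E0 by exact: emeasurable_fun_infty_o.
have E0P : E0 `<=` P k by exact: subIsetl.
have finE0 : mu E0 \is a fin_num by exact: mfin E0P.
(* Chebyshev: on [E0] the deviation from [m] exceeds [m / 2], while its mean over [P k] is at most
   [m / 8]. *)
have E0small : 4%:E * mu E0 <= mu (P k).
  have mosc : measurable_fun (P k) (fun x => `|fP x - m|%:E).
    apply/measurable_EFinP; apply: measurableT_comp => //.
    by apply: measurable_funB.
  have h1 : (m / 2)%:E * mu E0 <= (m / 8)%:E * mu (P k).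
    apply: (@le_trans _ _ (\int[mu]_(x in P k) `|fP x - m|%:E)); last first.
      apply: (le_trans (oscP y Py)); rewrite lee_wpmul2r// lee_fin ltW//.
    apply: (@le_trans _ _ (\int[mu]_(x in E0) `|fP x - m|%:E)); last first.
      exact: ge0_subset_integral.
    rewrite -integral_cst//; apply: ge0_le_integral => //.
    - by move=> x _; rewrite lee_fin divr_ge0// ltW.
    - exact: measurable_funS mosc.
    - move=> x [Px /=]; rewrite lte_fin lee_fin => fx.
      by rewrite ler0_norm; lra.
  move: h1; rewrite -(fineK finE0) -(fineK finPk) -!EFinM !lee_fin => h1.
  by rewrite -(ler_pM2l m0); lra.
case: H => [HN|HZ]; last first.
  exfalso; pose Z := P k `&` [set x | 0 < `|f x|%:E].
  have ZE : P k `&` [set x | f x != 0%R] = Z.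
    by apply/seteqP; split => x [Px /= fx]; split => //=; move: fx; rewrite lte_fin normr_gt0.
  have mZ : measurable Z by exact: emeasurable_fun_o_infty.
  have ZP : Z `<=` P k by exact: subIsetl.
  rewrite ZE in HZ; have : mu (P k) <= mu Z + mu E0.
    apply: le_trans (measureU2 mu mZ mE0); apply: le_measure; rewrite ?inE//.
      exact: measurableU.
    move=> x Px; have [fx|fx] := eqVneq (f x) 0%R; last first.
      by left; split => //=; rewrite lte_fin normr_gt0.
    right; split => //=; rewrite lte_fin; have /andP[_] := fPf x Px.
    by rewrite fx normr0 mulr0 => /le_lt_trans; apply; rewrite divr_gt0.
  move: HZ E0small Pk0; rewrite -(fineK finE0) -(fineK finPk) -(fineK (mfin mZ ZP)).
  by rewrite -EFinD -!EFinM !lee_fin lte_fin; lra.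
rewrite -[leLHS]add0e leeD ?mule_ge0 ?lee_fin ?powR_ge0//.
pose E := (P k `\` E0) `\` P N.
have mEE : measurable E by apply: measurableD => //; exact: measurableD.
have EP : E `<=` P k by move=> x [[]].
have PN : P N `<=` P k by apply/subsetPset; exact: chain_mono.
have Ebig : mu (P k) <= 2%:E * mu E.
  have : mu (P k) <= mu (E `|` E0) + mu (P N).
    apply: le_trans (measureU2 mu (measurableU _ _ mEE mE0) (mP N)).
    apply: le_measure; rewrite ?inE//.
      by apply: measurableU => //; exact: measurableU.
    move=> x Px; have [|xN] := pselect (P N x); first by right.
    by left; have [|xE] := pselect (E0 x); [right|left].
  have : mu (E `|` E0) <= mu E + mu E0 by exact: measureU2.
  have EE0 : E `|` E0 `<=` P k by move=> x [/EP|/E0P].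
  move: HN E0small; rewrite -(fineK finE0) -(fineK finPk) -(fineK (mfin mEE EP)).
  rewrite -(fineK (mfin (mP N) PN)) -(fineK (mfin (measurableU _ _ mEE mE0) EE0)).
  by rewrite -!EFinD -!EFinM !lee_fin; lra.
have nuPE := cube_nu_lower S delta01 eps0_gt0 df s_gt1 w_ge0 mw Apw nuE (nP k) mEE EP Ebig.
have ErN : ((m / (2 * K3)) `^ p)%:E * nu E <= r N.
  apply: (@le_trans _ _ (\int[nu]_(x in E) (`|f x| `^ p)%:E)); last first.
    apply: ge0_subset_integral => //; [exact: measurableD|exact: mfp|].
    by move=> x [[Px _] Nx]; split => //; exact: PU Px.
  rewrite -(integral_cst _ mEE); apply: ge0_le_integral => //.
  - by move=> x _; rewrite lee_fin powR_ge0.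
  - by apply: mfp => // x /EP/PX.
  - move=> x Ex; have [[Px nE0] _] := Ex; rewrite lee_fin.
    apply: ge0_ler_powR; rewrite ?nnegrE ?(ltW p_gt0)//.
      by rewrite divr_ge0 ?mulr_ge0 ?(ltW m0) ?(ltW K3_gt0).
    rewrite ler_pdivrMr ?mulr_gt0//; have /andP[_ fx] := fPf x Px.
    have mfx : (m / 2 <= fP x)%R.
      by rewrite leNgt; apply/negP => H; apply: nE0; split => //=; rewrite lte_fin.
    by nra.
apply: (@le_trans _ _ ((m `^ p)%:E * (wr%:E * nu E))).
  by rewrite lee_wpmul2l// lee_fin powR_ge0.
apply: (@le_trans _ _ (c3%:E * (((m / (2 * K3)) `^ p)%:E * nu E))); last first.
  by rewrite lee_wpmul2l// lee_fin.
rewrite !muleA -!EFinM lee_wpmul2r// lee_fin /c3.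
have k0 : (0 < 2 * K3)%R by rewrite mulr_gt0.
rewrite [((m / _) `^ _)%R]powRM ?invr_ge0 ?(ltW m0) ?(ltW k0)// -[((2 * K3)^-1)%R]powR_inv1 ?(ltW k0)//.
rewrite -powRrM mulN1r powRN le_eqVlt; apply/orP; left; apply/eqP; field.
by rewrite gt_eqF// powR_gt0.
Qed.

Hypothesis chain_size : forall N, exists2 k, (N <= k)%N &
  4%:E * mu (P N) <= mu (P k) \/ 2%:E * mu (P k `&` [set x | f x != 0%R]) <= mu (P k).

(** As [a N <= a k] and [F = a N + r N], the step bounds [a N] by [F] and [G]. In the limit [a N]
    becomes [F], the terms with [c3] cancel because [F] is finite, and only [C1 * c2] remains. *)
Lemma chain_fs : F < +oo -> F <= (C1 * c2)%:E * G.
Proof.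
move=> Foo; have c20 : (0 < c2)%R by rewrite ltr_wpDl// powR_ge0.
have [->|Goo] := eqVneq G +oo; first by rewrite gt0_muley ?leey// lte_fin mulr_gt0.
have F0 : 0 <= F by apply: integral_ge0 => x _; exact: hp0.
have Ffin : F \is a fin_num by rewrite (ge0_fin_numE F0).
have Gfin : G \is a fin_num by rewrite (ge0_fin_numE G_ge0) ltey.
have FE N : F = a N + r N.
  rewrite /F -(setDUK (@PU N)) ge0_integral_setU//; first exact: measurableD.
  - by rewrite setDUK//; exact: mfp.
  - by apply/disj_setPS => x [Px [_]].
have a_ge0 N : 0 <= a N by apply: integral_ge0 => x _; exact: hp0.
have aF N : a N \is a fin_num.
  rewrite (ge0_fin_numE (a_ge0 N)); apply: (@le_lt_trans _ _ (a N + r N)).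
    exact: leeDl (r_ge0 N).
  by rewrite -FE.
have rF N : r N \is a fin_num.
  rewrite (ge0_fin_numE (r_ge0 N)); apply: (@le_lt_trans _ _ (a N + r N)).
    exact: leeDr (a_ge0 N).
  by rewrite -FE.
have c30 : (0 < c3)%R by rewrite mulr_gt0 ?powR_gt0// mulr_gt0.
have C130 : (0 < 1 + C1 * c3)%R by rewrite addr_gt0// mulr_gt0.
have bnd N : a N <= ((C1 * c2 * fine G + C1 * c3 * fine F) / (1 + C1 * c3))%:E.
  have [k Nk H] := chain_size N.
  have aNk : a N <= a k.
    apply: ge0_subset_integral => //; first exact: mfp.
    by apply/subsetPset; exact: chain_mono.
  have := le_trans aNk (chain_step Nk H); have := FE N.
  rewrite -(fineK (aF N)) -(fineK (rF N)) -(fineK Gfin) -(fineK Ffin) -!EFinM -!EFinD.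
  rewrite -?EFinM !lee_fin => -[FE'] H2.
  rewrite (ler_pdivlMr _ _ C130); exact: absorb_remainder FE' H2.
have := @ge0_nondecreasing_set_cvg_integral _ _ _ P (fun x => (`|f x| `^ p)%:E) nu
  chain_mono mP (fun k => mfp mf (@PX k)) (fun k x _ => hp0 f x).
rewrite -/U -/F => cF.
have : F <= ((C1 * c2 * fine G + C1 * c3 * fine F) / (1 + C1 * c3))%:E.
  rewrite [leLHS](esym (cvg_lim _ cF))//; apply: lime_le.
    by apply/cvg_ex; exists F.
  by apply: nearW => N; exact: bnd.
rewrite -(fineK Ffin) -(fineK Gfin) -EFinM !lee_fin (ler_pdivlMr _ _ C130).
by rewrite mulrDr mulr1 [(fine F * _)%R]mulrC lerD2r.
Qed.

End chain.
End global_fefferman_stein.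

(** * Components of the dyadic system *)

Section components.
Context d (T : measurableType d) (R : realType).
Variables (X : set T) (rho : T -> T -> R) (mu : {measure set T -> \bar R}).
Variables (K C delta eps0 N0 : R) (I : int -> Type) (Q : forall n, I n -> set T).
Hypotheses (S : doubling_space X rho mu K C) (delta01 : 0 < delta < 1)
  (eps0_gt0 : 0 < eps0).
Hypothesis df : dyadic_filtration X rho mu delta eps0 N0 Q.
Local Notation ball x r := (qball X rho x r%:E).
Local Notation cubes := (cubes Q).
Local Notation cr := (cube_ratio K C eps0 N0).

Let delta_gt0 : 0 < delta. Proof. by case/andP: delta01. Qed.
Let mX : measurable X. Proof. exact: (space_measurable S). Qed.

(** The union of all ancestors of [A]. It may be smaller than [X], like a quadrant for the standard
    dyadic cubes of the plane; together the components cover almost all of [X]. *)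
Definition component (A : set T) :=
  \bigcup_(P in [set P | exists2 k : nat, cubes (- k%:Z) P & A `<=` P]) P.

Lemma component_chain A : cubes 0 A -> exists P : nat -> set T,
  [/\ forall k, cubes (- k%:Z) (P k), forall k, A `<=` P k &
      component A = \bigcup_k P k].
Proof.
move=> nA; have [P HP] : {P : nat -> set T & forall k, cubes (- k%:Z) (P k) /\ A `<=` P k}.
  apply: (@choice _ _ (fun k P => cubes (- k%:Z) P /\ A `<=` P)) => k.
  have [P nP AP] := cubes_ancestor S delta01 eps0_gt0 df k nA.
  by exists P; rewrite sub0r in nP.
have [z [_ Az _]] := cubes_center S delta01 eps0_gt0 df nA.
exists P; split; [by move=> k; have [] := HP k|by move=> k; have [] := HP k|].
apply/seteqP; split => [x [B [k nB AB] Bx]|x [k _ Px]]; last first.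
  by exists (P k) => //; exists k; have [] := HP k.
exists k => //; have [nP AP] := HP k.
by rewrite -(cubes_disjoint df nB nP)//; exists z; split; [exact: AB|exact: AP].
Qed.

Lemma component_sub A B D l : cubes 0 A -> cubes (- l%:Z) D -> A `<=` D -> B `<=` D ->
  component A `<=` component B.
Proof.
move=> nA nD AD BD x [P [k nP AP] Px].
have [z [_ Az _]] := cubes_center S delta01 eps0_gt0 df nA.
have [kl|lk] := leqP k l.
  exists D; first by exists l.
  apply: (cubes_nested S delta01 eps0_gt0 df nD (k := (l - k)%N) _ _ Px).
    by rewrite -subzn// addrA addNr add0r.
  by exists z; split; [exact: AD|exact: AP].
exists P => //; exists k => //; apply: (subset_trans BD).
apply: (cubes_nested S delta01 eps0_gt0 df nP (k := (k - l)%N)).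
  by rewrite -subzn ?(ltnW lk)// addrA addNr add0r.
by exists z; split; [exact: AP|exact: AD].
Qed.

Definition components : set (set T) := [set component A | A in cubes 0].

(** Cubes of the two chains that share a point are nested; the larger one is an ancestor of both
    starting cubes, and from there on the chains agree. *)
Lemma components_disjoint : pairwise_disjoint components.
Proof.
move=> _ _ [A nA <-] [B nB <-] [x [[P [k nP AP] Px] [P' [l nP' BP'] Px']]].
wlog kl : A B nA nB P P' k l nP nP' AP BP' Px Px' / (k <= l)%N.
  move=> H; have [kl|lk] := leqP k l; first exact: (H A B nA nB P P' k l).
  by apply/esym; apply: (H B A nB nA P' P l k) => //; exact: ltnW.
have PP' : P `<=` P'.
  apply: (cubes_nested S delta01 eps0_gt0 df nP' (k := (l - k)%N)).
    by rewrite -subzn// addrA addNr add0r.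
  by exists x.
have AP' := subset_trans AP PP'.
by apply/seteqP; split; [exact: (component_sub nA nP')|exact: (component_sub nB nP')].
Qed.

Lemma components_countable : countable components.
Proof.
have := cubes_countable S delta01 eps0_gt0 df 0.
by apply: sub_countable; exact: card_image_le.
Qed.

Lemma components_measurable : components `<=` measurable.
Proof.
move=> _ [A nA <-]; have [P [nP _ ->]] := component_chain nA.
by apply: bigcupT_measurable => k; exact: (cubes_measurable S df (nP k)).
Qed.

Lemma components_subset U : components U -> U `<=` X.
Proof. by move=> [A nA <-] x [P [k nP _] Px]; exact: (cubes_sub df nP). Qed.

Lemma cubes_sub_components : \bigcup_(A in cubes 0) A `<=` \bigcup_(U in components) U.
Proof.
move=> x [A nA Ax]; exists (component A); first by exists A.
by exists A => //; exists 0%N => //; rewrite oppr0.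
Qed.

Lemma large_ball (x : T) (M : \bar R) N : X x -> (M < mu X)%E -> exists2 k, (N <= k)%N &
  (M <= mu (ball x (delta ^ (- k%:Z))))%E.
Proof.
move=> Xx MX.
have dE k : delta ^ (- k%:Z) = (delta ^+ k)^-1 by rewrite -exprnN.
have d0 k : 0 < delta ^ (- k%:Z) by rewrite exprz_gt0.
have XE : X = \bigcup_k ball x (delta ^ (- k%:Z)).
  apply/seteqP; split=> [y Xy|y [k _ []//]].
  have d1 : `|delta| < 1 by rewrite gtr0_norm//; case/andP: delta01.
  have e0 : 0 < (`|rho x y| + 1)^-1 by rewrite invr_gt0 ltr_wpDl.
  have [k _ Hk] := @cvgr0_norm_lt _ _ _ _ _ _ (cvg_expr d1) _ e0.
  exists k => //; split => //; rewrite lte_fin dE.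
  have := Hk k (leqnn k); rewrite /= ger0_norm ?exprn_ge0 ?(ltW delta_gt0)// => H.
  apply: (@lt_trans _ _ (`|rho x y| + 1)).
    by rewrite (le_lt_trans (ler_norm _))// ltrDl.
  by rewrite -[ltLHS]invrK ltf_pV2// ?posrE ?invr_gt0 ?exprn_gt0// ltr_wpDl.
apply: contrapT => H.
have : (mu X <= M)%E.
  have mono : {homo (fun k => ball x (delta ^ (- k%:Z))) : n m / (n <= m)%N >-> (n <= m)%O}.
    move=> n m nm; apply/subsetPset; apply: ball_mono; rewrite !dE.
    rewrite lef_pV2 ?posrE ?exprn_gt0// ler_wiXn2l ?(ltW delta_gt0)//.
    by case/andP: delta01 => _ /ltW.
  have := @nondecreasing_cvg_mu _ _ _ mu (fun k => ball x (delta ^ (- k%:Z)))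
    (fun k => ball_measurable S Xx (d0 k)).
  rewrite -XE => /(_ mX mono) cX.
  rewrite -(cvg_lim _ cX)//; apply: lime_le; first by apply/cvg_ex; exists (mu X).
  exists N => // k /= Nk; rewrite leNgt; apply/negP => Mk; apply: H.
  by exists k => //; exact: ltW.
by rewrite leNgt MX.
Qed.

Lemma cube_large n A x : cubes n A -> A x ->
  (mu (ball x (delta ^ n)) <= (cr 1)%:E * mu A)%E.
Proof.
move=> nA Ax; have := cube_comparable S delta01 eps0_gt0 df nA Ax (@ltr01 R).
by rewrite mul1r.
Qed.

(** The smallness threshold originates here. [P k] has at least the fraction [1 / cr 1] of a ball
    about [x] that increases to [X]. If [mu X] is infinite, this exceeds four times [mu (P N)] for
    large [k]; if not, it reaches [mu X / (2 * cr 1)], which is at least twice [mu B]. *)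
Lemma components_size (Z B : set T) A (P : nat -> set T) :
  (mu X = +oo)%E \/ [/\ measurable B, Z `<=` B & (mu B <= ((4 * cr 1)^-1)%:E * mu X)%E] ->
  (forall k, measurable (P k `&` Z)) ->
  A !=set0 -> (forall k, cubes (- k%:Z) (P k)) -> (forall k, A `<=` P k) ->
  forall N, exists2 k, (N <= k)%N &
   (4%:E * mu (P N) <= mu (P k))%E \/ (2%:E * mu (P k `&` Z) <= mu (P k))%E.
Proof.
move=> H mPZ [x Ax] nP AP N.
have Xx : X x by exact: (cubes_sub df (nP 0%N) (AP 0%N _ Ax)).
have cr0 : 0 < cr 1 by exact: lt_le_trans (cube_ratio_ge1 _ _ S _).
have Pfin k : mu (P k) \is a fin_num.
  by rewrite ge0_fin_numE// (cubes_fin S delta01 eps0_gt0 df (nP k)).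
have X0 : (0 < mu X)%E.
  apply: (lt_le_trans (cubes_gt0 S delta01 eps0_gt0 df (nP 0%N))).
  apply: le_measure; rewrite ?inE//; first exact: (cubes_measurable S df (nP _)).
  exact: (cubes_sub df (nP 0%N)).
have [Xoo|Xoo] := eqVneq (mu X) +oo%E.
  have MX : ((cr 1)%:E * (4%:E * mu (P N)) < mu X)%E.
    by rewrite Xoo -(fineK (Pfin N)) -!EFinM ltry.
  have [k Nk Hk] := large_ball N Xx MX.
  exists k => //; left; rewrite -(@lee_pmul2l _ (cr 1)%:E)//.
  exact: le_trans Hk (cube_large (nP k) (AP k _ Ax)).
case: H => [H|[mB ZB muB]]; first by rewrite H eqxx in Xoo.
have Xfin : mu X \is a fin_num by rewrite ge0_fin_numE// ltey.
have xr : 0 < fine (mu X) by rewrite fine_gt0// X0 ltey.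
have hX : ((fine (mu X) / 2)%:E < mu X)%E by rewrite -[ltRHS](fineK Xfin) lte_fin; lra.
have [k Nk Hk] := large_ball N Xx hX.
exists k => //; right.
have Bfin : mu B \is a fin_num.
  rewrite ge0_fin_numE//; apply: (le_lt_trans muB).
  by rewrite -(fineK Xfin) -EFinM ltry.
apply: (@le_trans _ _ (2%:E * mu B)%E).
  rewrite lee_pmul2l//; apply: le_measure; rewrite ?inE//.
  by move=> y [_ /ZB].
have := le_trans Hk (cube_large (nP k) (AP k _ Ax)); move: muB.
rewrite -(fineK Xfin) -(fineK Bfin) -(fineK (Pfin k)) -!EFinM !lee_fin /=.
rewrite ler_pdivlMl ?mulr_gt0// => H1 H2.
rewrite -(ler_pM2l cr0); lra.
Qed.

End components.

(** * The one-weight inequality on X *)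

Section global_theorem.
Context d (T : measurableType d) (R : realType).
Variables (X : set T) (rho : T -> T -> R) (mu nu : {measure set T -> \bar R}).
Variables (K C delta eps0 N0 : R) (I : int -> Type) (Q : forall n, I n -> set T).
Hypotheses (S : doubling_space X rho mu K C) (delta01 : 0 < delta < 1)
  (eps0_gt0 : 0 < eps0).
Hypothesis df : dyadic_filtration X rho mu delta eps0 N0 Q.
Hypothesis LD : lebesgue_differentiation_property X rho mu.
Variables (s Kw : R) (w : T -> R).
Hypotheses (s_gt1 : 1 < s) (w_ge0 : forall x, X x -> 0 <= w x)
  (mw : measurable_fun X w) (Apw : (Ap_const X rho mu s w <= Kw%:E)%E).
Hypothesis nuE : forall A, measurable A -> A `<=` X -> nu A = (\int[mu]_(x in A) (w x)%:E)%E.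
Variables (K3 p : R) (f g : T -> R) (n0 : nat).
Hypotheses (K3_gt0 : 0 < K3) (p_gt0 : 0 < p).
Hypotheses (mf : measurable_fun X f) (mg : measurable_fun X g).
Local Notation wr := (weight_ratio K C eps0 N0 s Kw).
Local Notation Cd := (parent_ratio K C delta eps0 N0).
Local Notation C1 := (local_const Cd K3 p n0).
Local Open Scope ereal_scope.
Hypothesis osc : forall n P, cubes Q n P -> exists (fP : T -> R) (m : R),
  [/\ measurable_fun P fP, forall x, P x -> (`|f x| <= fP x <= K3 * `|f x|)%R,
      \int[mu]_(x in P) (fP x)%:E = m%:E * mu P &
      forall y, P y -> \int[mu]_(x in P) `|fP x - m|%:E <= (g y)%:E * mu P].
Hypothesis n0_large : forall k, (n0 < k)%N -> ((1 - wr^-1) ^+ k * (K3 + 2) `^ p <= 2^-1)%R.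
Hypothesis large_or_small : mu X = +oo \/ exists B, [/\ measurable B,
  [set x | X x /\ f x != 0%R] `<=` B &
  mu B <= ((4 * cube_ratio K C eps0 N0 1)^-1)%:E * mu X].

(** The chain estimate is summed over countably many components, whose union misses only a
    [mu]-null, hence [nu]-null set. Finiteness of the left side passes to each component, where the
    absorption uses it. *)
Theorem fefferman_stein : \int[nu]_(x in X) (`|f x| `^ p)%:E < +oo ->
  \int[nu]_(x in X) (`|f x| `^ p)%:E <=
  (C1 * (8 `^ p + 1))%:E * \int[nu]_(x in X) (`|g x| `^ p)%:E.
Proof.
have mX : measurable X by exact: (space_measurable S).
have mhp (h : T -> R) : measurable_fun X h -> measurable_fun X (fun x => (`|h x| `^ p)%:E).
  move=> mh; apply: (@eq_measurable_fun _ _ _ _ _ (fun x => `|h x|%:E `^ p)) => //.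
  apply: (measurableT_comp (measurable_poweR p)).
  by apply/measurable_EFinP; exact: measurableT_comp.
have dens (h : T -> R) : measurable_fun X h -> exists m : {measure set T -> \bar R},
    forall A, A `<=` X -> m A = \int[nu]_(x in A) (`|h x| `^ p)%:E.
  move=> mh; have mr : measurable_fun setT ((fun x => (`|h x| `^ p)%:E) \_ X).
    exact/(measurable_restrictT _ mX).1/mhp.
  have r0 x : 0 <= ((fun x => (`|h x| `^ p)%:E) \_ X) x.
    by apply: erestrict_ge0 => y _; rewrite lee_fin powR_ge0.
  have [m [mE _]] := density_measure nu mr r0.
  exists m => A AX; rewrite mE; apply: eq_integral => x; rewrite inE => Ax.
  by rewrite patchE mem_set//; exact: AX.
have [m1 m1E] := dens f mf; have [m2 m2E] := dens g mg.
rewrite -m1E// -m2E// => Foo.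
have C10 : (0 < C1 * (8 `^ p + 1))%R.
  apply: mulr_gt0; last by rewrite ltr_wpDl// powR_ge0.
  by apply: local_const_gt0 => //; exact: (cube_ratio_ge1 _ _ S).
pose V := \bigcup_(U in components Q) U.
have mV : measurable V.
  apply: bigcup_countable_measurable; first exact: (components_countable S delta01 eps0_gt0 df).
  exact: (components_measurable S delta01 eps0_gt0 df).
have VX : V `<=` X by move=> x [U cU Ux]; exact: (components_subset df cU).
have m1V : m1 X <= m1 V.
  have nuXV : nu (X `\` V) = 0.
    apply: (nu_negligible S mw nuE); [exact: measurableD|exact: subDsetl|].
    apply/eqP; rewrite eq_le measure_ge0 andbT -(cubes_ae_cover df 0).
    apply: le_measure; rewrite ?inE; first exact: measurableD.
      by apply: measurableD => //; exact: (cubes_cover_measurable S delta01 eps0_gt0 df).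
    by move=> x [Xx nV]; split => // H; apply: nV; exact: (cubes_sub_components H).
  have XDV : X = V `|` (X `\` V) by rewrite setDUK.
  have mXV : measurable (X `\` V) by exact: measurableD.
  have m1XV : m1 (X `\` V) = 0.
    rewrite m1E; last exact: subDsetl.
    by apply: null_set_integral => //; apply: measurable_funS (mhp f mf) => //; exact: subDsetl.
  rewrite [X in m1 X <= _]XDV; apply: (le_trans (measureU2 _ mV mXV)).
  by rewrite [X in _ + X](_ : _ = 0) ?adde0.
apply: (le_trans m1V); apply: (@le_trans _ _ ((C1 * (8 `^ p + 1))%:E * m2 (V `&` setT))); last first.
  by rewrite setIT lee_wpmul2l ?lee_fin ?(ltW C10)//; apply: le_measure; rewrite ?inE.
rewrite -[X in m1 X]setIT; apply: le_measure_bigcup => //.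
- exact: ltW.
- exact: (components_countable S delta01 eps0_gt0 df).
- exact: (components_measurable S delta01 eps0_gt0 df).
- exact: (components_disjoint S delta01 eps0_gt0 df).
move=> U cU; rewrite setIT; have UX := components_subset df cU.
have mU := components_measurable S delta01 eps0_gt0 df cU.
have m1Uoo : m1 U < +oo by apply: le_lt_trans Foo; apply: le_measure; rewrite ?inE.
case: cU UX mU m1Uoo => A nA <- UX mU m1Uoo.
have [P [nP AP UE]] := component_chain S delta01 eps0_gt0 df nA.
have [z [_ Az _]] := cubes_center S delta01 eps0_gt0 df nA.
have A0 : A !=set0 by exists z.
have mP k := cubes_measurable S df (nP k).
have PX k := cubes_sub df (nP k).
have mPf k : measurable (P k `&` [set x | f x != 0%R]).
  have -> : P k `&` [set x | f x != 0%R] = P k `&` [set x | 0 < `|f x|%:E].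
    by apply/seteqP; split => x [Px /= fx]; split => //=; move: fx; rewrite lte_fin normr_gt0.
  apply: emeasurable_fun_o_infty => //; apply: measurable_funS (PX k) _ => //.
  by apply/measurable_EFinP; exact: measurableT_comp.
rewrite m1E// m2E// UE; apply: (chain_fs S delta01 eps0_gt0 df LD s_gt1 w_ge0 mw Apw nuE
  K3_gt0 p_gt0 mf mg osc n0_large A0 nP AP); last first.
  by rewrite -UE -m1E.
have E k : P k `&` [set x | f x != 0%R] = P k `&` [set x | X x /\ f x != 0%R].
  by apply/seteqP; split => x [Px] //= H; split => //; [split => //; exact: PX Px|have [] := H].
move=> N; have mPf' k : measurable (P k `&` [set x | X x /\ f x != 0%R]) by rewrite -E.
have H : mu X = +oo \/ exists B, [/\ measurable B,
  [set x | X x /\ f x != 0%R] `<=` B &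
  mu B <= ((4 * cube_ratio K C eps0 N0 1)^-1)%:E * mu X] by [].
have [k Nk Hk] : exists2 k, (N <= k)%N & (4%:E * mu (P N) <= mu (P k)) \/
    (2%:E * mu (P k `&` [set x | X x /\ f x != 0%R]) <= mu (P k)).
  case: H => [Xoo|[B HB]].
    by apply: (components_size S delta01 eps0_gt0 df (B := set0) _ mPf' A0 nP AP); left.
  by apply: (components_size S delta01 eps0_gt0 df (B := B) _ mPf' A0 nP AP); right.
by exists k => //; rewrite E.
Qed.

End global_theorem.

(** * Vitali selection and the weak-type maximal bound *)

Section vitali.
Context d (T : measurableType d) (R : realType).
Variables (rho : T -> T -> R) (nu : {measure set T -> \bar R}) (K C : R).
Hypothesis S : doubling_space setT rho nu K C.
Local Notation ball x r := (qball setT rho x r%:E).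

Let bl (p : T * R) : set T := ball p.1 p.2.

Let K1 : 1 <= K. Proof. exact: ds_K S. Qed.
Let K0 : 0 < K. Proof. exact: lt_le_trans K1. Qed.
Let C0 : 0 < C. Proof. exact: lt_le_trans (ds_C S). Qed.

(** Zorn's lemma for disjoint subfamilies [W] such that each ball meeting [W] meets a ball of [W] of
    at least half its radius. Asking this only of balls that meet [W] makes it stable under unions
    of chains. If a maximal family missed a ball, a missed one of more than half the supremal radius
    could be added. Balls are pairs of a centre and a radius, since a set may be a ball in several
    ways. *)
Lemma vitali_selection (F : set (T * R)) (R0 : R) :
  (forall p, F p -> 0 < p.2 <= R0) -> exists G, [/\ G `<=` F,
    forall p q, G p -> G q -> bl p `&` bl q !=set0 -> p = q &
    forall p, F p -> exists q, [/\ G q, bl p `&` bl q !=set0 & p.2 <= 2 * q.2]].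
Proof.
move=> FR.
pose Pr (W : set (T * R)) := [/\ W `<=` F,
  forall p q, W p -> W q -> bl p `&` bl q !=set0 -> p = q &
  forall p, F p -> (exists2 q, W q & bl p `&` bl q !=set0) ->
    exists q, [/\ W q, bl p `&` bl q !=set0 & p.2 <= 2 * q.2]].
have [Fm FmP Fmtot|G [[GF Gd Gs] Gmax]] := @Zorn_bigcup _ Pr.
  split.
  - by move=> p [W FW Wp]; have [WF _ _] := FmP W FW; exact: WF.
  - move=> p q [W FW Wp] [W' FW' Wq] pq.
    have [WW'|W'W] := Fmtot W W' FW FW'.
      by have [_ H _] := FmP W' FW'; apply: H => //; exact: WW'.
    by have [_ H _] := FmP W FW; apply: H => //; exact: W'W.
  - move=> p Fp [q [W FW Wq] pq]; have [_ _ H] := FmP W FW.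
    have [q' [Wq' pq' le]] : exists q, [/\ W q, bl p `&` bl q !=set0 & p.2 <= 2 * q.2].
      by apply: H => //; exists q.
    by exists q'; split => //; exists W.
exists G; split => // p Fp; apply: (Gs p Fp); apply: contrapT => Hp.
pose N := [set p | F p /\ forall q, G q -> ~ (bl p `&` bl q !=set0)].
have Np : N p by split => // q Gq pq; apply: Hp; exists q.
pose rad := [set q.2 | q in N].
have hs : has_sup rad.
  split; first by exists p.2; exists p.
  by exists R0 => _ [q [Fq _] <-]; have /andP[] := FR q Fq.
have ub q : N q -> q.2 <= sup rad by move=> Nq; apply: sup_upper_bound => //; exists q.
have s0 : 0 < sup rad.
  by apply: lt_le_trans (ub p Np); have /andP[] := FR p Fp.
have [_ [p0 Np0 <-] p0s] := sup_adherent (divr_gt0 s0 (@ltr0n R 2)) hs.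
have {p0s} p0s : sup rad < 2 * p0.2 by lra.
have [Fp0 Gp0] := Np0.
apply: (Gmax (G `|` [set p0])).
  split; first exact: subsetUl.
  move=> /(_ p0 (or_intror erefl)) Gp; apply: (Gp0 p0 Gp); exists p0.1.
  by split; apply: (ball_center S) => //; have /andP[] := FR p0 Fp0.
split.
- by move=> q [/GF//|->].
- move=> q q' [Gq|->] [Gq'|->]// qq'; first exact: Gd.
    by exfalso; apply: (Gp0 q Gq); rewrite setIC.
  by exfalso; exact: (Gp0 q' Gq').
- move=> q Fq [q' Gq' qq'].
  have [Hq|Hq] := pselect (exists2 q', G q' & bl q `&` bl q' !=set0).
    by have [q1 [Gq1 h1 h2]] := Gs q Fq Hq; exists q1; split => //; left.
  exists p0; split; first by right.
    by case: Gq' qq' => [Gq' qq'|->//]; exfalso; apply: Hq; exists q'.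
  have Nq : N q by split => // q1 Gq1 H1; apply: Hq; exists q1.
  exact: le_trans (ub q Nq) (ltW p0s).
Qed.

(** Two quasi-triangle inequalities put a ball into the dilate by [K * (1 + 4 * K)] of any ball that
    it meets and whose radius is at least half of its own. *)
Definition vitali_const : R := C ^+ dbl_exp (K * (1 + 4 * K)).

Let V0 : 0 < vitali_const. Proof. by rewrite exprn_gt0. Qed.

Lemma vitali_engulf p q : 0 < p.2 -> 0 < q.2 -> p.2 <= 2 * q.2 -> bl p `&` bl q !=set0 ->
  bl p `<=` ball q.1 (K * (1 + 4 * K) * q.2).
Proof.
move=> p0 q0 pq [z [[_ pz] [_ qz]]] u [_ pu]; split => //.
move: pz qz pu; rewrite !lte_fin => pz qz pu.
apply: (le_lt_trans (ds_triangle S (z := z) I I I)).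
rewrite -mulrA ltr_pM2l// mulrDl mul1r ltr_leD//.
apply: (le_trans (ds_triangle S (z := p.1) I I I)).
rewrite [4 * K * _]mulrAC [4 * q.2 * K]mulrC ler_pM2l//.
rewrite (ds_sym S (x := z))//; lra.
Qed.

Local Open Scope ereal_scope.

Section weak.
Variables (h : T -> \bar R).
Hypotheses (mh : measurable_fun setT h) (h0 : forall x, 0 <= h x).

Definition heavy (lam : R) (p : T * R) :=
  (0 < p.2)%R /\ lam%:E * nu (bl p) < \int[nu]_(x in bl p) h x.

(** Selection requires bounded radii. The selected balls are disjoint and of positive measure, hence
    countably many; their dilates cover, and the integral of [h] over each selected ball pays for
    its dilate. *)
Lemma heavy_bounded_weak (lam R0 : R) : (0 < lam)%R ->
  lam%:E * nu (\bigcup_(p in [set p | heavy lam p /\ (p.2 <= R0)%R]) bl p) <=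
  vitali_const%:E * \int[nu]_x h x.
Proof.
move=> lam0; set F := [set p | _].
have FR p : F p -> (0 < p.2 <= R0)%R by move=> [[-> _] ->].
have [G [GF Gd Gs]] := vitali_selection FR.
have Gpos q : G q -> (0 < q.2)%R by move=> /GF/FR/andP[].
have mb q : (0 < q.2)%R -> measurable (bl q) by move=> q0; exact: (ball_measurable S).
pose GG : set (set T) := [set bl q | q in G].
have mGG : GG `<=` measurable by move=> _ [q Gq <-]; apply: mb; exact: Gpos.
have dGG : pairwise_disjoint GG.
  by move=> _ _ [q Gq <-] [q' Gq' <-] qq'; rewrite (Gd q q').
have cGG : countable GG.
  apply: (positive_disjoint_countable S mGG _ dGG) => _ [q Gq <-]; split => //.
  by apply: (ds_gt0 S) => //; exact: Gpos.
have [Fs [FsG FsE Fsall Fst]] := countable_disjoint_seq cGG.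
have mFs n : measurable (Fs n) by have [->|/mGG] := FsG n; last by [].
have k0 : (0 < K * (1 + 4 * K))%R by rewrite mulr_gt0// addr_gt0// mulr_gt0.
(* The dilate depends on centre and radius; disjointness makes this pair unique for a nonempty
   [Fs n], and an empty [Fs n] gets the empty set. *)
have [E HE] : {E : nat -> set T & forall n, [/\ measurable (E n),
    nu (E n) <= vitali_const%:E * nu (Fs n) &
    forall q, G q -> bl q = Fs n -> ball q.1 (K * (1 + 4 * K) * q.2) `<=` E n]}.
  apply: (@choice _ _ (fun n E => [/\ measurable E,
    nu E <= vitali_const%:E * nu (Fs n) &
    forall q, G q -> bl q = Fs n -> ball q.1 (K * (1 + 4 * K) * q.2) `<=` E])) => n.
  have [Fn0|[q Gq qF]] := FsG n.
    exists set0; split => //; first by rewrite measure0 mule_ge0// lee_fin ltW.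
    move=> q Gq qF; have := ball_center S (x := q.1) I (Gpos q Gq).
    by rewrite -/(bl q) qF Fn0.
  exists (ball q.1 (K * (1 + 4 * K) * q.2)); split.
  - by apply: (ball_measurable S) => //; rewrite mulr_gt0// Gpos.
  - by rewrite -qF; apply: (doubling_ball S) => //; exact: Gpos.
  - move=> q' Gq' q'F; rewrite (Gd q' q)//.
    rewrite q'F -qF setIid; exists q.1; apply: (ball_center S) => //; exact: Gpos.
have mE n : measurable (E n) by have [] := HE n.
have sub : \bigcup_(p in F) bl p `<=` \bigcup_n E n.
  move=> x [p Fp px]; have [q [Gq pq le]] := Gs p Fp.
  have [n Fnq] := Fsall (bl q) (ex_intro2 _ _ q Gq erefl).
  exists n => //; have [_ _ H] := HE n; apply: (H q Gq (esym Fnq)).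
  by apply: vitali_engulf px => //; [have /andP[] := FR p Fp|exact: Gpos].
have mF : measurable (\bigcup_(p in F) bl p).
  apply: (ds_borel S); apply: qopen_bigcup => p Fp.
  by apply: (ds_open S) => //; have /andP[] := FR p Fp.
have [m [mE' _]] := density_measure nu mh h0.
apply: (@le_trans _ _ (lam%:E * \sum_(0 <= n <oo) nu (E n))).
  rewrite lee_wpmul2l ?lee_fin ?(ltW lam0)//.
  exact: measure_sigma_subadditive.
apply: (@le_trans _ _ (\sum_(0 <= n <oo) vitali_const%:E * m (Fs n))).
  rewrite -nneseriesZl//; apply: lee_nneseries => n _.
    by rewrite mule_ge0// lee_fin ltW.
  apply: (@le_trans _ _ (lam%:E * (vitali_const%:E * nu (Fs n)))).
    by rewrite lee_wpmul2l ?lee_fin ?(ltW lam0)//; have [] := HE n.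
  rewrite muleCA lee_wpmul2l ?lee_fin ?(ltW V0)// mE'.
  have [->|[q Gq <-]] := FsG n; first by rewrite measure0 mule0 integral_ge0.
  by have [[_ /ltW]] := GF q Gq.
rewrite nneseriesZl// lee_wpmul2l ?lee_fin ?(ltW V0)//.
have -> : \sum_(0 <= n <oo) m (Fs n) = m (\bigcup_n Fs n).
  rewrite measure_bigcup//; last exact: Fst.
  by apply: eq_eseriesl => i; rewrite in_setT.
rewrite -mE'; apply: le_measure; rewrite ?inE//; exact: bigcupT_measurable.
Qed.

(** Uncentred, so that the level sets are unions of balls, open and therefore measurable. *)
Definition maximal (x : T) : \bar R := ereal_sup [set c | exists p : T * R,
  [/\ (0 < p.2)%R, bl p x & c = (fine (nu (bl p)))^-1%:E * \int[nu]_(y in bl p) h y]].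

Let nub p : (0 < p.2)%R -> (0 < fine (nu (bl p)))%R /\ nu (bl p) = (fine (nu (bl p)))%:E.
Proof.
move=> p0; have H := ds_gt0 S (x := p.1) I p0; have Hf := ds_fin S (x := p.1) I p0.
by split; [rewrite fine_gt0// H Hf|rewrite fineK// ge0_fin_numE// ltW].
Qed.

Lemma lt_maximal (lam : R) : [set x | lam%:E < maximal x] = \bigcup_(p in heavy lam) bl p.
Proof.
apply/seteqP; split => [x /= /ereal_sup_gt[_ [p [p0 px ->]]]|x [p [p0 hp] px]] /=.
  have [b0 bE] := nub p0; rewrite lte_pdivlMl// muleC => H; exists p => //.
  by split => //; rewrite bE.
have [b0 bE] := nub p0.
apply: (@lt_le_trans _ _ ((fine (nu (bl p)))^-1%:E * \int[nu]_(y in bl p) h y)).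
  by rewrite lte_pdivlMl// muleC -bE.
by apply: ereal_sup_ubound; exists p.
Qed.

Lemma measurable_lt_maximal (lam : R) : measurable [set x | lam%:E < maximal x].
Proof.
rewrite lt_maximal; apply: (ds_borel S); apply: qopen_bigcup => p [p0 _].
exact: (ds_open S).
Qed.

Lemma measurable_maximal : measurable_fun setT maximal.
Proof.
apply: (measurability _ (ErealGenOInfty.measurableE R)) => _ -[_ [r ->] <-].
rewrite setTI (_ : _ @^-1` _ = [set x | r%:E < maximal x]).
  exact: measurable_lt_maximal.
by apply/seteqP; split => x /=; rewrite in_itv/= ?andbT ?leey// => /andP[].
Qed.

Lemma maximal_ge0 x : 0 <= maximal x.
Proof.
apply: (@le_trans _ _ ((fine (nu (ball x 1)))^-1%:E * \int[nu]_(y in ball x 1) h y)).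
  by rewrite mule_ge0 ?integral_ge0// lee_fin invr_ge0 fine_ge0.
apply: ereal_sup_ubound; exists (x, 1%R); split => //=.
exact: (ball_center S).
Qed.

Lemma maximal_ball p x : (0 < p.2)%R -> bl p x ->
  \int[nu]_(y in bl p) h y <= nu (bl p) * maximal x.
Proof.
move=> p0 px; have [b0 bE] := nub p0; rewrite bE -lee_pdivrMl//.
by apply: ereal_sup_ubound; exists p.
Qed.

Lemma maximal_weak (lam : R) : (0 < lam)%R ->
  lam%:E * nu [set x | lam%:E < maximal x] <= vitali_const%:E * \int[nu]_x h x.
Proof.
move=> lam0.
pose O n := \bigcup_(p in [set p | heavy lam p /\ (p.2 <= n%:R)%R]) bl p.
have OE : [set x | lam%:E < maximal x] = \bigcup_n O n.
  rewrite lt_maximal; apply/seteqP; split => x.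
    move=> [p hp px]; exists (Num.truncn `|p.2|).+1 => //; exists p => //.
    by split => //; apply: (le_trans (ler_norm _)); exact/ltW/truncnS_gt.
  by move=> [n _ [p [hp _] px]]; exists p.
have mO n : measurable (O n).
  apply: (ds_borel S); apply: qopen_bigcup => p [[p0 _] _]; exact: (ds_open S).
have mono : {homo O : n m / (n <= m)%N >-> (n <= m)%O}.
  move=> n m nm; apply/subsetPset => x [p [hp pn] px]; exists p => //; split => //.
  by apply: (le_trans pn); rewrite ler_nat.
have mUO : measurable (\bigcup_n O n) by exact: bigcupT_measurable.
have cO := @nondecreasing_cvg_mu _ _ _ nu O mO mUO mono.
rewrite OE -lee_pdivlMl// -(cvg_lim _ cO)//; apply: lime_le.
  by apply/cvg_ex; exists (nu (\bigcup_n O n)).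
by apply: nearW => n /=; rewrite lee_pdivlMl//; exact: heavy_bounded_weak.
Qed.

End weak.
End vitali.

(** * Strong type of the maximal operator and the majorant *)

Section strong_type.
Context d (T : measurableType d) (R : realType).
Variables (rho : T -> T -> R) (nu : {measure set T -> \bar R}) (K C : R).
Hypothesis S : doubling_space setT rho nu K C.
Local Notation ball x r := (qball setT rho x r%:E).
Local Notation M := (maximal rho nu).
Local Notation V := (vitali_const K C).
Local Open Scope ereal_scope.

Let V0 : (0 < V)%R.
Proof. by rewrite exprn_gt0// (lt_le_trans _ (ds_C S)). Qed.

(** The Marcinkiewicz constant for dyadic levels: 2^t from rounding a level up, [2 * V] from the
    weak-type bound at half the level, the quotient from the geometric sum, the last power from
    comparing levels with [2 * h]. *)
Definition hl_const (t : R) : R :=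
  (2 `^ t * (2 * V) * (2 `^ (t - 1) / (2 `^ (t - 1) - 1)) * 2 `^ (t - 1))%R.

Lemma hl_const_gt0 t : (1 < t)%R -> (0 < hl_const t)%R.
Proof.
move=> t1; have b1 : (1 < 2 `^ (t - 1) :> R)%R.
  have p1 : (1 `^ (t - 1) = 1 :> R)%R by rewrite powR1.
  by rewrite -[X in (X < _)%R]p1 gt0_ltr_powR ?nnegrE ?subr_gt0// ltr1n.
by rewrite /hl_const !mulr_gt0 ?powR_gt0// invr_gt0 subr_gt0.
Qed.

Section truncation.
Variables (h : T -> \bar R).
Hypotheses (mh : measurable_fun setT h) (h0 : forall x, 0 <= h x).

Let trunc (lam : R) (x : T) : \bar R := h x * (lam%:E < h x)%E%:R%:E.

Let mind (lam : R) : measurable_fun setT (fun x => (lam%:E < h x)%E%:R%:E : \bar R).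
Proof.
have ms : measurable (setT `&` [set x | lam%:E < h x]).
  exact: emeasurable_fun_o_infty.
have [+ _] := integral_level nu ler01 measurableT ms.
by apply: eq_measurable_fun => x _; rewrite mul1r.
Qed.

Let mtrunc lam : measurable_fun setT (trunc lam).
Proof. by apply: emeasurable_funM => //; exact: mind. Qed.

Let trunc0 lam x : 0 <= trunc lam x. Proof. by rewrite mule_ge0// lee_fin. Qed.

(** The part of [h] below [lam] adds at most [lam] to any average, so an average above [2 * lam]
    leaves the truncated function an average above [lam]. *)
Lemma maximal_weak_trunc (lam : R) : (0 < lam)%R ->
  lam%:E * nu [set x | (2 * lam)%:E < M h x] <= V%:E * \int[nu]_x trunc lam x.
Proof.
move=> lam0; apply: le_trans (maximal_weak S (mtrunc lam) (trunc0 lam) lam0).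
rewrite lee_wpmul2l ?lee_fin ?(ltW lam0)//; apply: le_measure; rewrite ?inE.
- exact: (measurable_lt_maximal S).
- exact: (measurable_lt_maximal S).
rewrite !(lt_maximal S) => x [p [p0 hp] px]; exists p => //; split => //.
have mB : measurable (ball p.1 p.2) by exact: (ball_measurable S).
have Bfin : nu (ball p.1 p.2) \is a fin_num by rewrite ge0_fin_numE// (ds_fin S).
have : \int[nu]_(x in ball p.1 p.2) h x <=
    \int[nu]_(x in ball p.1 p.2) trunc lam x + lam%:E * nu (ball p.1 p.2).
  rewrite -integral_cst// -ge0_integralD//; last 2 first.
  - exact: measurable_funTS.
  - by move=> y _; rewrite lee_fin ltW.
  apply: ge0_le_integral => //.
  - exact: measurable_funTS.
  - by apply: emeasurable_funD => //; exact: measurable_funTS.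
  - move=> y _; rewrite /trunc; case: (ltP lam%:E (h y)) => hy.
      by rewrite mule1 leeDl// lee_fin ltW.
    by rewrite mule0 add0e.
move=> /(lt_le_trans hp); rewrite mulrDl mul1r EFinD ge0_muleDl ?lee_fin ?(ltW lam0)//.
rewrite lteD2rE//.
by rewrite fin_numM.
Qed.

Lemma trunc_level_sum (t tau : R) n x : (1 < t)%R -> (0 < tau)%R ->
  \sum_(k < n) ((2 ^+ k.+1 * tau) `^ t * ((2 ^+ k * tau / 2)^-1 * V))%:E *
     trunc (2 ^+ k * tau / 2) x <= (hl_const t)%:E * h x `^ t.
Proof.
move=> t1 tau0; have t10 : (0 < t - 1)%R by rewrite subr_gt0.
have two1 : (1 < 2 :> R)%R by rewrite ltr1n.
have pos k : (0 < 2 ^+ k * tau)%R by rewrite mulr_gt0// exprn_gt0.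
have b1 : (1 < 2 `^ (t - 1) :> R)%R.
  have p1 : (1 `^ (t - 1) = 1 :> R)%R by rewrite powR1.
  by rewrite -[X in (X < _)%R]p1 gt0_ltr_powR ?nnegrE.
apply: (@le_trans _ _ ((2 `^ t * (2 * V))%:E * ((\sum_(k < n) (2 ^+ k * tau) `^ (t - 1) *
    ((2 ^+ k * tau)%:E <= 2%:E * h x)%E%:R)%:E * h x))).
  rewrite -sumEFin ge0_sume_distrl; last first.
    by move=> k _; rewrite lee_fin mulr_ge0// powR_ge0.
  rewrite ge0_sume_distrr; last first.
    by move=> k _; rewrite mule_ge0// lee_fin mulr_ge0// powR_ge0.
  apply: lee_sum => k _; rewrite /trunc.
  rewrite [h x * _]muleC muleA -EFinM muleA -EFinM lee_wpmul2r// lee_fin.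
  have -> : ((2 ^+ k.+1 * tau) `^ t * ((2 ^+ k * tau / 2)^-1 * V) =
      2 `^ t * (2 * V) * (2 ^+ k * tau) `^ (t - 1))%R.
    rewrite exprS -mulrA powRM ?(ltW (pos k))//.
    rewrite -[in LHS](mulr_powRB1 (ltW (pos k)) (lt_trans ltr01 t1)).
    by field; rewrite !gt_eqF// exprn_gt0.
  rewrite -[leLHS]mulrA ler_wpM2l//.
    by rewrite !mulr_ge0 ?powR_ge0 ?(ltW V0).
  rewrite ler_wpM2l ?powR_ge0// ler_nat.
  case: (ltP _ (h x)) => // hx; rewrite (_ : (_ <= _) = true)//.
  rewrite -lee_pdivrMl// -EFinM mulrC; exact: ltW.
apply: (@le_trans _ _ ((2 `^ t * (2 * V))%:E * (((2 `^ (t - 1) / (2 `^ (t - 1) - 1))%:E *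
    (2%:E * h x) `^ (t - 1)) * h x))).
  rewrite lee_wpmul2l ?lee_fin ?mulr_ge0 ?powR_ge0 ?(ltW V0)// lee_wpmul2r//.
  by apply: level_sum_le => //; rewrite mule_ge0// lee_fin.
rewrite poweRM ?lee_fin// poweR_EFin.
have -> : h x `^ t = h x `^ (t - 1) * h x.
  rewrite -[X in _ = _ * X]poweRe1// -poweRD ?subrK//.
  by apply: add_neq0_poweRD_def; rewrite subrK gt_eqF// (lt_trans ltr01).
by rewrite !muleA -!EFinM /hl_const !mulrA.
Qed.

Lemma maximal_level_bound (t tau : R) n : (1 < t)%R -> (0 < tau)%R -> (0 < n)%N ->
  \int[nu]_x ((Order.min (M h x) (2 ^+ n * tau)%:E) `^ t * (tau%:E < M h x)%E%:R%:E) <=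
  (hl_const t)%:E * \int[nu]_x (h x `^ t).
Proof.
move=> t1 tau0 n0; have t0 : (0 < t)%R by exact: lt_trans t1.
have two1 : (1 < 2 :> R)%R by rewrite ltr1n.
have pos k : (0 < 2 ^+ k * tau)%R by rewrite mulr_gt0// exprn_gt0.
have pos2 k : (0 < 2 ^+ k * tau / 2)%R by rewrite divr_gt0.
have mM := measurable_maximal S h.
have M0 := maximal_ge0 S h0.
have ms k : measurable (setT `&` [set x | (2 ^+ k * tau)%:E < M h x]).
  exact: emeasurable_fun_o_infty.
have lv k := integral_level nu (powR_ge0 (2 ^+ k.+1 * tau)%R t) measurableT (ms k).
have mht : measurable_fun setT (fun x => h x `^ t).
  exact: (measurableT_comp (measurable_poweR t)).
apply: (@le_trans _ _ (\int[nu]_x (\sum_(k < n)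
      ((2 ^+ k.+1 * tau) `^ t * ((2 ^+ k * tau)%:E < M h x)%E%:R)%:E))).
  apply: ge0_le_integral => //.
  - by move=> x _; rewrite mule_ge0 ?poweR_ge0// lee_fin.
  - apply: emeasurable_funM => //.
      apply: (measurableT_comp (measurable_poweR t)).
      by apply: measurable_mine => //; exact: measurable_cst.
    have := (integral_level nu ler01 measurableT (ms 0%N)).1.
    by apply: eq_measurable_fun => x _; rewrite mul1r expr0 mul1r.
  - by apply: emeasurable_sum => k; exact: (lv k).1.
  - by move=> x _; rewrite sumEFin; exact: level_cover.
rewrite ge0_integral_sum//; last 2 first.
- by move=> k; exact: (lv k).1.
- by move=> k x _; rewrite lee_fin mulr_ge0// powR_ge0.
apply: (@le_trans _ _ (\sum_(k < n) ((2 ^+ k.+1 * tau) `^ t * ((2 ^+ k * tau / 2)^-1 * V))%:E *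
     \int[nu]_x trunc (2 ^+ k * tau / 2) x)).
  apply: lee_sum => k _; rewrite (lv k).2 setTI [X in _ <= X * _]EFinM -muleA.
  rewrite lee_wpmul2l ?lee_fin ?powR_ge0// [X in _ <= X * _]EFinM -muleA -lee_pdivrMl ?invr_gt0// invrK.
  have := maximal_weak_trunc (pos2 k).
  by rewrite [(2 * (_ / 2))%R]mulrC divfK.
apply: (@le_trans _ _ (\int[nu]_x (\sum_(k < n)
   ((2 ^+ k.+1 * tau) `^ t * ((2 ^+ k * tau / 2)^-1 * V))%:E * trunc (2 ^+ k * tau / 2) x))).
  have c0 k : 0 <= ((2 ^+ k.+1 * tau) `^ t * ((2 ^+ k * tau / 2)^-1 * V))%:E.
    by rewrite lee_fin mulr_ge0 ?powR_ge0// mulr_ge0 ?invr_ge0 ?(ltW V0)// ltW.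
  rewrite ge0_integral_sum//; last 2 first.
  - by move=> k; apply: measurable_funeM; exact: mtrunc.
  - by move=> k x _; rewrite mule_ge0 ?c0.
  apply: lee_sum => k _; rewrite ge0_integralZl//.
rewrite -ge0_integralZl//; last 2 first.
- by move=> x _; rewrite poweR_ge0.
- by rewrite lee_fin ltW// hl_const_gt0.
apply: ge0_le_integral => //.
- move=> x _; apply: sume_ge0 => k _; rewrite mule_ge0// lee_fin.
  by rewrite mulr_ge0 ?powR_ge0// mulr_ge0 ?invr_ge0 ?(ltW V0)// ltW.
- by apply: emeasurable_sum => k; apply: measurable_funeM; exact: mtrunc.
- by apply: measurable_funeM.
- by move=> x _; exact: trunc_level_sum.
Qed.

Lemma maximal_strong (t : R) : (1 < t)%R ->
  \int[nu]_x (M h x `^ t) <= (hl_const t)%:E * \int[nu]_x (h x `^ t).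
Proof.
move=> t1; have t0 : (0 < t)%R by exact: lt_trans t1.
have two1 : (1 < 2 :> R)%R by rewrite ltr1n.
have mM := measurable_maximal S h.
have M0 := maximal_ge0 S h0.
(* Truncated above at [2 ^+ n.+1] and below at its inverse; [n.+1 + n.+1] doublings lead from one to
   the other. *)
pose u n x := (Order.min (M h x) (2 ^+ n.+1)%:E) `^ t * (((2 ^+ n.+1)^-1)%:E < M h x)%E%:R%:E.
apply: (@integral_lim_le _ _ _ nu setT u) => //.
- move=> n; apply: emeasurable_funM => //.
    apply: (measurableT_comp (measurable_poweR t)).
    by apply: measurable_mine => //; exact: measurable_cst.
  have ms : measurable (setT `&` [set x | ((2 ^+ n.+1)^-1)%:E < M h x]).
    exact: emeasurable_fun_o_infty.
  have := (integral_level nu ler01 measurableT ms).1.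
  by apply: eq_measurable_fun => x _; rewrite mul1r.
- by move=> n x _; rewrite mule_ge0 ?poweR_ge0// lee_fin.
- move=> x _ n m nm; have le2 : (2 ^+ n.+1 <= 2 ^+ m.+1 :> R)%R.
    by rewrite ler_weXn2l// ler1n.
  apply: lee_pmul; rewrite ?poweR_ge0 ?lee_fin//.
    rewrite poweR_le ?(ltW t0)//; first by rewrite le_min M0 lee_fin exprn_ge0.
    by rewrite le_min ge_min lexx/= ge_min lee_fin le2 orbT.
  rewrite ler_nat; case: (ltP _ (M h x)) => // H.
  rewrite (_ : (_ < _) = true)//; apply: le_lt_trans H.
  by rewrite lee_fin lef_pV2 ?posrE ?exprn_gt0.
- move=> x _; rewrite /u; case E : (M h x) (M0 x) => [a| |]// => [|_].
    rewrite lee_fin le_eqVlt => /predU1P[<-|a0].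
      rewrite poweR0r ?gt_eqF//; apply: cvg_near_cst; apply: nearW => n.
      by rewrite lte_fin invr_lt0 ltNge exprn_ge0//= mule0.
    have [N HN] := expr2_eventually_ge (Num.max a (a^-1 + 1))%R.
    apply: cvg_near_cst; exists N => // n /= Nn.
    have := HN n.+1 (leqW Nn); rewrite ge_max => /andP[an an'].
    rewrite min_l ?lee_fin// lte_fin (_ : ((2 ^+ n.+1)^-1 < a)%R) ?mule1//.
    by rewrite -[ltRHS]invrK ltf_pV2 ?posrE ?exprn_gt0 ?invr_gt0//; lra.
  rewrite poweRyr ?gt_eqF//; apply/cvgeyPge => A.
  have [N HN] := expr2_eventually_ge A.
  exists N => // n Nn; have -> : Order.min +oo (2 ^+ n.+1)%:E = (2 ^+ n.+1)%:E :> \bar R.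
    by rewrite min_r// leey.
  rewrite ltry mule1 poweR_EFin lee_fin.
  apply: (le_trans (HN n.+1 (leqW Nn))); apply: le1r_powR; last exact: ltW.
  by rewrite exprn_ege1// ler1n.
- move=> n; have := @maximal_level_bound t ((2 ^+ n.+1)^-1)%R (n.+1 + n.+1) t1.
  have p0 : (0 < 2 ^+ n.+1 :> R)%R by rewrite exprn_gt0.
  by rewrite exprD mulfK ?gt_eqF// invr_gt0 => /(_ p0 isT).
Qed.

End truncation.

Lemma maximal_mono (h1 h2 : T -> \bar R) x : (forall x, 0 <= h1 x) ->
  measurable_fun setT h1 -> measurable_fun setT h2 ->
  (forall x, h1 x <= h2 x) -> M h1 x <= M h2 x.
Proof.
move=> h10 m1 m2 h12; apply: ge_ereal_sup => _ [p [p0 px ->]].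
apply: (@le_trans _ _ ((fine (nu (ball p.1 p.2)))^-1%:E * \int[nu]_(y in ball p.1 p.2) h2 y)).
  rewrite lee_wpmul2l ?lee_fin ?invr_ge0 ?fine_ge0//; apply: ge0_le_integral => //.
  - exact: (ball_measurable S).
  - exact: measurable_funTS.
  - exact: measurable_funTS.
by apply: ereal_sup_ubound; exists p.
Qed.

(** The number [c] for which c^t times [hl_const t] is 1/2. *)
Definition majorant_coef (t : R) : R := (2 * hl_const t) `^ (- t^-1).

Lemma majorant_coef_gt0 t : (1 < t)%R -> (0 < majorant_coef t)%R.
Proof. by move=> t1; rewrite powR_gt0// mulr_gt0// hl_const_gt0. Qed.

(* The fixed point of [G |-> max h (c M G)]; this variant of the Rubio de Francia
   algorithm needs no summation of iterates. *)
Theorem A1_majorant (t : R) (h : T -> \bar R) : (1 < t)%R -> measurable_fun setT h ->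
  (forall x, 0 <= h x) -> exists G : T -> \bar R,
  [/\ measurable_fun setT G, forall x, h x <= G x,
      \int[nu]_x (G x `^ t) <= 2%:E * \int[nu]_x (h x `^ t) &
      forall x r y, (0 < r)%R -> ball x r y ->
        \int[nu]_(z in ball x r) G z <= (majorant_coef t)^-1%:E * nu (ball x r) * G y].
Proof.
move=> t1 mh h0; have t0 : (0 < t)%R by exact: lt_trans t1.
set c := majorant_coef t; have c0 : (0 < c)%R by exact: majorant_coef_gt0.
pose Gs := fix Gs n := if n is n'.+1 then fun x => Order.max (h x) (c%:E * M (Gs n') x) else h.
have G0 n x : 0 <= Gs n x.
  by case: n => [|n] //=; rewrite le_max h0.
have mG n : measurable_fun setT (Gs n).
  elim: n => [|n IH]//=; apply: measurable_maxe => //.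
  by apply: measurable_funeM; exact: (measurable_maximal S).
have Gstep n : forall x, Gs n x <= Gs n.+1 x.
  elim: n => [x|n IH x] /=; first by rewrite le_max lexx.
  rewrite ge_max; apply/andP; split; first by rewrite le_max lexx.
  rewrite le_max lee_wpmul2l ?orbT// ?lee_fin ?(ltW c0)//.
  by apply: maximal_mono => //; exact: (mG n.+1).
have Gmono x : {homo Gs ^~ x : n m / (n <= m)%N >-> n <= m}.
  by apply: homo_leq => [y|y z w|n]; [exact: lexx|exact: le_trans|exact: Gstep].
pose G x := ereal_sup (range (Gs ^~ x)).
have cG x : Gs n x @[n --> \oo] --> G x by apply: ereal_nondecreasing_cvgn; exact: Gmono.
have GG n x : Gs n x <= G x by apply: ereal_sup_ubound; exists n.
exists G; split.
- exact: emeasurable_fun_cvg (fun x _ => cG x).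
- by move=> x; exact: (GG 0%N).
- have mP n : measurable_fun setT (fun x => Gs n x `^ t).
    exact: (measurableT_comp (measurable_poweR t)).
  have mht := mP 0%N.
  (* The bound reproduces itself: the t-th power of a maximum is at most the sum of the t-th powers,
     and the second term is at most half of the bound for [Gs n]. *)
  have Hn n : \int[nu]_x (Gs n x `^ t) <= 2%:E * \int[nu]_x (h x `^ t).
    have i0 : 0 <= \int[nu]_x (h x `^ t) by apply: integral_ge0 => x _; exact: poweR_ge0.
    elim: n => [|n IH]; first by rewrite /= -[leLHS]mul1e lee_wpmul2r// lee_fin ler1n.
    have mMG : measurable_fun setT (fun x => M (Gs n) x `^ t).
      apply: (measurableT_comp (measurable_poweR t)).
      exact: (measurable_maximal S).
    have M0 := maximal_ge0 S (G0 n).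
    apply: (@le_trans _ _ (\int[nu]_x (h x `^ t + (c `^ t)%:E * M (Gs n) x `^ t))).
      apply: ge0_le_integral => //.
      - by move=> x _; exact: poweR_ge0.
      - by apply: emeasurable_funD => //; exact: measurable_funeM.
      - move=> x _; rewrite -poweR_EFin -poweRM ?lee_fin ?(ltW c0)//=.
        by case: (leP (h x) (c%:E * M (Gs n) x)) => _; [rewrite leeDr|rewrite leeDl]; rewrite ?poweR_ge0.
    rewrite ge0_integralD//; last 3 first.
    + by move=> x _; exact: poweR_ge0.
    + by move=> x _; rewrite mule_ge0 ?poweR_ge0// lee_fin powR_ge0.
    + exact: measurable_funeM.
    rewrite ge0_integralZl//; last 2 first.
    + by move=> x _; exact: poweR_ge0.
    + by rewrite lee_fin powR_ge0.
    have := maximal_strong (mG n) (G0 n) t1.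
    move=> /(lee_wpmul2l (_ : 0 <= (c `^ t)%:E)) H.
    rewrite (_ : 2%:E = 1 + 1)// ge0_muleDl// mul1e leeD2l//.
    apply: le_trans (H _) _; first by rewrite lee_fin powR_ge0.
    rewrite muleA -EFinM.
    have -> : (c `^ t * hl_const t = 2^-1)%R.
      rewrite /c /majorant_coef -powRrM mulNr mulVf ?gt_eqF//.
      have hl0 := hl_const_gt0 t1.
      have hl20 : (0 < 2 * hl_const t)%R by rewrite mulr_gt0.
      by rewrite powR_inv1 ?(ltW hl20)// invfM mulfVK// gt_eqF.
    apply: (@le_trans _ _ ((2^-1)%:E * (2%:E * \int[nu]_x (h x `^ t)))).
      by rewrite lee_wpmul2l// lee_fin.
    by rewrite muleA -EFinM mulVf// mul1e.
  apply: (@integral_lim_le _ _ _ nu setT (fun n x => Gs n x `^ t)) => //.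
  + by move=> n x _; exact: poweR_ge0.
  + by move=> x _ n m nm; apply: poweR_le; [exact: ltW|exact: G0|exact: Gmono].
  + move=> x _; have -> : G x `^ t = ereal_sup (range (fun n => Gs n x `^ t)).
      apply/eqP; rewrite eq_le; apply/andP; split; last first.
        apply: ge_ereal_sup => _ [n _ <-].
        by apply: poweR_le; [exact: ltW|exact: G0|exact: GG].
      set sup := ereal_sup _.
      have ub n : Gs n x `^ t <= sup by apply: ereal_sup_ubound; exists n.
      have s0 : 0 <= sup by exact: le_trans (poweR_ge0 _ _) (ub 0%N).
      have -> : sup = (sup `^ t^-1) `^ t by rewrite -poweRrM mulVf ?gt_eqF// poweRe1.
      apply: poweR_le; [exact: ltW|exact: le_trans (G0 0%N x) (GG 0%N x)|].
      apply: ge_ereal_sup => _ [n _ <-].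
      have -> : Gs n x = (Gs n x `^ t) `^ t^-1.
        by rewrite -poweRrM mulfV ?gt_eqF// poweRe1// G0.
      by apply: poweR_le => //; rewrite ?poweR_ge0// invr_ge0 ltW.
    apply: ereal_nondecreasing_cvgn => n m nm.
    by apply: poweR_le; [exact: ltW|exact: G0|exact: Gmono].
(* By construction [c * M (Gs n) <= Gs n.+1 <= G], and an average over a ball is at most the maximal
   function at each of its points. *)
- move=> x r y r0 xy; have mB := ball_measurable S (x := x) I r0.
  apply: (@integral_lim_le _ _ _ nu _ Gs) => //.
  + by move=> n; exact: measurable_funTS.
  + move=> n; apply: (le_trans (maximal_ball S (Gs n) (p := (x, r)) r0 xy)) => /=.
    rewrite -muleA muleCA lee_wpmul2l// -lee_pdivrMl ?invr_gt0// invrK.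
    by apply: le_trans (GG n.+1 y); rewrite /= le_max lexx orbT.
Qed.

End strong_type.

(** * Monotonicity of A_s in the exponent *)

Section Ap_monotone.
Context d (T : measurableType d) (R : realType).
Variables (D : set T) (rho : T -> T -> R) (mu : {measure set T -> \bar R}).
Variables (K C s s' Kw : R) (w : T -> R).
Hypotheses (S : doubling_space D rho mu K C) (s_gt1 : 1 < s) (ss' : s <= s').
Hypotheses (w_ge0 : forall x, D x -> 0 <= w x) (mw : measurable_fun D w).
Local Open Scope ereal_scope.

Let s'1 : (1 < s')%R. Proof. exact: lt_le_trans ss'. Qed.

Lemma dual_weight_mono x : dual_weight s' w x = (dual_weight s w x) `^ ((s - 1) / (s' - 1)).
Proof.
have s0 : (0 < s - 1)%R by rewrite subr_gt0.
have s'0 : (0 < s' - 1)%R by rewrite subr_gt0.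
rewrite /dual_weight !inver !powR_eq0.
have e0 (z : R) : (0 < z)%R -> z^-1%R != 0%R by move=> z0; rewrite invr_eq0 gt_eqF.
rewrite !e0// !andbT; case: ifPn => [|w0].
  by rewrite poweRyr// mulf_neq0 ?e0// gt_eqF.
rewrite poweR_EFin -!powRN -powRrM; congr (_ `^ _)%:E.
by field; rewrite !gt_eqF.
Qed.

(** The dual weight for [s'] is the power (s - 1) / (s' - 1) of the one for [s]. Hölder's inequality
    bounds its average; raised to [s' - 1] the bound is the old one, so the constant is kept. *)
Lemma Ap_mono : Ap_const D rho mu s w <= Kw%:E -> Ap_const D rho mu s' w <= Kw%:E.
Proof.
move=> Aw; apply: ge_ereal_sup => _ [x [r [Dx r0 ->]]].
apply: le_trans Aw; apply: (@le_trans _ _ (eavg mu (qball D rho x r%:E) (EFin \o w) *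
     (eavg mu (qball D rho x r%:E) (dual_weight s w)) `^ (s - 1))); last first.
  by apply: ereal_sup_ubound; exists x, r.
have [<-|ns] := eqVneq s s'; first by [].
have {ns}ss : (s < s')%R by rewrite lt_neqAle ns.
have s0 : (0 < s - 1)%R by rewrite subr_gt0.
have s'0 : (0 < s' - 1)%R by rewrite subr_gt0.
set B := qball _ _ _ _; set th := ((s - 1) / (s' - 1))%R.
have th01 : (0 < th < 1)%R.
  by rewrite divr_gt0//= ltr_pdivrMr// mul1r ltrD2r.
have mB : measurable B by exact: (ball_measurable S).
have mwB : measurable_fun B w.
  by apply: measurable_funS mw; [exact: (space_measurable S)|exact: ball_in].
have mdB : measurable_fun B (dual_weight s w) by exact: measurable_dual_weight.
have B0 : 0 < mu B by exact: (ds_gt0 S).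
have Bfin : mu B \is a fin_num by rewrite ge0_fin_numE// (ds_fin S).
have m0 : (0 < fine (mu B))%R by rewrite fine_gt0// B0 ltey_eq Bfin.
have d0 x1 : 0 <= dual_weight s w x1 by exact/ltW/dual_weight_gt0.
apply: lee_wpmul2l.
  rewrite /eavg mule_ge0 ?inve_ge0//; apply: integral_ge0 => y By.
  by rewrite lee_fin w_ge0//; exact: ball_in By.
rewrite /eavg -(fineK Bfin) inver gt_eqF//.
have H := holder_ereal mu th01 mB mdB (@measurable_cst _ _ _ _ B 1) (fun x _ => d0 x)
   (fun x _ => lee01).
have iE : \int[mu]_(x in B) dual_weight s' w x =
    \int[mu]_(x in B) (dual_weight s w x `^ th * cst 1 x `^ (1 - th)).
  by apply: eq_integral => y _; rewrite dual_weight_mono poweR1r mule1.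
rewrite iE; set I1 := \int[mu]_(x in B) _ in H *; set sg := \int[mu]_(x in B) _ in H *.
have I10 : 0 <= I1 by apply: integral_ge0 => y _; rewrite mule_ge0// poweR_ge0.
have sg0 : 0 <= sg by apply: integral_ge0.
rewrite integral_cst// mul1e in H.
have -> : (s - 1 = th * (s' - 1))%R by rewrite divfK// gt_eqF.
rewrite poweRrM; apply: poweR_le; [exact: ltW| |].
  by rewrite mule_ge0// lee_fin invr_ge0 ltW.
rewrite poweRM ?lee_fin ?invr_ge0 ?(ltW m0)//.
apply: (@le_trans _ _ ((fine (mu B))^-1%:E * (sg `^ th * mu B `^ (1 - th)))).
  by rewrite lee_wpmul2l// lee_fin invr_ge0 ltW.
rewrite muleCA muleC -[X in X `^ (1 - th)](fineK Bfin) !poweR_EFin -EFinM.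
rewrite lee_wpmul2r ?poweR_ge0// lee_fin.
rewrite -[(fine (mu B))^-1%R]powR_inv1 ?(ltW m0)// -powRD ?(gt_eqF m0) ?implybT//.
rewrite -powRrM mulN1r le_eqVlt; apply/orP; left; apply/eqP.
by congr (_ `^ _)%R; ring.
Qed.

End Ap_monotone.

Definition Ap_doubling (R : realType) (C s Kw : R) := Num.max 1 (Kw * C `^ s).

(** * The doubling measure w dmu and its real-valued majorants *)

Section Ap_measure.
Context d (T : measurableType d) (R : realType).
Variables (rho : T -> T -> R) (mu : {measure set T -> \bar R}).
Variables (K C s Kw : R) (w : T -> R).
Hypotheses (S : doubling_space setT rho mu K C) (s_gt1 : 1 < s).
Hypotheses (w_ge0 : forall x, 0 <= w x) (mw : measurable_fun setT w).
Hypothesis Apw : (Ap_const setT rho mu s w <= Kw%:E)%E.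
Local Notation ball x r := (qball setT rho x r%:E).
Local Open Scope ereal_scope.

Let mwE : measurable_fun setT (fun x => (w x)%:E).
Proof. exact/measurable_EFinP. Qed.
Let w0 x : 0 <= (w x)%:E. Proof. by rewrite lee_fin. Qed.
Let w0' x : setT x -> (0 <= w x)%R. Proof. by []. Qed.

Lemma setT_bigcup_ball x : [set: T] = \bigcup_n ball x n.+1%:R.
Proof. exact: (bigcup_ball rho). Qed.

(** If one ball has zero weight, comparing it with larger balls by [Ap_subset_lower] makes the
    weight of all of them zero. *)
Lemma Ap_weight_dichotomy : {ae mu, forall x, w x = 0%R} \/
  forall x r, (0 < r)%R -> 0 < \int[mu]_(z in ball x r) (w z)%:E.
Proof.
have [H|] := pselect (forall x r, (0 < r)%R -> 0 < \int[mu]_(z in ball x r) (w z)%:E).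
  by right.
move=> /existsNP[x /existsNP[r /not_implyP[r0 /negP]]].
rewrite lt0e negb_and negbK integral_ge0//= orbF => /eqP W0; left.
have B0 n : \int[mu]_(z in ball x n.+1%:R) (w z)%:E = 0.
  pose r' := Num.max r n.+1%:R; have r'0 : (0 < r')%R by rewrite lt_max r0.
  have mB := ball_measurable S (x := x) I r0.
  have BB : ball x r `<=` ball x r'.
    by apply: ball_mono; rewrite le_max lexx.
  have H := Ap_subset_lower S s_gt1 w0' mw Apw I r'0 mB BB.
  apply/eqP; rewrite eq_le integral_ge0// andbT.
  apply: (@le_trans _ _ (\int[mu]_(z in ball x r') (w z)%:E)).
    apply: ge0_subset_integral => //.
    - exact: (ball_measurable S).
    - exact: (ball_measurable S).
    - exact: measurable_funTS.
    - by apply: ball_mono; rewrite le_max lexx orbT.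
  rewrite leNgt; apply/negP => W'.
  move: H; rewrite W0 mule0 leNgt mule_gt0// poweR_gt0//.
  exact: (ds_gt0 S).
have aeB n := integral_eq0_ae (ball_measurable S (x := x) I (ltr0Sn R n))
  (measurable_funTS mwE) (fun x _ => w0 x) (B0 n).
have : {ae mu, forall z n, ball x n.+1%:R z -> (w z)%:E = 0} by apply: ae_foralln => n; exact: aeB.
apply: filterS => z H.
have : [set: T] z by [].
by rewrite (setT_bigcup_ball x) => -[n _ /H[]].
Qed.

Section nondegenerate.
Hypothesis W_gt0 : forall x r, (0 < r)%R -> 0 < \int[mu]_(z in ball x r) (w z)%:E.
Variable nu : {measure set T -> \bar R}.
Hypothesis nuE : forall A, nu A = \int[mu]_(x in A) (w x)%:E.

Lemma Ap_pos_ae : {ae mu, forall x, (0 < w x)%R}.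
Proof.
have [[x0]|/forallNP E] := pselect (exists x : T, True); last first.
  by apply: aeW => x; case: (E x).
move=> _; have : {ae mu, forall z n, ball x0 n.+1%:R z -> (0 < w z)%R}.
  apply: ae_foralln => n.
  exact: (Ap_weight_gt0_ae S s_gt1 w0' mw Apw I (ltr0Sn R n) (W_gt0 _ _)).
apply: filterS => z H.
have : [set: T] z by [].
by rewrite (setT_bigcup_ball x0) => -[n _ /H].
Qed.

Lemma Ap_measure_doubling : doubling_space setT rho nu K (Ap_doubling C s Kw).
Proof.
split => //; try solve [by case: S].
- by rewrite /Ap_doubling le_max lexx.
- by move=> x r _ r0; rewrite nuE W_gt0.
- by move=> x r _ r0; rewrite nuE (Ap_weight_lty S s_gt1 mw Apw I r0).
move=> x r _ r0; rewrite !nuE.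
have r20 : (0 < 2 * r)%R by rewrite mulr_gt0.
have mB := ball_measurable S (x := x) I r0.
have H := Ap_subset_lower S s_gt1 w0' mw Apw I r20 mB
  (@ball_mono _ _ _ setT rho x _ _ (ler_peMl (ltW r0) (ler1n R 2))).
have B0 := ds_gt0 S (x := x) I r0.
have Bf : mu (ball x r) \is a fin_num by rewrite gt0_fin_numE// (ds_fin S).
have m0 : (0 < fine (mu (ball x r)))%R by rewrite fine_gt0// B0 ltey_eq Bf.
have B20 := ds_gt0 S (x := x) I r20.
have B2f : mu (ball x (2 * r)) \is a fin_num by rewrite gt0_fin_numE// (ds_fin S).
have dbl := ds_doubling S (x := x) I r0.
rewrite -(fineK Bf) -(fineK B2f) -EFinM lee_fin in dbl.
have C1 := ds_C S.
have Kw0 : (0 <= Kw)%R.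
  have := Ap_ball_product S s_gt1 mw Apw (x0 := x) I r0 => P.
  have : 0 <= (Kw * fine (mu (ball x r)) `^ s)%:E.
    by apply: le_trans P; rewrite mule_ge0 ?poweR_ge0// integral_ge0.
  by rewrite lee_fin pmulr_lge0// powR_gt0.
rewrite -(fineK Bf) poweR_EFin in H.
rewrite -(@lee_pmul2l _ (fine (mu (ball x r)) `^ s)%:E) ?lte_fin ?powR_gt0//.
apply: (le_trans H); rewrite muleA -EFinM lee_wpmul2r ?integral_ge0// lee_fin.
apply: (@le_trans _ _ (Kw * (C * fine (mu (ball x r))) `^ s)%R).
  apply: ler_wpM2l => //; apply: ge0_ler_powR => //.
  - by rewrite ltW// (lt_trans _ s_gt1).
  - by rewrite nnegrE fine_ge0.
  - by rewrite nnegrE (le_trans _ dbl)// fine_ge0.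
rewrite powRM ?(ltW m0) ?(le_trans ler01)// mulrA [X in (X <= _)%R]mulrC.
by rewrite ler_wpM2l ?powR_ge0// /Ap_doubling le_max lexx orbT.
Qed.

Hypothesis nu_int : forall D h, measurable D -> measurable_fun D h ->
  (forall x, D x -> 0 <= h x) -> \int[nu]_(x in D) h x = \int[mu]_(x in D) (h x * (w x)%:E).

(** [w] is positive a.e., so [nu]-null sets are [mu]-null; the majorant is built for [nu] but used
    under [mu]. *)
Lemma nu0_mu0 (P : T -> Prop) : {ae nu, forall x, P x} -> {ae mu, forall x, P x}.
Proof.
move=> [A [mA nuA AP]]; have := Ap_pos_ae.
have := integral_eq0_ae mA (measurable_funTS mwE) (fun x _ => w0 x)
  (etrans (esym (nuE A)) nuA) => H1 H2.
have [B [mB muB BP]] : {ae mu, forall x, ~ A x}.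
  apply: (@filterS2 _ _ (ae_filter_ringOfSetsType mu) _ _ _ _ H1 H2) => x /= HA wx Ax.
  by have [E] := HA Ax; rewrite E ltxx in wx.
exists B; split => // x nP; apply: BP => /=.
by move=> H; apply: H; exact: AP.
Qed.

(** Weights are real functions, so [G] must be made real and positive. If [G x = 0], its integrals
    over all balls about [x] vanish, so [h = 0] a.e., which the positive integral excludes. [G] is
    +oo only on a null set, as the integral of G^t is finite, and is replaced there by 1. *)
Lemma real_majorant (t : R) (h : T -> \bar R) : (1 < t)%R ->
  measurable_fun setT h -> (forall x, 0 <= h x) ->
  0 < \int[mu]_x (h x `^ t * (w x)%:E) < +oo ->
  let L := ((majorant_coef K (Ap_doubling C s Kw) t)^-1)%R in
  exists G : T -> R, [/\ measurable_fun setT G, forall x, (0 < G x)%R,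
    {ae mu, forall x, h x <= (G x)%:E},
    \int[mu]_x ((G x `^ t)%:E * (w x)%:E) <= 2%:E * \int[mu]_x (h x `^ t * (w x)%:E) &
    forall x r, (0 < r)%R -> {ae mu, forall y, ball x r y ->
      \int[mu]_(z in ball x r) (G z * w z)%:E <=
      (L * fine (\int[mu]_(z in ball x r) (w z)%:E))%:E * (G y)%:E}].
Proof.
move=> t1 mh h0 /andP[I0 Ioo] L; have t0 : (0 < t)%R by exact: lt_trans t1.
have Sn := Ap_measure_doubling.
have [G [mG hG Gint Gball]] := A1_majorant Sn t1 mh h0.
have G0 x : 0 <= G x by exact: le_trans (h0 x) (hG x).
have mp (f : T -> \bar R) : measurable_fun setT f -> measurable_fun setT (fun x => f x `^ t).
  by move=> mf; exact: (measurableT_comp (measurable_poweR t)).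
rewrite !nu_int// in Gint; try solve [exact: mp | by move=> x _; exact: poweR_ge0].
have Gpos x : 0 < G x.
  rewrite lt0e G0 andbT; apply/eqP => Gx; move: I0.
  have Hn n : \int[nu]_(z in ball x n.+1%:R) G z = 0.
    apply/eqP; rewrite eq_le integral_ge0// andbT.
    have := Gball x n.+1%:R x; rewrite Gx mule0; apply; first exact: ltr0Sn.
    by apply: (ball_center Sn).
  have : {ae mu, forall z, h z `^ t * (w z)%:E = 0}.
    apply: nu0_mu0.
    have : {ae nu, forall z n, ball x n.+1%:R z -> G z = 0}.
      apply: ae_foralln => n.
      exact: (integral_eq0_ae (ball_measurable Sn (x := x) I (ltr0Sn R n))
        (measurable_funTS mG) (fun x _ => G0 x) (Hn n)).
    apply: filterS => z H.
    have : [set: T] z by [].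
    rewrite (setT_bigcup_ball x) => -[n _ /H Gz].
    have -> : h z = 0 by apply/eqP; rewrite eq_le h0 -Gz hG.
    by rewrite poweR0r ?gt_eqF// mul0e.
  move=> H; rewrite (_ : \int[mu]_x _ = 0) ?ltxx// -(integral0 mu setT).
  apply: ge0_ae_eq_integral => //.
  - by apply: emeasurable_funM => //; exact: mp.
  - by move=> z _; rewrite mule_ge0// poweR_ge0.
  - by apply: filterS H => z.
have Gfin : {ae mu, forall x, G x < +oo}.
  apply: nu0_mu0.
  have : {ae nu, forall x, setT x -> G x `^ t < +oo}.
    apply: integral_lty_ae => //; [exact: mp|by move=> x _; exact: poweR_ge0|].
    rewrite nu_int//; [|exact: mp|by move=> x _; exact: poweR_ge0].
    by apply: (le_lt_trans Gint); rewrite lte_mul_pinfty.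
  apply: filterS => x /(_ I) H; rewrite ltey; apply/eqP => E; move: H.
  by rewrite E poweRyr ?gt_eqF// ltxx.
pose Gr x := if G x == +oo then 1%R else fine (G x).
have GrE : {ae mu, forall x, (Gr x)%:E = G x}.
  apply: filterS Gfin => x Gx; rewrite /Gr lt_eqF// fineK//.
  by rewrite ge0_fin_numE.
have mGr : measurable_fun setT Gr.
  apply: measurable_fun_ifT => //; last exact: measurableT_comp.
  apply: (measurable_fun_bool true) => //; rewrite setTI.
  have -> : (fun x => G x == +oo) @^-1` [set true] = setT `&` (G @^-1` [set +oo]).
    by rewrite setTI; apply/seteqP; split => x /= => [/eqP|->].
  exact: (mG).
have Gr0 x : (0 < Gr x)%R.
  by rewrite /Gr; case: ifPn => // Gx; rewrite fine_gt0// Gpos/= lt_neqAle Gx leey.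
exists Gr; split => //.
- by apply: filterS GrE => x ->.
- apply: le_trans Gint; rewrite le_eqVlt; apply/orP; left; apply/eqP.
  apply: ge0_ae_eq_integral => //.
  + apply: emeasurable_funM => //; apply/measurable_EFinP.
    by apply: (measurableT_comp (measurable_powR _)).
  + by apply: emeasurable_funM => //; exact: mp.
  + by move=> x _; rewrite mule_ge0// lee_fin powR_ge0.
  + by move=> x _; rewrite mule_ge0// poweR_ge0.
  + by apply: filterS GrE => x /= <- _; rewrite poweR_EFin.
- move=> x r r0; have GrE' := GrE; apply: filterS GrE' => y Gy By; rewrite Gy.
  have := Gball x r y r0 By; rewrite nuE nu_int//; last 2 first.
  + exact: (ball_measurable S).
  + exact: measurable_funTS.
  rewrite -/L EFinM fineK; last first.
    by rewrite gt0_fin_numE ?W_gt0// (Ap_weight_lty S s_gt1 mw Apw I r0).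
  apply: le_trans; rewrite le_eqVlt; apply/orP; left; apply/eqP.
  have mB := ball_measurable S (x := x) I r0.
  apply: ge0_ae_eq_integral => //.
  + by apply/measurable_EFinP; apply: measurable_funTS; exact: measurable_funM.
  + by apply: measurable_funTS; exact: emeasurable_funM.
  + by move=> z _; rewrite lee_fin mulr_ge0// (ltW (Gr0 z)).
  + by move=> z _; rewrite mule_ge0.
  + by apply: filterS GrE => z /= <- _; rewrite EFinM.
Qed.

End nondegenerate.
End Ap_measure.

(** The powers of [V] cancel, and what is left is the [A_s] product of [W] and [sg] raised to
    [a + 1]. *)
Lemma div_weight_algebra (R : realType) (L W V sg Kw M s a : R) :
  0 < L -> 0 < W -> 0 < V -> 0 <= sg -> 0 < M -> 0 < a -> W * sg `^ (s - 1) <= Kw * M ->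
  (V / (L * W)) `^ (- a) * W * (V `^ a * sg `^ ((s - 1) * (a + 1)))
    <= L `^ a * Kw `^ (a + 1) * M `^ (a + 1).
Proof.
move=> L0 W0 V0 sg0 M0 a0 wsg; have a10 : 0 < a + 1 by rewrite addr_gt0.
have Kw0 : 0 <= Kw.
  rewrite -(pmulr_lge0 _ M0); apply: le_trans wsg.
  by rewrite mulr_ge0 ?powR_ge0// ltW.
have LW0 : 0 < L * W by rewrite mulr_gt0.
have -> : (V / (L * W)) `^ (- a) = (V `^ a)^-1 * (L `^ a * W `^ a).
  rewrite powRM ?(ltW V0) ?invr_ge0 ?(ltW LW0)// powRN; congr (_ * _).
  by rewrite -[(L * W)^-1]powR_inv1 ?(ltW LW0)// -powRrM mulrNN mul1r powRM ?ltW.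
have Va0 : V `^ a != 0 by rewrite gt_eqF ?powR_gt0.
apply: (@le_trans _ _ (L `^ a * ((W * sg `^ (s - 1)) `^ (a + 1)))).
  rewrite le_eqVlt; apply/orP; left; apply/eqP.
  rewrite [in RHS]powRM ?powR_ge0 ?(ltW W0)// -powRrM powRD ?(gt_eqF W0) ?implybT//.
  by rewrite powRr1 ?(ltW W0)//; field.
rewrite -mulrA ler_wpM2l ?powR_ge0// -powRM ?(ltW M0)//.
apply: ge0_ler_powR => //; first exact: ltW.
- by rewrite nnegrE mulr_ge0 ?powR_ge0// ltW.
- by rewrite nnegrE mulr_ge0// ltW.
Qed.

(** * Products of an A_s weight with powers of its majorant *)

Section majorant_weights.
Context d (T : measurableType d) (R : realType).
Variables (rho : T -> T -> R) (mu : {measure set T -> \bar R}).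
Variables (K C s Kw L : R) (w G : T -> R).
Hypotheses (S : doubling_space setT rho mu K C) (s_gt1 : 1 < s).
Hypotheses (w_ge0 : forall x, 0 <= w x) (mw : measurable_fun setT w).
Hypothesis Apw : (Ap_const setT rho mu s w <= Kw%:E)%E.
Local Notation ball x r := (qball setT rho x r%:E).
Local Open Scope ereal_scope.
Hypothesis W_gt0 : forall x r, (0 < r)%R -> 0 < \int[mu]_(z in ball x r) (w z)%:E.
Hypotheses (mG : measurable_fun setT G) (G_gt0 : forall x, (0 < G x)%R) (L_gt0 : (0 < L)%R).
Hypothesis Gball : forall x r, (0 < r)%R -> {ae mu, forall y, ball x r y ->
      \int[mu]_(z in ball x r) (G z * w z)%:E <=
      (L * fine (\int[mu]_(z in ball x r) (w z)%:E))%:E * (G y)%:E}.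

Let w0 x : 0 <= (w x)%:E. Proof. by rewrite lee_fin. Qed.
Let w_pos : {ae mu, forall x, (0 < w x)%R}.
Proof. exact: (Ap_pos_ae S s_gt1 w_ge0 mw Apw). Qed.

Lemma Ap_const_le s' K' v : (forall x r, (0 < r)%R ->
    (\int[mu]_(z in ball x r) (v z)%:E) *
    (\int[mu]_(z in ball x r) dual_weight s' v z) `^ (s' - 1)
    <= (K' * fine (mu (ball x r)) `^ s')%:E) -> (1 < s')%R ->
  Ap_const setT rho mu s' v <= K'%:E.
Proof.
move=> H s'1; apply: ge_ereal_sup => _ [x [r [_ r0 ->]]].
have B0 := ds_gt0 S (x := x) I r0.
have Bf : mu (ball x r) \is a fin_num by rewrite gt0_fin_numE// (ds_fin S).
have m0 : (0 < fine (mu (ball x r)))%R by rewrite fine_gt0// B0 ltey_eq Bf.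
have := H x r r0; rewrite /eavg; set m := fine _ in m0 *.
rewrite -(fineK Bf) -/m inver gt_eqF// poweRM ?lee_fin ?invr_ge0 ?(ltW m0)//; last first.
  by apply: integral_ge0 => z _; exact/ltW/dual_weight_gt0.
rewrite poweR_EFin muleACA -EFinM.
have -> : (m^-1 * m^-1 `^ (s' - 1) = (m `^ s')^-1)%R.
  rewrite mulr_powRB1 ?invr_ge0 ?(ltW m0) ?(lt_trans _ s'1)//.
  by rewrite -[m^-1%R]powR_inv1 ?ltW// -powRrM mulN1r powRN.
by rewrite lee_pdivrMl ?powR_gt0// -EFinM mulrC.
Qed.

Section one_ball.
Variables (x0 : T) (r : R).
Hypothesis r_gt0 : (0 < r)%R.
Let B := ball x0 r.
Let m := fine (mu B).

Let mB : measurable B. Proof. exact: (ball_measurable S). Qed.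
Let mwB : measurable_fun B (fun x => (w x)%:E).
Proof. by apply/measurable_EFinP; exact: measurable_funTS. Qed.
Let mGB : measurable_fun B (fun x => (G x)%:E).
Proof. by apply/measurable_EFinP; exact: measurable_funTS. Qed.
Let mdB : measurable_fun B (dual_weight s w).
Proof. by apply: measurable_dual_weight; exact: measurable_funTS. Qed.
Let muB_gt0 : 0 < mu B. Proof. exact: (ds_gt0 S). Qed.
Let m_gt0 : (0 < m)%R. Proof. by rewrite fine_gt0// muB_gt0 (ds_fin S). Qed.

Let W := fine (\int[mu]_(x in B) (w x)%:E).
Let sg := fine (\int[mu]_(x in B) dual_weight s w x).
Let V := fine (\int[mu]_(x in B) (G x * w x)%:E).

Let WE : \int[mu]_(x in B) (w x)%:E = W%:E.
Proof.
rewrite fineK// gt0_fin_numE ?W_gt0//; exact: (Ap_weight_lty S s_gt1 mw Apw I r_gt0).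
Qed.

Let W0 : (0 < W)%R. Proof. by rewrite -lte_fin -WE W_gt0. Qed.

Let d0 x : 0 <= dual_weight s w x. Proof. exact/ltW/dual_weight_gt0. Qed.

Let dE : \int[mu]_(x in B) dual_weight s w x = sg%:E.
Proof.
rewrite fineK// ge0_fin_numE ?integral_ge0//.
exact: (Ap_dual_lty S s_gt1 mw Apw I r_gt0 (W_gt0 _ _)).
Qed.

Let sg0 : (0 <= sg)%R. Proof. by rewrite -lee_fin -dE integral_ge0. Qed.

Let wsg : (W * sg `^ (s - 1) <= Kw * m `^ s)%R.
Proof.
have := Ap_ball_product S s_gt1 mw Apw (x0 := x0) I r_gt0.
by rewrite -/B WE dE poweR_EFin -EFinM lee_fin.
Qed.

Let mGw : measurable_fun B (fun x => (G x * w x)%:E).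
Proof.
by apply/measurable_EFinP; apply: measurable_funTS; exact: measurable_funM.
Qed.

Let Gw0 x : 0 <= (G x * w x)%:E.
Proof. by rewrite lee_fin mulr_ge0// ltW. Qed.

Let VE : \int[mu]_(x in B) (G x * w x)%:E = V%:E.
Proof.
rewrite fineK// ge0_fin_numE ?integral_ge0// ltey; apply/eqP => Voo.
have [A [mA A0 HA]] := Gball x0 r_gt0.
suff : mu B <= mu A by rewrite A0 leNgt muB_gt0.
apply: le_measure; rewrite ?inE// => y By; apply: HA => /=.
by move/(_ By); rewrite Voo -EFinM.
Qed.

Let V0 : (0 < V)%R.
Proof.
rewrite -lte_fin -VE lt0e integral_ge0// andbT; apply/eqP => E.
have := W0; rewrite -lte_fin -WE (_ : \int[mu]_(x in B) (w x)%:E = 0) ?ltxx//.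
rewrite -(integral0 mu B); apply: ge0_ae_eq_integral => //.
have := integral_eq0_ae mB mGw (fun x _ => Gw0 x) E.
apply: filterS => x H Bx; have := H Bx => /= -[/eqP].
by rewrite mulf_eq0 gt_eqF//= => /eqP ->.
Qed.

Let c := (V / (L * W))%R.
Let c0 : (0 < c)%R. Proof. by rewrite divr_gt0// mulr_gt0. Qed.

Let cG : {ae mu, forall y, B y -> (c <= G y)%R}.
Proof.
apply: filterS (Gball x0 r_gt0) => y H By; have := H By.
by rewrite VE -EFinM lee_fin ler_pdivrMr ?mulr_gt0// [X in (_ <= X)%R]mulrC.
Qed.

(** On the ball [G] is a.e. at least [c = V / (L * W)]. This bounds the dual integral of [G * w] by
    a negative power of [c] times [sg], and [V / c = L * W] brings back the [A_s] product of [w]. *)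
Lemma mul_weight_ball :
  (\int[mu]_(x in B) (G x * w x)%:E) *
  (\int[mu]_(x in B) dual_weight s (fun x => (G x * w x)%R) x) `^ (s - 1)
  <= (L * Kw * m `^ s)%:E.
Proof.
have s0 : (0 < s - 1)%R by rewrite subr_gt0.
have mv : measurable_fun B (dual_weight s (fun x => (G x * w x)%R)).
  by apply: measurable_dual_weight; apply/measurable_EFinP.
have H : \int[mu]_(x in B) dual_weight s (fun x => (G x * w x)%R) x
    <= (c `^ (- (s - 1)^-1) * sg)%:E.
  rewrite EFinM -dE -ge0_integralZl ?lee_fin ?powR_ge0//.
  apply: ae_ge0_le_integral => //.
  - by move=> x _; exact/ltW/dual_weight_gt0.
  - by move=> x _; rewrite mule_ge0// lee_fin powR_ge0.
  - exact: measurable_funeM.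
  apply: (@filterS2 _ _ (ae_filter_ringOfSetsType mu) _ _ _ _ cG w_pos) => x H wx Bx.
  have {}H := H Bx; have Gx := G_gt0 x.
  rewrite /dual_weight !inver !gt_eqF ?powR_gt0 ?mulr_gt0//.
  rewrite -EFinM lee_fin -!powRN [X in (X <= _)%R](powRM _ (ltW Gx) (ltW wx)) ler_wpM2r ?powR_ge0//.
  rewrite !powRN lef_pV2 ?posrE ?powR_gt0//; apply: ge0_ler_powR => //.
  - by rewrite invr_ge0 ltW.
  - by rewrite nnegrE ltW.
  - by rewrite nnegrE ltW.
apply: (@le_trans _ _ (V%:E * ((c `^ (- (s - 1)^-1) * sg)%:E) `^ (s - 1))).
  rewrite VE lee_wpmul2l ?lee_fin ?(ltW V0)// poweR_le//; first exact: ltW.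
  by apply: integral_ge0 => x _; exact/ltW/dual_weight_gt0.
rewrite poweR_EFin -EFinM lee_fin powRM ?powR_ge0// -powRrM mulNr mulVf ?gt_eqF//.
rewrite powR_inv1 ?(ltW c0)//.
have -> : (V * (c^-1 * sg `^ (s - 1)) = L * (W * sg `^ (s - 1)))%R.
  by rewrite /c; field; rewrite !gt_eqF.
by rewrite -mulrA ler_wpM2l// ltW.
Qed.

Variable a : R.
Hypothesis a_gt0 : (0 < a)%R.

(** The exponent [(a + 1) * s] is the one for which the dual weight of [v] is the power [b] of
    [G * w] times the power [1 - b] of the dual weight of [w]. Hölder's inequality then gives powers
    of [V] and [sg], while [v] itself is at most c^(-a) w. *)
Lemma div_weight_ball (S' := ((a + 1) * s)%R) (v := fun x => (G x `^ (- a) * w x)%R) :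
  (\int[mu]_(x in B) (v x)%:E) *
  (\int[mu]_(x in B) dual_weight S' v x) `^ (S' - 1)
  <= (L `^ a * Kw `^ (a + 1) * m `^ S')%:E.
Proof.
have a10 : (0 < a + 1)%R by rewrite addr_gt0.
have s0 : (0 < s - 1)%R by rewrite subr_gt0.
have S'0 : (0 < S' - 1)%R.
  rewrite /S' subr_gt0 mulrDl mul1r; apply: (lt_trans s_gt1).
  by rewrite ltrDr mulr_gt0// (lt_trans _ s_gt1).
pose b := (a / (S' - 1))%R.
have b01 : (0 < b < 1)%R.
  rewrite divr_gt0//= ltr_pdivrMr// mul1r /S' mulrDl mul1r -addrA.
  apply: (@lt_trans _ _ (a * s)%R); first by rewrite ltr_pMr.
  by rewrite ltrDl.
have mv : measurable_fun B v.
  apply: measurable_funTS; apply: measurable_funM => //.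
  exact: (measurableT_comp (measurable_powR _)).
have v0 x : (0 <= v x)%R by rewrite mulr_ge0// powR_ge0.
have mdv : measurable_fun B (dual_weight S' v) by exact: measurable_dual_weight.
have iv0 : 0 <= \int[mu]_(x in B) dual_weight S' v x.
  by apply: integral_ge0 => x _; exact/ltW/dual_weight_gt0.
have H1 : \int[mu]_(x in B) (v x)%:E <= (c `^ (- a) * W)%:E.
  rewrite EFinM -WE -ge0_integralZl ?lee_fin ?powR_ge0//.
  apply: ae_ge0_le_integral => //.
  - by move=> x _; rewrite lee_fin.
  - exact/measurable_EFinP.
  - by move=> x _; rewrite mule_ge0// lee_fin powR_ge0.
  - exact: measurable_funeM.
  apply: filterS cG => x H Bx; have {}H := H Bx; have Gx := G_gt0 x.
  rewrite -EFinM lee_fin ler_wpM2r// !powRN lef_pV2 ?posrE ?powR_gt0//.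
  by apply: ge0_ler_powR => //; rewrite ?nnegrE ltW.
have H2 : \int[mu]_(x in B) dual_weight S' v x <= (V `^ b * sg `^ (1 - b))%:E.
  rewrite EFinM -!poweR_EFin -VE -dE.
  apply: le_trans (holder_ereal mu b01 mB mGw mdB (fun x _ => Gw0 x) (fun x _ => d0 x)).
  apply: ae_ge0_le_integral => //.
  - by move=> x _; exact/ltW/dual_weight_gt0.
  - by move=> x _; rewrite mule_ge0 ?poweR_ge0.
  - by apply: emeasurable_funM; exact: (measurableT_comp (measurable_poweR _)).
  apply: filterS w_pos => x wx Bx; have Gx := G_gt0 x.
  rewrite /dual_weight !inver !gt_eqF ?powR_gt0 ?mulr_gt0 ?powR_gt0//.
  rewrite !poweR_EFin -EFinM lee_fin -!powRN [X in (_ <= X * _)%R]powRM ?(ltW Gx) ?(ltW wx)//.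
  rewrite [X in (X <= _)%R]powRM ?powR_ge0 ?(ltW wx)// -!powRrM mulrNN.
  rewrite -/b -mulrA ler_wpM2l ?powR_ge0// -powRD ?(gt_eqF wx) ?implybT//.
  rewrite le_eqVlt; apply/orP; left; apply/eqP; congr (_ `^ _)%R.
  rewrite /b; have : (S' - 1 != 0)%R by rewrite gt_eqF.
  have : (s - 1 != 0)%R by rewrite gt_eqF.
  by rewrite /S' => ? ?; field; apply/andP.
apply: (@le_trans _ _ ((c `^ (- a) * W)%:E * ((V `^ b * sg `^ (1 - b))%:E) `^ (S' - 1))).
  apply: lee_pmul => //; first by apply: integral_ge0 => x _; rewrite lee_fin.
  - exact: poweR_ge0.
  - by apply: poweR_le => //; exact: ltW.
rewrite poweR_EFin -EFinM lee_fin powRM ?powR_ge0// -!powRrM /b divfK ?gt_eqF//.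
have -> : ((1 - a / (S' - 1)) * (S' - 1) = (s - 1) * (a + 1))%R.
  by rewrite mulrBl mul1r divfK ?gt_eqF// /S'; ring.
rewrite [X in (_ <= _ * X)%R](_ : _ = (m `^ s) `^ (a + 1))%R; last by rewrite -powRrM mulrC.
by apply: div_weight_algebra wsg; rewrite ?mulr_gt0 ?powR_gt0//.
Qed.

End one_ball.
End majorant_weights.

(** * Extrapolation in the second variable *)

Definition majorant_const (R : realType) (K C s Kw t : R) :=
  (majorant_coef K (Ap_doubling C s Kw) t)^-1.

(** For r < 1 the weights used are G^(-a) w with a = 2 (1 - r) / r, in the class of exponent
    [(a + 1) * s]; otherwise they are [G * w] or [w], in the class of [w]. *)
Definition extrapolation_exponent (R : realType) (r s : R) : R :=
  if r < 1 then (2 * (1 - r) / r + 1) * s else s.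

Definition extrapolation_weight (R : realType) (K C s Kw r : R) : R :=
  if r < 1 then
    majorant_const K C s Kw 2 `^ (2 * (1 - r) / r) * Kw `^ (2 * (1 - r) / r + 1)
  else if r == 1 then Kw
  else majorant_const K C s Kw (r / (r - 1)) * Kw.

Definition extrapolation_factor (R : realType) (r N : R) : R :=
  if r < 1 then 4 * N `^ r else N `^ r * 2 `^ (r - 1).

Section extrapolation.
Context d (T : measurableType d) (R : realType).
Variables (rho : T -> T -> R) (mu : {measure set T -> \bar R}).
Variables (K C s Kw : R) (w : T -> R).
Hypotheses (S : doubling_space setT rho mu K C) (s_gt1 : 1 < s).
Hypotheses (w_ge0 : forall x, 0 <= w x) (mw : measurable_fun setT w).
Hypothesis Apw : (Ap_const setT rho mu s w <= Kw%:E)%E.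
Local Open Scope ereal_scope.

Let mwE : measurable_fun setT (fun x => (w x)%:E).
Proof. exact/measurable_EFinP. Qed.
Let w0 x : 0 <= (w x)%:E. Proof. by rewrite lee_fin. Qed.
Let mp (r : R) (f : T -> \bar R) : measurable_fun setT f -> measurable_fun setT (fun x => f x `^ r).
Proof. by move=> mf; exact: (measurableT_comp (measurable_poweR r)). Qed.

Lemma Ap_majorant (t : R) (h : T -> \bar R) (L := majorant_const K C s Kw t) : (1 < t)%R ->
  measurable_fun setT h -> (forall x, 0 <= h x) ->
  0 < \int[mu]_x (h x `^ t * (w x)%:E) < +oo ->
  exists G : T -> R, [/\ measurable_fun setT G /\ (forall x, (0 < G x)%R),
    {ae mu, forall x, (0 < w x)%R /\ h x <= (G x)%:E},
    \int[mu]_x ((G x `^ t)%:E * (w x)%:E) <= 2%:E * \int[mu]_x (h x `^ t * (w x)%:E),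
    Ap_const setT rho mu s (fun x => G x * w x)%R <= (L * Kw)%:E &
    forall a, (0 < a)%R -> Ap_const setT rho mu ((a + 1) * s) (fun x => G x `^ (- a) * w x)%R <=
      (L `^ a * Kw `^ (a + 1))%:E].
Proof.
move=> t1 mh h0 I0.
have [wae0|W_gt0] := Ap_weight_dichotomy S s_gt1 w_ge0 mw Apw.
  case/andP: I0 => + _; rewrite (_ : \int[mu]_x _ = 0) ?ltxx// -(integral0 mu setT).
  apply: ge0_ae_eq_integral => //.
  - by apply: emeasurable_funM => //; exact: mp.
  - by move=> x _; rewrite mule_ge0// poweR_ge0.
  - by apply: filterS wae0 => x -> _; rewrite mule0.
have [nu [nuE nu_int]] := density_measure mu mwE w0.
have [G [mG G0 hG Gint Gball]] :=
  real_majorant S s_gt1 w_ge0 mw Apw W_gt0 nuE nu_int t1 mh h0 I0.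
have L0 : (0 < L)%R.
  by rewrite invr_gt0; exact: (majorant_coef_gt0 (Ap_measure_doubling S s_gt1 w_ge0 mw Apw W_gt0 nuE)).
exists G; split => //.
- by apply: (@filterS2 _ _ (ae_filter_ringOfSetsType mu) _ _ _ _
    (Ap_pos_ae S s_gt1 w_ge0 mw Apw W_gt0) hG) => x.
- apply: (Ap_const_le S) => // x r r0.
  exact: (mul_weight_ball S s_gt1 w_ge0 mw Apw W_gt0 mG G0 L0 Gball x r0).
- move=> a a0; apply: (Ap_const_le S) => [x r r0|].
    exact: (div_weight_ball S s_gt1 w_ge0 mw Apw W_gt0 mG G0 L0 Gball x r0 a0).
  rewrite mulrDl mul1r; apply: (lt_trans s_gt1).
  by rewrite ltrDr mulr_gt0// (lt_trans _ s_gt1).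
Qed.

Section pair.
Variables (r N : R) (phi gam : T -> \bar R).
Hypotheses (r_gt0 : (0 < r)%R) (N_gt0 : (0 < N)%R).
Hypotheses (mphi : measurable_fun setT phi) (mgam : measurable_fun setT gam).
Hypotheses (phi0 : forall x, 0 <= phi x) (gam0 : forall x, 0 <= gam x).
Hypothesis FS : forall v : T -> R, (forall x, (0 <= v x)%R) -> measurable_fun setT v ->
  Ap_const setT rho mu (extrapolation_exponent r s) v <= (extrapolation_weight K C s Kw r)%:E ->
  \int[mu]_x (phi x * (v x)%:E) < +oo ->
  \int[mu]_x (phi x * (v x)%:E) <= N%:E * \int[mu]_x (gam x * (v x)%:E).

Let Phi := \int[mu]_x (phi x `^ r * (w x)%:E).
Let Gam := \int[mu]_x (gam x `^ r * (w x)%:E).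

Let Phi0 : 0 <= Phi.
Proof. by apply: integral_ge0 => x _; rewrite mule_ge0// poweR_ge0. Qed.
Let Gam0 : 0 <= Gam.
Proof. by apply: integral_ge0 => x _; rewrite mule_ge0// poweR_ge0. Qed.

Let mpw (f : T -> \bar R) a : measurable_fun setT f -> measurable_fun setT (fun x => f x `^ a * (w x)%:E).
Proof. by move=> mf; apply: emeasurable_funM => //; exact: mp. Qed.

Hypothesis Phi_fin : Phi < +oo.

(** Duality with h = phi^(r-1) and [t] conjugate to [r]: [Phi] is at most the integral of phi G w,
    hence at most [N] times that of gam G w, hence at most N Gam^(1/r) (2 Phi)^(1 - 1/r). As [Phi]
    is positive and finite, its power is divided out. The same Hölder bound for [phi] gives the
    finiteness that [FS] requires. *)
Let extrapolation_gt1 : (1 < r)%R -> Phi <= (N `^ r * 2 `^ (r - 1))%:E * Gam.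
Proof.
move=> r1; have [->|Phin0] := eqVneq Phi 0.
  by rewrite mule_ge0// lee_fin mulr_ge0// powR_ge0.
have {}Phin0 : 0 < Phi by rewrite lt0e Phin0.
have [->|Gamoo] := eqVneq Gam +oo.
  by rewrite gt0_muley ?leey// lte_fin mulr_gt0 ?powR_gt0.
have Gamf : Gam \is a fin_num by rewrite ge0_fin_numE// ltey.
have Phif : Phi \is a fin_num by rewrite ge0_fin_numE.
have r10 : (0 < r - 1)%R by rewrite subr_gt0.
pose t := (r / (r - 1))%R.
have t1 : (1 < t)%R by rewrite ltr_pdivlMr// mul1r ltrBlDr ltrDl.
pose h x := phi x `^ (r - 1).
have hE : \int[mu]_x (h x `^ t * (w x)%:E) = Phi.
  by apply: eq_integral => x _; rewrite /h -poweRrM /t mulrC divfK// gt_eqF.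
have hI : 0 < \int[mu]_x (h x `^ t * (w x)%:E) < +oo by rewrite hE Phin0.
have [G [[mG G0] hG Gint Gw _]] :=
  Ap_majorant t1 (mp (r - 1) mphi) (fun x => poweR_ge0 _ _) hI.
rewrite hE in Gint.
have th01 : (0 < r^-1 < 1)%R by rewrite invr_gt0 r_gt0 invf_lt1.
have mGt : measurable_fun setT (fun x => (G x `^ t)%:E * (w x)%:E).
  apply: emeasurable_funM => //; apply/measurable_EFinP.
  exact: (measurableT_comp (measurable_powR _)).
have mGw : measurable_fun setT (fun x => (G x * w x)%R) by exact: measurable_funM.
have Gw0 x : (0 <= G x * w x)%R by rewrite mulr_ge0// ltW.
have H u : measurable_fun setT u -> (forall x, 0 <= u x) ->
    \int[mu]_x (u x * (G x * w x)%:E) <=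
    (\int[mu]_x (u x `^ r * (w x)%:E)) `^ r^-1 * (2%:E * Phi) `^ (1 - r^-1).
  move=> mu' u0; apply: (@le_trans _ _ ((\int[mu]_x (u x `^ r * (w x)%:E)) `^ r^-1 *
     (\int[mu]_x ((G x `^ t)%:E * (w x)%:E)) `^ (1 - r^-1))); last first.
    rewrite lee_wpmul2l ?poweR_ge0//; apply: poweR_le => //.
      by case/andP: th01 => _ /ltW; rewrite subr_ge0.
    by apply: integral_ge0 => x _; rewrite mule_ge0// lee_fin powR_ge0.
  apply: le_trans (holder_ereal mu th01 measurableT (mpw r mu') mGt _ _); last 2 first.
  - by move=> x _; rewrite mule_ge0// poweR_ge0.
  - by move=> x _; rewrite mule_ge0// lee_fin powR_ge0.
  apply: ae_ge0_le_integral => //.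
  - by move=> x _; rewrite mule_ge0// lee_fin.
  - by apply: emeasurable_funM => //; exact/measurable_EFinP.
  - by move=> x _; rewrite mule_ge0// poweR_ge0.
  - by apply: emeasurable_funM; apply: mp => //; exact: mpw.
  apply: filterS hG => x [wx _] _; have Gx := G0 x.
  have -> : ((G x `^ t)%:E * (w x)%:E) `^ (1 - r^-1) = (G x * w x `^ (1 - r^-1))%:E.
    rewrite -EFinM poweR_EFin powRM ?powR_ge0// -powRrM.
    have -> : (t * (1 - r^-1) = 1)%R by rewrite /t; field; rewrite !gt_eqF.
    by rewrite powRr1 ?(ltW Gx).
  rewrite poweRM ?poweR_ge0// -poweRrM mulfV ?gt_eqF// poweRe1// poweR_EFin.
  rewrite -muleA -EFinM mulrCA -powRD ?(gt_eqF wx) ?implybT//.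
  by rewrite (_ : (r^-1 + (1 - r^-1) = 1)%R) ?powRr1//; ring.
have Phile : Phi <= \int[mu]_x (phi x * (G x * w x)%:E).
  apply: ae_ge0_le_integral => //.
  - by move=> x _; rewrite mule_ge0// poweR_ge0.
  - exact: mpw.
  - by move=> x _; rewrite mule_ge0// lee_fin.
  - by apply: emeasurable_funM => //; exact/measurable_EFinP.
  apply: filterS hG => x [wx hx] _.
  rewrite EFinM muleA lee_wpmul2r//.
  have -> : phi x `^ r = phi x * phi x `^ (r - 1).
    have [pe|pe] := eqVneq (phi x) +oo.
      by rewrite pe !poweRyr ?gt_eqF// gt0_muley.
    have {}pe : phi x \is a fin_num by rewrite ge0_fin_numE// ltey.
    rewrite -(fineK pe) !poweR_EFin -EFinM mulr_powRB1 ?fine_ge0//.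
  by rewrite lee_wpmul2l.
have fin : \int[mu]_x (phi x * (G x * w x)%:E) < +oo.
  apply: (le_lt_trans (H _ mphi phi0)); rewrite lte_mul_pinfty ?poweR_ge0//.
    by rewrite ge0_fin_numE ?poweR_ge0// poweR_lty.
  by rewrite poweR_lty// lte_mul_pinfty.
have := FS Gw0 mGw; rewrite /extrapolation_exponent /extrapolation_weight.
rewrite ltNge (ltW r1)/= gt_eqF// => /(_ Gw fin) F.
have := le_trans Phile (le_trans F (lee_wpmul2l _ (H _ mgam gam0))).
rewrite lee_fin => /(_ (ltW N_gt0)); rewrite -/Gam.
have pf : (0 < fine Phi)%R by rewrite fine_gt0// Phin0.
have gf : (0 <= fine Gam)%R by rewrite fine_ge0.
rewrite -(fineK Phif) -(fineK Gamf) -!EFinM !lee_fin.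
set P := fine Phi in pf *; set Q := fine Gam in gf *.
rewrite powRM ?(ltW pf)// => {}F.
have {}F : (P `^ r^-1 <= N * Q `^ r^-1 * 2 `^ (1 - r^-1))%R.
  rewrite -(ler_pM2r (powR_gt0 (1 - r^-1) pf)) -powRD ?(gt_eqF pf) ?implybT//.
  rewrite (_ : (r^-1 + (1 - r^-1) = 1)%R); last by ring.
  by rewrite powRr1 ?(ltW pf)// -!mulrA.
have := ge0_ler_powR (ltW r_gt0) _ _ F; rewrite !nnegrE => /(_ (powR_ge0 _ _)) {}F.
have {F}/F : (0 <= N * Q `^ r^-1 * 2 `^ (1 - r^-1))%R.
  by rewrite !mulr_ge0 ?powR_ge0// ltW.
rewrite -powRrM mulVf ?gt_eqF// powRr1 ?(ltW pf)//.
rewrite !powRM ?mulr_ge0 ?powR_ge0 ?(ltW N_gt0)// -!powRrM mulVf ?gt_eqF// powRr1//.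
by rewrite mulrBl mul1r mulVf ?gt_eqF// mulrAC.
Qed.

(** The majorant of M^(r/2) satisfies M <= G^(2/r) a.e., whence gam v <= G^2 w. Hölder's inequality
    for phi^r w = (phi v)^r (G^2 w)^(1-r) gives Phi <= 2 N^r I, and I <= e^r Phi + Gam. *)
Let extrapolation_lt1 : (r < 1)%R -> Phi <= (4 * N `^ r)%:E * Gam.
Proof.
move=> r1; have r10 : (0 < 1 - r)%R by rewrite subr_gt0.
have Nr0 : (0 < N `^ r)%R by rewrite powR_gt0.
have [->|Gamoo] := eqVneq Gam +oo.
  by rewrite gt0_muley ?leey// lte_fin mulr_gt0.
have Gamf : Gam \is a fin_num by rewrite ge0_fin_numE// ltey.
have Phif : Phi \is a fin_num by rewrite ge0_fin_numE.
(* With this choice 2 N^r e^r = 1/2, so [Phi] can be absorbed. *)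
pose e := ((4 * N `^ r)^-1 `^ r^-1)%R.
have e0 : (0 < e)%R by rewrite powR_gt0// invr_gt0 mulr_gt0.
have er : (e `^ r = (4 * N `^ r)^-1)%R.
  by rewrite /e -powRrM mulVf ?gt_eqF// powRr1// invr_ge0 mulr_ge0// ltW.
have er0 : 0 < (e `^ r)%:E by rewrite lte_fin; exact: powR_gt0.
pose M x := maxe (e%:E * phi x) (gam x).
have M0 x : 0 <= M x by rewrite le_max gam0 orbT.
have mM : measurable_fun setT M by apply: measurable_maxe => //; exact: measurable_funeM.
pose h x := M x `^ (r / 2).
pose I := \int[mu]_x (M x `^ r * (w x)%:E).
have I0 : 0 <= I by apply: integral_ge0 => x _; rewrite mule_ge0// poweR_ge0.
have hE : \int[mu]_x (h x `^ 2 * (w x)%:E) = I.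
  by apply: eq_integral => x _; rewrite /h -poweRrM divfK.
have mc : measurable_fun setT (fun x => (e `^ r)%:E * (phi x `^ r * (w x)%:E)).
  by apply: measurable_funeM; exact: mpw.
have epos x : 0 <= (e `^ r)%:E * (phi x `^ r * (w x)%:E).
  by rewrite !mule_ge0// ?poweR_ge0// lee_fin powR_ge0.
have gpos x : 0 <= gam x `^ r * (w x)%:E by rewrite mule_ge0// poweR_ge0.
have Phi_e : \int[mu]_x ((e `^ r)%:E * (phi x `^ r * (w x)%:E)) = (e `^ r)%:E * Phi.
  rewrite ge0_integralZl// ?lee_fin ?powR_ge0//; first exact: mpw.
  by move=> x _; rewrite mule_ge0// poweR_ge0.
have pM x : (e `^ r)%:E * (phi x `^ r * (w x)%:E) <= M x `^ r * (w x)%:E.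
  rewrite muleA lee_wpmul2r// -poweR_EFin -poweRM ?lee_fin ?(ltW e0)//.
  by apply: poweR_le; rewrite ?(ltW r_gt0) ?mule_ge0 ?lee_fin ?(ltW e0)// le_max lexx.
have IePhi : (e `^ r)%:E * Phi <= I.
  rewrite -Phi_e; apply: ge0_le_integral => //; exact: mpw.
have Ile : I <= (e `^ r)%:E * Phi + Gam.
  rewrite -Phi_e -ge0_integralD//; last exact: mpw.
  apply: ge0_le_integral => //.
  - by move=> x _; rewrite mule_ge0// poweR_ge0.
  - exact: mpw.
  - by apply: emeasurable_funD => //; exact: mpw.
  move=> x _; rewrite muleA -ge0_muleDl ?mule_ge0 ?poweR_ge0 ?lee_fin ?powR_ge0//.
  rewrite lee_wpmul2r// -poweR_EFin -poweRM ?lee_fin ?(ltW e0)// /M.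
  by case: (leP (e%:E * phi x) (gam x)) => _; rewrite ?leeDl ?leeDr ?poweR_ge0.
have [IE|In0] := eqVneq I 0.
  have -> : Phi = 0.
    apply/eqP; rewrite eq_le Phi0 andbT -(@lee_pmul2l _ (e `^ r)%:E)//.
    by rewrite mule0 -IE.
  by rewrite mule_ge0// lee_fin mulr_ge0// ltW.
have {}In0 : 0 < I by rewrite lt0e In0.
have Ioo : I < +oo.
  by apply: (le_lt_trans Ile); rewrite lte_add_pinfty ?lte_mul_pinfty ?lee_fin ?powR_ge0// ltey.
have If : I \is a fin_num by rewrite ge0_fin_numE.
have hI : 0 < \int[mu]_x (h x `^ 2 * (w x)%:E) < +oo by rewrite hE In0.
have two1 : (1 < 2 :> R)%R by rewrite ltr1n.
have [G [[mG G0] hG Gint _ Gw]] :=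
  Ap_majorant two1 (mp (r / 2) mM) (fun x => poweR_ge0 _ _) hI.
rewrite hE in Gint.
pose a := (2 * (1 - r) / r)%R.
have a0 : (0 < a)%R by rewrite divr_gt0// mulr_gt0.
pose v x := (G x `^ (- a) * w x)%R.
have v0 x : (0 <= v x)%R by rewrite mulr_ge0// powR_ge0.
have mv : measurable_fun setT v.
  by apply: measurable_funM => //; exact: (measurableT_comp (measurable_powR _)).
have mvE : measurable_fun setT (fun x => (v x)%:E) by exact/measurable_EFinP.
have mG2 : measurable_fun setT (fun x => (G x `^ 2)%:E * (w x)%:E).
  apply: emeasurable_funM => //; apply/measurable_EFinP.
  exact: (measurableT_comp (measurable_powR _)).
have G20 x : 0 <= (G x `^ 2)%:E * (w x)%:E by rewrite mule_ge0// lee_fin powR_ge0.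
have mphiv : measurable_fun setT (fun x => phi x * (v x)%:E) by exact: emeasurable_funM.
have phiv0 x : 0 <= phi x * (v x)%:E by rewrite mule_ge0// lee_fin.
have ra : (r * a = 2 * (1 - r))%R by rewrite /a mulrC divfK// gt_eqF.
have MG : {ae mu, forall x, [/\ (0 < w x)%R, phi x \is a fin_num, gam x \is a fin_num,
    (e * fine (phi x) <= G x `^ (2 / r))%R & (fine (gam x) <= G x `^ (2 / r))%R]}.
  apply: filterS hG => x [wx hx].
  have MH : M x <= (G x `^ (2 / r))%:E.
    have -> : M x = h x `^ (2 / r).
      rewrite /h -poweRrM (_ : (r / 2 * (2 / r) = 1)%R) ?poweRe1//.
      by field; rewrite gt_eqF.
    by rewrite -poweR_EFin; apply: poweR_le; rewrite ?poweR_ge0// divr_ge0// ltW.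
  have eH : e%:E * phi x <= (G x `^ (2 / r))%:E by apply: le_trans MH; rewrite le_max lexx.
  have gH : gam x <= (G x `^ (2 / r))%:E by apply: le_trans MH; rewrite le_max lexx orbT.
  have gf : gam x \is a fin_num by rewrite ge0_fin_numE// (le_lt_trans gH)// ltry.
  have pf : phi x \is a fin_num.
    rewrite ge0_fin_numE// ltey; apply/eqP => E; move: eH.
    by rewrite E gt0_muley ?lte_fin.
  by split => //; rewrite -lee_fin ?EFinM fineK.
(* This is why [phi] is majorized too: G^(-a) is the power -(1 - r) of G^(2/r), hence at most (e
   phi)^(-(1-r)) where [phi] is positive, and [phi * v] is at most a constant times phi^r w. *)
have phiv_fin : \int[mu]_x (phi x * (v x)%:E) < +oo.
  apply: (@le_lt_trans _ _ (\int[mu]_x ((e `^ (r - 1))%:E * (phi x `^ r * (w x)%:E)))).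
    apply: ae_ge0_le_integral => //.
    - by move=> x _; rewrite !mule_ge0 ?poweR_ge0// lee_fin powR_ge0.
    - by apply: measurable_funeM; exact: mpw.
    apply: filterS MG => x [wx pf _ pG _] _; have Gx := G0 x.
    rewrite -(fineK pf) poweR_EFin -!EFinM lee_fin /v !mulrA.
    rewrite ler_wpM2r//; set P := fine _ in pG *.
    have P0 : (0 <= P)%R by rewrite fine_ge0.
    have [->|Pn0] := eqVneq P 0%R; first by rewrite mul0r mulr_ge0 ?powR_ge0.
    have {Pn0}P0 : (0 < P)%R by rewrite lt_neqAle eq_sym Pn0.
    have -> : (G x `^ (- a) = ((G x `^ (2 / r)) `^ (1 - r))^-1)%R.
      by rewrite -powRrM powRN; congr (_ `^ _)^-1%R; rewrite /a; field; rewrite gt_eqF.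
    have -> : (e `^ (r - 1) = (e `^ (1 - r))^-1)%R by rewrite -powRN opprB.
    have e1 : (0 < e `^ (1 - r))%R by exact: powR_gt0.
    rewrite ler_pdivrMr ?powR_gt0// -mulrA ler_pdivlMl//.
    have PE : (P = P `^ r * P `^ (1 - r))%R.
      rewrite -powRD ?(gt_eqF P0) ?implybT//.
      by rewrite (_ : (r + (1 - r) = 1)%R) ?powRr1 ?(ltW P0)//; ring.
    apply: (@le_trans _ _ (e `^ (1 - r) * (P `^ r * P `^ (1 - r)))%R); first by rewrite -PE.
    rewrite mulrCA; apply: ler_wpM2l; first exact: powR_ge0.
    apply: (@le_trans _ _ ((e * P) `^ (1 - r))%R).
      by rewrite [leRHS]powRM ?(ltW P0) ?(ltW e0).
    apply: ge0_ler_powR => //; rewrite ?(ltW r10) ?nnegrE ?powR_ge0//.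
    by rewrite mulr_ge0 ?(ltW P0) ?(ltW e0).
  rewrite ge0_integralZl// ?lee_fin ?powR_ge0//; first last.
  - by move=> x _; rewrite mule_ge0// poweR_ge0.
  - exact: mpw.
  by rewrite lte_mul_pinfty// lee_fin powR_ge0.
have gamv : \int[mu]_x (gam x * (v x)%:E) <= 2%:E * I.
  apply: le_trans Gint; apply: ae_ge0_le_integral => //.
  - by move=> x _; rewrite mule_ge0// lee_fin.
  - exact: emeasurable_funM.
  apply: filterS MG => x [wx _ gf _ gG] _; have Gx := G0 x.
  rewrite -(fineK gf) -!EFinM lee_fin /v mulrA ler_wpM2r//.
  rewrite powRN ler_pdivrMr ?powR_gt0//; apply: (le_trans gG).
  rewrite -powRD ?(gt_eqF Gx) ?implybT// le_eqVlt; apply/orP; left; apply/eqP.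
  by congr (_ `^ _)%R; rewrite /a; field; rewrite gt_eqF.
have F : \int[mu]_x (phi x * (v x)%:E) <= N%:E * (2%:E * I).
  apply: (@le_trans _ _ (N%:E * \int[mu]_x (gam x * (v x)%:E))); last first.
    by rewrite lee_wpmul2l// lee_fin ltW.
  apply: FS => //; rewrite /extrapolation_exponent /extrapolation_weight r1.
  exact: Gw.
have th01 : (0 < r < 1)%R by rewrite r_gt0.
have Phile : Phi <= (N%:E * (2%:E * I)) `^ r * (2%:E * I) `^ (1 - r).
  apply: (@le_trans _ _ ((\int[mu]_x (phi x * (v x)%:E)) `^ r *
     (\int[mu]_x ((G x `^ 2)%:E * (w x)%:E)) `^ (1 - r))); last first.
    apply: lee_pmul; rewrite ?poweR_ge0//.
      by apply: poweR_le; rewrite ?(ltW r_gt0)// integral_ge0.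
    by apply: poweR_le; rewrite ?(ltW r10)// integral_ge0.
  apply: le_trans (holder_ereal mu th01 measurableT mphiv mG2 _ _) => //.
  apply: ae_ge0_le_integral => //.
  - by move=> x _; rewrite mule_ge0// poweR_ge0.
  - exact: mpw.
  - by move=> x _; rewrite mule_ge0// poweR_ge0.
  - by apply: emeasurable_funM; exact: mp.
  apply: filterS MG => x [wx pf _ _ _] _; have Gx := G0 x.
  have -> : ((G x `^ 2)%:E * (w x)%:E) `^ (1 - r) = (G x `^ (r * a) * w x `^ (1 - r))%:E.
    by rewrite -EFinM poweR_EFin powRM ?powR_ge0// -powRrM ra.
  have -> : (phi x * (v x)%:E) `^ r = (fine (phi x) `^ r * (G x `^ (r * a))^-1 * w x `^ r)%:E.
    rewrite -[in LHS](fineK pf) -EFinM poweR_EFin powRM ?fine_ge0 ?v0// /v.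
    by rewrite powRM ?powR_ge0// -powRrM mulNr powRN [(a * r)%R]mulrC mulrA.
  have -> : phi x `^ r = (fine (phi x) `^ r)%:E by rewrite -poweR_EFin fineK.
  rewrite -!EFinM lee_fin.
  have gn : (G x `^ (r * a) != 0)%R by rewrite gt_eqF// powR_gt0.
  rewrite -[in X in (X <= _)%R](powRr1 (w_ge0 x)).
  rewrite [X in (_ * _ `^ X <= _)%R](_ : 1%R = (r + (1 - r))%R); last by ring.
  rewrite powRD ?(gt_eqF wx) ?implybT// le_eqVlt; apply/orP; left; apply/eqP.
  by field.
have {Phile}Phile : Phi <= (2 * N `^ r)%:E * I.
  apply: (le_trans Phile); rewrite -(fineK If) -!EFinM lee_fin.
  set J := fine I.
  have J0 : (0 < J)%R by rewrite fine_gt0// In0.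
  have J20 : (0 < 2 * J)%R by rewrite mulr_gt0.
  rewrite powRM ?(ltW N_gt0) ?(ltW J20)// -mulrA -powRD ?(gt_eqF J20) ?implybT//.
  by rewrite (_ : (r + (1 - r) = 1)%R) ?powRr1 ?(ltW J20)//; [rewrite mulrCA mulrA|ring].
have : Phi <= (2 * N `^ r)%:E * ((e `^ r)%:E * Phi + Gam).
  by apply: (le_trans Phile); rewrite lee_wpmul2l// lee_fin mulr_ge0// ltW.
rewrite -(fineK Phif) -(fineK Gamf); set P := fine Phi; set Q := fine Gam.
rewrite [X in _ <= X -> _](_ : _ = (2 * N `^ r * (e `^ r * P + Q))%:E)//.
rewrite -EFinM !lee_fin er => H.
have HE : (2 * N `^ r * ((4 * N `^ r)^-1 * P + Q) = 2^-1 * P + 2 * N `^ r * Q)%R.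
  by field; rewrite gt_eqF.
rewrite HE in H; lra.
Qed.

Lemma extrapolation : Phi <= (extrapolation_factor r N)%:E * Gam.
Proof.
rewrite /extrapolation_factor; case: ifPn => [|]; first exact: extrapolation_lt1.
rewrite -leNgt le_eqVlt => /orP[/eqP r1|]; last exact: extrapolation_gt1.
rewrite -r1 subrr powRr0 mulr1 powRr1 ?(ltW N_gt0)//.
have phiE : Phi = \int[mu]_x (phi x * (w x)%:E).
  by apply: eq_integral => x _; rewrite -r1 poweRe1.
have gamE : Gam = \int[mu]_x (gam x * (w x)%:E).
  by apply: eq_integral => x _; rewrite -r1 poweRe1.
rewrite phiE gamE; apply: FS => //; last by rewrite -phiE.
by rewrite /extrapolation_exponent /extrapolation_weight -r1 ltxx eqxx.
Qed.

End pair.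
End extrapolation.

(** * Sets and functions measurable for the completed measure *)

Section completion.
Context d (T : measurableType d) (R : realType).
Variable m : {measure set T -> \bar R}.
Local Open Scope ereal_scope.
Local Notation mext := ((m : set T -> \bar R)^*)%mu.
Local Notation cT := (caratheodory_type mext).
Local Notation cm := (@completed_measure_extension _ _ _ m).

Lemma completion_measurable (A : set T) : measurable A -> measurable (A : set cT).
Proof. exact: caratheodory_measurable_mu_ext. Qed.

Lemma completionE (A : set T) : measurable A -> cm A = m A.
Proof. exact: measurable_mu_extE. Qed.

Lemma completion_fun d' (U : measurableType d') (D : set T) (f : T -> U) :
  measurable D -> measurable_fun D f -> measurable_fun (D : set cT) (f : cT -> U).
Proof. by move=> mD mf _ B mB; apply: completion_measurable; exact: mf. Qed.

Lemma measurable_hull (E : set T) : mext E < +oo ->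
  exists F, [/\ measurable F, E `<=` F & m F = mext E].
Proof.
move=> Efin.
have Ef : mext E \is a fin_num by rewrite ge0_fin_numE// mu_ext_ge0.
have cov n : exists F, [/\ measurable F, E `<=` F & m F <= mext E + n.+1%:R^-1%:E].
  have n0 : (0 < n.+1%:R^-1 :> R)%R by rewrite invr_gt0.
  have [_ [A [mA EA] <-] HA] := lb_ereal_inf_adherent n0 Ef.
  exists (\bigcup_k A k); split => //; first exact: bigcupT_measurable.
  apply: le_trans (ltW HA); apply: measure_sigma_subadditive => //.
  exact: bigcupT_measurable.
pose F n := projT1 (cid (cov n)).
have HF n : [/\ measurable (F n), E `<=` F n & m (F n) <= mext E + n.+1%:R^-1%:E].
  by rewrite /F; case: cid.
have mF : measurable (\bigcap_n F n) by apply: bigcapT_measurable => n; case: (HF n).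
have EF : E `<=` \bigcap_n F n by move=> x Ex n _; case: (HF n) => _ H _; exact: H.
exists (\bigcap_n F n); split => //.
apply/eqP; rewrite eq_le; apply/andP; split; last first.
  by rewrite -measurable_mu_extE//; exact: le_mu_ext.
apply/lee_addgt0Pr => e e0; have [n ne] : exists n, (n.+1%:R^-1 < e)%R.
  have [n _ /(_ n (leqnn n))] := near_infty_natSinv_lt (PosNum e0).
  by exists n.
have [mFn _ H] := HF n.
apply: (@le_trans _ _ (m (F n))).
  by apply: le_measure; rewrite ?inE//; exact: bigcap_inf.
by apply: (le_trans H); rewrite leeD2l// lee_fin ltW.
Qed.

Hypothesis sf : sigma_finite setT m.

(** On a piece of finite measure the hull of [E] exceeds [E] by a set of outer measure zero, by
    Caratheodory's splitting; the hull of this excess is the exceptional set. *)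
Lemma completion_ae_measurable (E : set cT) : measurable E ->
  exists A N : set T, [/\ measurable A, measurable N, m N = 0 & E `\` N = A `\` N].
Proof.
move=> mE; have /sigma_finiteP[S [ST _ mS]] := sf.
have loc n : exists AN : set T * set T,
    [/\ measurable AN.1, measurable AN.2, m AN.2 = 0 & (E `&` S n) `\` AN.2 = AN.1 `\` AN.2].
  have [mSn Soo] := mS n.
  have Soo' : mext (S n) < +oo by rewrite measurable_mu_extE.
  have Eoo : mext (E `&` S n) < +oo.
    by apply: le_lt_trans Soo'; apply: le_mu_ext; exact: subIsetr.
  have [F [mF EF FE]] := measurable_hull Eoo.
  have mEn : measurable (E `&` S n : set cT).
    by apply: measurableI => //; exact: completion_measurable.
  have D0 : mext (F `\` (E `&` S n)) = 0.
    have Ef : mext (E `&` S n) \is a fin_num by rewrite ge0_fin_numE// mu_ext_ge0.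
    have Fe : mext F = mext (E `&` S n) by rewrite -FE; exact: measurable_mu_extE.
    have : mext F = mext (F `&` (E `&` S n)) + mext (F `&` ~` (E `&` S n)) by exact: mEn.
    rewrite (setIidr EF) Fe.
    case: (mext (E `&` S n)) Ef => // a _; rewrite -setDE.
    by case: (mext _) => //= b [] /eqP; rewrite -subr_eq0 opprD addrA subrr sub0r oppr_eq0 => /eqP ->.
  have [|F' [mF' DF' F'0]] := @measurable_hull (F `\` (E `&` S n)); first by rewrite D0.
  exists (F, F'); split => //=; first by rewrite F'0.
  apply/seteqP; split => x [Ex nx]; split => //; first exact: EF.
  by apply: contrapT => nE; apply: nx; apply: DF'.
pose A n := (projT1 (cid (loc n))).1; pose N n := (projT1 (cid (loc n))).2.
have H n : [/\ measurable (A n), measurable (N n), m (N n) = 0 &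
    (E `&` S n) `\` N n = A n `\` N n] by rewrite /A /N; case: cid.
have mA n : measurable (A n) by case: (H n).
have mN n : measurable (N n) by case: (H n).
exists (\bigcup_n A n), (\bigcup_n N n); split.
- exact: bigcupT_measurable.
- exact: bigcupT_measurable.
- apply/eqP; rewrite eq_le measure_ge0 andbT.
  have U0 : m (\bigcup_n N n) <= \sum_(n <oo) m (N n).
    by apply: measure_sigma_subadditive => //; exact: bigcupT_measurable.
  apply: (le_trans U0).
  by rewrite eseries0// => n _ _; case: (H n).
apply/seteqP; split => x [].
  move=> Ex nN; split => //; have : [set: T] x by [].
  rewrite ST => -[n _ Sx]; exists n => //.
  have [_ _ _ EA] := H n.
  have : (A n `\` N n) x by rewrite -EA; split => // Nx; apply: nN; exists n.
  by case.
move=> [n _ Ax] nN; split => //; have [_ _ _ EA] := H n.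
have : ((E `&` S n) `\` N n) x by rewrite EA; split => // Nx; apply: nN; exists n.
by case=> -[].
Qed.

(** The previous lemma is applied to the superlevel sets at rational levels. Off the union of their
    exceptional sets [f] is measurable for the original sigma-algebra; on that union it is replaced
    by 0. *)
Lemma completion_ae_fun (f : cT -> \bar R) : measurable_fun setT f -> (forall x, 0 <= f x) ->
  exists f0 : T -> \bar R, exists N : set T, [/\ measurable_fun setT f0,
    forall x, 0 <= f0 x, measurable N, m N = 0 & forall x, ~ N x -> f x = f0 x].
Proof.
move=> mf f0.
pose q n : R := ratr (odflt 0%R (unpickle n : option rat)).
have mE n : measurable ([set x | (q n)%:E < f x] : set cT).
  by rewrite -[X in measurable X]setTI; exact: emeasurable_fun_o_infty.
pose A n := projT1 (cid (completion_ae_measurable (mE n))).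
pose Nc n := cid (projT2 (cid (completion_ae_measurable (mE n)))).
pose N_ n := projT1 (Nc n).
have H n : [/\ measurable (A n), measurable (N_ n), m (N_ n) = 0 &
    [set x | (q n)%:E < f x] `\` N_ n = A n `\` N_ n] by exact: projT2 (Nc n).
have mA n : measurable (A n) by case: (H n).
have mN_ n : measurable (N_ n) by case: (H n).
pose N := \bigcup_n N_ n.
have mN : measurable N by exact: bigcupT_measurable.
exists (fun x => if x \in N then 0 else f x), N; split => //.
- apply: (measurability _ (ErealGenOInfty.measurableE R)) => // _ [_ [a ->] <-].
  rewrite setTI; have [a0|a0] := ltP a 0%R.
    rewrite (_ : _ @^-1` _ = setT)//; apply/seteqP; split => // x _ /=.
    by rewrite in_itv/= andbT; case: ifPn => _; [|apply: lt_le_trans (f0 x)]; rewrite lte_fin.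
  rewrite (_ : _ @^-1` _ = (\bigcup_(n in [set n | (a <= q n)%R]) A n) `\` N).
    by apply: measurableD => //; apply: bigcup_measurable => n _; exact: mA.
  apply/seteqP; split => x /=; rewrite in_itv/= andbT; case: ifPn => // xN.
  + by rewrite lte_fin ltNge a0.
  + move=> ax; move: xN; rewrite notin_setE => xN; split => //.
    have [r /andP[ar rf]] : exists r : rat, (a < ratr r)%R && ((ratr r)%:E < f x).
      have [b ab bf] : exists2 b, (a < b)%R & b%:E <= f x.
        case: (f x) ax => [b ab||]//; first by exists b.
        by exists (a + 1)%R; rewrite ?leey// ltrDl.
      have [r] := rat_in_itvoo ab; rewrite in_itv/= => /andP[ar rb].
      by exists r; rewrite ar/=; apply: lt_le_trans bf; rewrite lte_fin.
    have qr : q (pickle r) = ratr r by rewrite /q pickleK.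
    exists (pickle r); first by rewrite /= qr ltW.
    have [_ _ _ HE] := H (pickle r).
    suff : (A (pickle r) `\` N_ (pickle r)) x by case.
    by rewrite -HE; split; [rewrite /= qr|move=> Nx; apply: xN; exists (pickle r)].
  + by move=> [_]; rewrite inE in xN.
  + move=> [[n /= an Ax] nN]; have [_ _ _ HE] := H n.
    have : ([set x | (q n)%:E < f x] `\` N_ n) x.
      by rewrite HE; split => // Nx; apply: nN; exists n.
    by case=> /= qf _; apply: le_lt_trans qf; rewrite lee_fin.
- by move=> x; case: ifPn.
- apply/eqP; rewrite eq_le measure_ge0 andbT.
  have U0 : m N <= \sum_(n <oo) m (N_ n) by exact: measure_sigma_subadditive.
  apply: (le_trans U0).
  by rewrite eseries0// => n _ _; case: (H n).
- by move=> x nN; rewrite memNset.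
Qed.

Lemma completion_integral (f : T -> \bar R) : measurable_fun setT f -> (forall x, 0 <= f x) ->
  \int[cm]_x f x = \int[m]_x f x.
Proof.
move=> mf f0.
have mid : measurable_fun setT (fun x : cT => x : T).
  by apply: completion_fun.
transitivity (\int[pushforward cm (fun x : cT => x : T)]_x f x).
  by rewrite (ge0_integral_pushforward mid)// => x _.
by apply: eq_measure_integral => A mA _; exact: completionE.
Qed.

Lemma completion_integral_ae (f : cT -> \bar R) (f0 : T -> \bar R) (N : set T) :
  measurable_fun setT f -> (forall x, 0 <= f x) ->
  measurable_fun setT f0 -> (forall x, 0 <= f0 x) ->
  measurable N -> m N = 0 -> (forall x, ~ N x -> f x = f0 x) ->
  \int[cm]_x f x = \int[m]_x f0 x.
Proof.
move=> mf f_0 mf0 f00 mN N0 H; rewrite -completion_integral//.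
apply: ge0_ae_eq_integral => //; first exact: completion_fun.
exists N; split; [exact: completion_measurable|by rewrite -N0; exact: completionE|].
by move=> x /= nx; apply: contrapT => /H fx; apply: nx.
Qed.

End completion.

(** * Tonelli's theorem on the completed product *)

Section completed_product.
Context d1 d2 (T1 : measurableType d1) (T2 : measurableType d2) (R : realType).
Variables (mu1 : {sigma_finite_measure set T1 -> \bar R})
          (mu2 : {sigma_finite_measure set T2 -> \bar R}).
Local Open Scope ereal_scope.
Local Notation cT := (cprod mu1 mu2).
Local Notation cmu := (cprod_measure mu1 mu2).

Let m : {measure set (T1 * T2)%type -> \bar R} := (mu1 \x mu2)%E.

Lemma product_sigma_finite : sigma_finite setT m.
Proof.
have /sigma_finiteP[F [FT ndF Foo]] := sigma_finiteT mu1.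
have /sigma_finiteP[G [GT ndG Goo]] := sigma_finiteT mu2.
exists (fun n => F n `*` G n) => [|k].
  rewrite -setXTT FT GT; apply/seteqP; split => [[x y] /= [[n _ Fx] [k _ Gy]]|[x y] [n _ [/= Fx Gy]]].
    exists (maxn n k) => //; split => /=.
      by have /subsetPset := ndF _ _ (leq_maxl n k); exact.
    by have /subsetPset := ndG _ _ (leq_maxr n k); exact.
  by split; exists n.
have [mF Fk] := Foo k; have [mG Gk] := Goo k.
split; first exact: measurableX.
by rewrite [ltLHS]product_measure1E// lte_mul_pinfty// ge0_fin_numE.
Qed.

Lemma cprod_measurable_fst : measurable_fun setT (fun z : cT => z.1).
Proof. exact: (@completion_fun _ _ _ m _ _ setT fst measurableT measurable_fst). Qed.

Lemma cprod_measurable_snd : measurable_fun setT (fun z : cT => z.2).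
Proof. exact: (@completion_fun _ _ _ m _ _ setT snd measurableT measurable_snd). Qed.

Lemma null_ysection (N : set (T1 * T2)%type) : measurable N -> m N = 0 ->
  {ae mu2, forall y, mu1 (ysection N y) = 0}.
Proof.
move=> mN N0.
have mI : measurable_fun setT (EFin \o (\1_N : (T1 * T2)%type -> R)).
  by apply/measurable_EFinP.
have I0 z : 0 <= (EFin \o (\1_N : (T1 * T2)%type -> R)) z by rewrite lee_fin.
have H := fubini_tonelli2 (m1 := mu1) (m2 := mu2) _ mI I0.
have mG := measurable_fun_fubini_tonelli_G (m1 := mu1) _ mI I0.
have E : \int[mu2]_y fubini_G mu1 (EFin \o (\1_N : (T1 * T2)%type -> R)) y = 0.
  by rewrite -H integral_indic// setIT.
have G0 y : setT y -> 0 <= fubini_G mu1 (EFin \o (\1_N : (T1 * T2)%type -> R)) y.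
  by move=> _; apply: integral_ge0.
have := integral_eq0_ae measurableT mG G0 E.
apply: filterS => y /(_ I) /= <-.
rewrite /fubini_G /= -[X in mu1 X]setIT -integral_indic//; last exact: measurable_ysection.
by apply: eq_integral => x _; rewrite /= !indicE mem_ysection.
Qed.

Hypotheses (c1 : measure_is_complete mu1) (c2 : measure_is_complete mu2).

(** Off a product-null set [f] is a function to which Tonelli's theorem applies, and almost every
    section of that set is null. Completeness of [mu1] makes almost every slice of [f] measurable;
    completeness of [mu2] makes the inner integral measurable. *)
Lemma fubini_completed (f : cT -> \bar R) : measurable_fun setT f -> (forall z, 0 <= f z) ->
  [/\ {ae mu2, forall y, measurable_fun setT (fun x => f (x, y))},
      measurable_fun setT (fun y => \int[mu1]_x f (x, y)) &
      \int[cmu]_z f z = \int[mu2]_y \int[mu1]_x f (x, y)].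
Proof.
move=> mf f_0; have [f0 [N [mf0 f00 mN N0 H]]] := @completion_ae_fun _ _ _ m product_sigma_finite f mf f_0.
have ms y : measurable_fun setT (fun x => f0 (x, y)).
  by apply: (measurableT_comp mf0); apply: measurable_fun_pair.
have ae1 : {ae mu2, forall y, ae_eq mu1 setT (fun x => f0 (x, y)) (fun x => f (x, y))}.
  apply: filterS (null_ysection mN N0) => y Ny.
  exists (ysection N y); split => //; first exact: measurable_ysection.
  move=> x /= nx; rewrite /ysection/= inE; apply: contrapT => /H fx; apply: nx.
  by rewrite fx.
have mfy : {ae mu2, forall y, measurable_fun setT (fun x => f (x, y))}.
  by apply: filterS ae1 => y Hy; apply: (ae_measurable_fun c1 Hy).
have mG : measurable_fun setT (fun y => \int[mu1]_x f0 (x, y)).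
  exact: (measurable_fun_fubini_tonelli_G (m1 := mu1) _ mf0 f00).
have Gae : ae_eq mu2 setT (fun y => \int[mu1]_x f0 (x, y)) (fun y => \int[mu1]_x f (x, y)).
  apply: (@filterS2 _ _ (ae_filter_ringOfSetsType mu2) _ _ _ _ ae1 mfy) => y Hy my _.
  exact: ge0_ae_eq_integral.
have mG' := ae_measurable_fun c2 Gae mG.
split => //.
rewrite (_ : \int[cmu]_z f z = \int[m]_z f0 z); last first.
  exact: (@completion_integral_ae _ _ _ m f f0 N).
rewrite (fubini_tonelli2 (m1 := mu1) (m2 := mu2) _ mf0 f00).
apply: ge0_ae_eq_integral => // y _; exact: integral_ge0.
Qed.

End completed_product.

(** * Mixed norms and weighted integrals through slices *)

Section slices.
Context d1 d2 (T1 : measurableType d1) (T2 : measurableType d2) (R : realType).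
Variables (mu1 : {sigma_finite_measure set T1 -> \bar R})
          (mu2 : {sigma_finite_measure set T2 -> \bar R}).
Local Open Scope ereal_scope.
Local Notation cT := (cprod mu1 mu2).
Local Notation cmu := (cprod_measure mu1 mu2).
Variables (X : set cT) (p : R) (w1 : T1 -> R) (v : T2 -> R).
Hypotheses (mX : measurable X) (c1 : measure_is_complete mu1) (c2 : measure_is_complete mu2).
Hypotheses (w1_ge0 : forall x, (0 <= w1 x)%R) (mw1 : measurable_fun setT w1).

Definition slice_integral (h : cT -> R) (y : T2) : \bar R :=
  \int[mu1]_x (`|h (x, y)| `^ p * \1_X (x, y) * w1 x)%:E.

Let F (h : cT -> R) (z : cT) : \bar R := (`|h z| `^ p * \1_X z * w1 z.1)%:E.

Let mfst d' (U : measurableType d') (u : T1 -> U) : measurable_fun setT u ->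
  measurable_fun setT (fun z : cT => u z.1).
Proof. by move=> mu; apply: measurableT_comp mu _; exact: cprod_measurable_fst. Qed.

Let msnd d' (U : measurableType d') (u : T2 -> U) : measurable_fun setT u ->
  measurable_fun setT (fun z : cT => u z.2).
Proof. by move=> mu; apply: measurableT_comp mu _; exact: cprod_measurable_snd. Qed.

Let F_ge0 h z : 0 <= F h z.
Proof. by rewrite lee_fin !mulr_ge0// powR_ge0. Qed.

Let mF (h : cT -> R) : measurable_fun X h -> measurable_fun setT (F h).
Proof.
move=> mh; apply/measurable_EFinP; apply: measurable_funM; last first.
  exact: mfst.
have m1 : measurable_fun setT ((fun z => `|h z| `^ p)%R \_ X).
  apply/(measurable_restrictT _ mX).
  apply: (measurableT_comp (measurable_powR _)).
  exact: measurableT_comp.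
apply: eq_measurable_fun m1 => z _; rewrite /patch indicE.
by case: ifPn => zX; rewrite ?mulr1 ?mulr0.
Qed.

Lemma slice_integral_ge0 h y : 0 <= slice_integral h y.
Proof. by apply: integral_ge0 => x _; exact: (F_ge0 h (x, y)). Qed.

Lemma measurable_slice_integral h : measurable_fun X h ->
  measurable_fun setT (slice_integral h).
Proof. by move=> mh; case: (fubini_completed c1 c2 (mF mh) (F_ge0 h)). Qed.

Hypotheses (v_ge0 : forall y, (0 <= v y)%R) (mv : measurable_fun setT v).

Lemma measurable_prod_weight : measurable_fun setT (prod_weight w1 v : cT -> R).
Proof.
apply: measurable_funM.
  exact: mfst.
exact: msnd.
Qed.

(** This turns the one-weight inequality for [prod_weight w1 v] into one in the second variable
    only. The factor [v] leaves the inner integral for almost every [y], namely when the slice is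
    measurable. *)
Lemma integral_slices (h : cT -> R) : measurable_fun X h ->
  \int[cmu]_(z in X) ((`|h z| `^ p)%:E * (prod_weight w1 v z)%:E) =
  \int[mu2]_y (slice_integral h y * (v y)%:E).
Proof.
move=> mh; have [mFy mG _] := fubini_completed c1 c2 (mF mh) (F_ge0 h).
have mvE : measurable_fun setT (fun z : cT => (v z.2)%:E).
  by apply/measurable_EFinP; exact: msnd.
have v0 (z : cT) : 0 <= (v z.2)%:E by rewrite lee_fin.
have Fv0 z : 0 <= F h z * (v z.2)%:E by rewrite mule_ge0.
have mFv : measurable_fun setT (fun z => F h z * (v z.2)%:E).
  by apply: emeasurable_funM => //; exact: mF.
have [_ mG' E] := fubini_completed c1 c2 mFv Fv0.
rewrite integral_mkcond.
transitivity (\int[cmu]_z (F h z * (v z.2)%:E)).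
  apply: eq_integral => z _; rewrite /patch /F indicE.
  case: ifPn => zX; rewrite ?mulr0 ?mul0r ?mul0e// mulr1 /prod_weight -!EFinM.
  by congr EFin; rewrite mulrA.
rewrite E; apply: ge0_ae_eq_integral => //.
- apply: emeasurable_funM; first exact: measurable_slice_integral.
  exact/measurable_EFinP.
- by move=> y _; apply: integral_ge0.
- by move=> y _; rewrite mule_ge0 ?slice_integral_ge0// lee_fin.
apply: filterS mFy => y my _ /=.
by rewrite ge0_integralZr// lee_fin.
Qed.

End slices.

(** * Oscillation over cubes in terms of extended integrals *)

Section cube_averages.
Context d (T : measurableType d) (R : realType).
Variables (X : set T) (rho : T -> T -> R) (mu : {measure set T -> \bar R}).
Variables (K C delta eps0 N0 : R) (I : int -> Type) (Q : forall n, I n -> set T).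
Hypotheses (S : doubling_space X rho mu K C) (delta01 : 0 < delta < 1) (eps0_gt0 : 0 < eps0).
Hypothesis df : dyadic_filtration X rho mu delta eps0 N0 Q.

Lemma qball_measurable x (r : \bar R) : X x -> (0 < r)%E -> measurable (qball X rho x r).
Proof.
case: r => [r||]// Xx r0; first exact: (ball_measurable S).
rewrite (_ : qball _ _ _ _ = X); first exact: (space_measurable S).
by apply/seteqP; split => [y []//|y Xy]; split => //; rewrite ltry.
Qed.

Lemma avg_integrable P h : measurable P -> (0 < mu P < +oo)%E ->
  mu.-integrable P (EFin \o h) -> (\int[mu]_(x in P) (h x)%:E = (avg mu P h)%:E * mu P)%E.
Proof.
move=> mP /andP[P0 Poo] ih; have Pf : mu P \is a fin_num by rewrite gt0_fin_numE.
rewrite /avg /Rintegral -[X in (_ * X)%E](fineK Pf) -EFinM mulrAC mulVf ?mul1r; last first.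
  by rewrite gt_eqF// fine_gt0// P0.
by rewrite fineK//; exact: integrable_fin_num.
Qed.

(** Integrability on the cube makes the real integrals behind [avg] agree with the extended ones, so
    averages can be multiplied out by [mu P], which is positive and finite. *)
Lemma cube_oscillation (f g : T -> R) (K3 : R) :
  (forall (n : int) (a : I n), exists fQ : T -> R,
     [/\ mu.-integrable (@Q n a) (EFin \o fQ),
         forall x, @Q n a x -> `|f x| <= fQ x <= K3 * `|f x| &
         forall y, @Q n a y ->
           avg mu (@Q n a) (fun x => `|fQ x - avg mu (@Q n a) fQ|) <= g y]) ->
  forall n P, cubes Q n P -> exists (fP : T -> R) (m : R),
    [/\ measurable_fun P fP, forall x, P x -> `|f x| <= fP x <= K3 * `|f x|,
        (\int[mu]_(x in P) (fP x)%:E = m%:E * mu P)%E &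
        forall y, P y -> (\int[mu]_(x in P) `|fP x - m|%:E <= (g y)%:E * mu P)%E].
Proof.
move=> H n P nP; have mP := cubes_measurable S df nP.
have P0 : (0 < mu P < +oo)%E.
  by rewrite (cubes_gt0 S delta01 eps0_gt0 df nP) (cubes_fin S delta01 eps0_gt0 df nP).
case: nP => a PE; have [fQ] := H n a; rewrite PE => -[iQ fQf osc].
exists fQ, (avg mu P fQ); split => //.
- by apply/measurable_EFinP; exact: measurable_int iQ.
- exact: avg_integrable.
move=> y Py; rewrite (_ : (\int[mu]_(x in P) _)%E =
    ((avg mu P (fun x => `|fQ x - avg mu P fQ|))%:E * mu P)%E); last first.
  apply: avg_integrable => //.
  have ic : mu.-integrable P (EFin \o cst (avg mu P fQ)).
    apply/integrableP; split; first exact/measurable_EFinP.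
    rewrite (_ : (\int[mu]_(x in P) _)%E = (\int[mu]_(x in P) (cst `|avg mu P fQ|%:E x))%E)//.
    by rewrite integral_cst// lte_mul_pinfty ?lee_fin//; case/andP: P0.
  have := integrable_abse (integrableB mP iQ ic).
  by apply: eq_integrable.
by rewrite lee_wpmul2r// lee_fin osc.
Qed.

End cube_averages.

(** * Choice of constants and assembly *)

Lemma exists_expn_small (R : realType) (c b : R) : 0 <= c < 1 -> 0 <= b ->
  exists n, forall k, (n < k)%N -> c ^+ k * b <= 2^-1.
Proof.
move=> /andP[c0 c1] b0; have b1 : 0 < b + 1 by rewrite ltr_wpDl.
have e0 : 0 < (2 * (b + 1))^-1 by rewrite invr_gt0 mulr_gt0.
have cn : `|c| < 1 by rewrite ger0_norm.
have := cvg_expr cn => /cvgr0_norm_lt /(_ _ e0) [n _ Hn].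
exists n => k nk; have := Hn k (ltnW nk); rewrite /= ger0_norm ?exprn_ge0// => H.
apply: (@le_trans _ _ ((2 * (b + 1))^-1 * (b + 1))).
  by apply: ler_pM; rewrite ?exprn_ge0// ?(ltW H)// lerDl.
by rewrite invfM mulfVK// gt_eqF.
Qed.

Lemma extrapolation_factor_gt0 (R : realType) (r N : R) : 0 < N -> 0 < extrapolation_factor r N.
Proof.
by move=> N0; rewrite /extrapolation_factor; case: ifP => _; rewrite mulr_gt0// powR_gt0.
Qed.

Lemma extrapolation_exponent_gt1 (R : realType) (r s : R) : 0 < r -> 1 < s ->
  1 < extrapolation_exponent r s.
Proof.
move=> r0 s1; rewrite /extrapolation_exponent; case: ifP => // r1.
apply: (lt_le_trans s1); rewrite ler_peMl ?(le_trans ler01 (ltW s1))// lerDr.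
by rewrite divr_ge0 ?mulr_ge0 ?subr_ge0 ?ltW.
Qed.

Unset Implicit Arguments.
Set Strict Implicit.
Set Printing Implicit Defensive.

Theorem corollary2p8 (R : realType)
    (K1 K2 delta eps0 N0 : R) (Phi : R -> R -> R) (p q p' q' K0 : R)
    (delta01 : 0 < delta < 1) (eps0_gt0 : 0 < eps0)
    (p_gt1 : 1 < p) (q_gt1 : 1 < q) (p'_gt1 : 1 < p') (q'_gt1 : 1 < q')
    (K0_ge1 : 1 <= K0) :
  exists2 eps : R, 0 < eps & forall K3 : R, 0 < K3 ->
  exists2 N : R, 0 < N &
  forall (d1 d2 : measure_display)
    (T1 : measurableType d1) (T2 : measurableType d2)
    (mu1 : {sigma_finite_measure set T1 -> \bar R})
    (mu2 : {sigma_finite_measure set T2 -> \bar R})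
    (rho1 : T1 -> T1 -> R) (rho2 : T2 -> T2 -> R)
    (X : set (cprod mu1 mu2)),
  let mu := cprod_measure mu1 mu2 in
  let rho := prod_rho (mu1 := mu1) (mu2 := mu2) rho1 rho2 in
  homogeneous_type setT rho1 mu1 K1 K2 ->
  homogeneous_type setT rho2 mu2 K1 K2 ->
  homogeneous_type X rho mu K1 K2 ->
  prod_weights_Ap rho1 rho2 X Phi ->
  forall (I : int -> Type) (Q : forall n, I n -> set (cprod mu1 mu2)),
  dyadic_filtration X rho mu delta eps0 N0 Q ->
  forall (w1 : T1 -> R) (w2 : T2 -> R),
  is_Ap setT rho1 mu1 p' w1 -> is_Ap setT rho2 mu2 q' w2 ->
  (Ap_const setT rho1 mu1 p' w1 <= K0%:E)%E ->
  (Ap_const setT rho2 mu2 q' w2 <= K0%:E)%E ->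
  forall f g : cprod mu1 mu2 -> R,
  in_Lpq X p q w1 w2 f -> in_Lpq X p q w1 w2 g ->
  (mu X = +oo%E \/
   exists (r0 : \bar R) (x0 : cprod mu1 mu2),
     [/\ (0 < r0)%E, X x0,
         [set x | X x /\ f x != 0] `<=` qball X rho x0 r0 &
         (mu (qball X rho x0 r0) <= eps%:E * mu X)%E]) ->
  (forall (n : int) (a : I n), exists fQ : cprod mu1 mu2 -> R,
     [/\ mu.-integrable (Q n a) (EFin \o fQ),
         forall x, Q n a x -> `|f x| <= fQ x <= K3 * `|f x| &
         forall y, Q n a y ->
           avg mu (Q n a) (fun x => `|fQ x - avg mu (Q n a) fQ|) <= g y]) ->
  (mixed_norm X p q w1 w2 f <= N%:E * mixed_norm X p q w1 w2 g)%E.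

Proof.
pose K := Num.max K1 1; pose C := Num.max K2 1.
have C1 : 1 <= C by rewrite le_max lexx orbT.
have cr1 L : 1 <= cube_ratio K C eps0 N0 L by rewrite exprn_ege1.
(* The threshold of [components_size]; it depends only on the geometry of the cubes and can be fixed
   before [K3]. *)
exists (4 * cube_ratio K C eps0 N0 1)^-1.
  by rewrite invr_gt0 mulr_gt0// (lt_le_trans ltr01).
move=> K3 K3_gt0.
have p0 : 0 < p by exact: lt_trans p_gt1.
have q0 : 0 < q by exact: lt_trans q_gt1.
pose r := q / p; have r0 : 0 < r by rewrite divr_gt0.
pose S0 := extrapolation_exponent r q'.
have S01 : 1 < S0 by exact: extrapolation_exponent_gt1.
(* [S0] serves every weight produced by the extrapolation; the maximum with [p'] is admissible in
   both variables. *)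
pose S := Num.max p' S0.
have S1 : 1 < S by rewrite lt_max p'_gt1.
pose Kv := extrapolation_weight K C q' K0 r.
(* [Kw] bounds the [A_S] constants on [X] of all the product weights at once, so [n0] and [N1] are
   chosen before the spaces and the weights. *)
pose Km := Num.max K0 Kv; pose Kw := Phi S Km.
pose wr := weight_ratio K C eps0 N0 S Kw.
have wr1 : 1 < wr by exact: weight_ratio_gt1.
have [n0 Hn0] : exists n, forall k, (n < k)%N -> (1 - wr^-1) ^+ k * (K3 + 2) `^ p <= 2^-1.
  apply: exists_expn_small; last exact: powR_ge0.
  have wr0 : 0 < wr by exact: lt_trans wr1.
  by rewrite subr_ge0 invf_le1// (ltW wr1)/= ltrBlDr ltrDl invr_gt0.
pose N1 := local_const (parent_ratio K C delta eps0 N0) K3 p n0 * (8 `^ p + 1).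
have N10 : 0 < N1.
  apply: mulr_gt0; last by rewrite ltr_wpDl// powR_ge0.
  by apply: local_const_gt0 => //; exact: cr1.
pose N2 := extrapolation_factor r N1.
have N20 : 0 < N2 by exact: extrapolation_factor_gt0.
(* Extrapolation compares q-th powers of the mixed norms. *)
exists (N2 `^ q^-1); first exact: powR_gt0.
move=> d1 d2 T1 T2 mu1 mu2 rho1 rho2 X mu rho H1 H2 HX HA I Q df w1 w2.
move=> [w10 mw1 _] [w20 mw2 _] Aw1 Aw2 f g [mf Lf] [mg Lg] supp osc.
have comp1 : measure_is_complete mu1 by move=> A; exact: (ht_complete H1).
have comp2 : measure_is_complete mu2 by move=> A; exact: (ht_complete H2).
have D1 := homogeneous_doubling H1.
have D2 := homogeneous_doubling H2.
have DX := homogeneous_doubling HX.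
have mX := space_measurable DX.
have {}w10 x : 0 <= w1 x by exact: w10.
have {}w20 x : 0 <= w2 x by exact: w20.
pose phi := slice_integral X p w1 f; pose gam := slice_integral X p w1 g.
have mphi : measurable_fun setT phi by exact: measurable_slice_integral.
have mgam : measurable_fun setT gam by exact: measurable_slice_integral.
have phi0 y : (0 <= phi y)%E by exact: slice_integral_ge0.
have gam0 y : (0 <= gam y)%E by exact: slice_integral_ge0.
have FS (v : T2 -> R) : (forall x, 0 <= v x) -> measurable_fun setT v ->
    (Ap_const setT rho2 mu2 S0 v <= Kv%:E)%E ->
    (\int[mu2]_x (phi x * (v x)%:E) < +oo)%E ->
    (\int[mu2]_x (phi x * (v x)%:E) <= N1%:E * \int[mu2]_x (gam x * (v x)%:E))%E.
  move=> v0 mv Av phiv.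
  have A1 : (Ap_const setT rho1 mu1 S w1 <= Km%:E)%E.
    apply: (@Ap_mono _ _ _ _ _ _ _ _ p' S Km w1 D1) => //; first by rewrite le_max lexx.
    by apply: (le_trans Aw1); rewrite lee_fin le_max lexx.
  have A2 : (Ap_const setT rho2 mu2 S v <= Km%:E)%E.
    apply: (@Ap_mono _ _ _ _ _ _ _ _ S0 S Km v D2) => //; first by rewrite le_max lexx orbT.
    by apply: (le_trans Av); rewrite lee_fin le_max lexx orbT.
  have [||_ AX] := HA S Km w1 v S1 _ _ A1 A2.
  - by split => //; apply: le_lt_trans A1 _; exact: ltry.
  - by split => //; apply: le_lt_trans A2 _; exact: ltry.
  have W0 z : 0 <= (prod_weight w1 v : cprod mu1 mu2 -> R) z by rewrite mulr_ge0.
  have mW : measurable_fun setT (prod_weight w1 v : cprod mu1 mu2 -> R).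
    exact: measurable_prod_weight.
  have mWE : measurable_fun setT (fun z : cprod mu1 mu2 => (prod_weight w1 v z)%:E).
    exact/measurable_EFinP.
  have WE0 (z : cprod mu1 mu2) : (0 <= (prod_weight w1 v z)%:E)%E by rewrite lee_fin.
  have [nu [nuE nu_int]] := density_measure mu mWE WE0.
  have nuh (h : cprod mu1 mu2 -> R) : measurable_fun X h ->
      (\int[nu]_(z in X) (`|h z| `^ p)%:E =
       \int[mu2]_y (slice_integral X p w1 h y * (v y)%:E))%E.
    move=> mh; have mhp : measurable_fun X (fun z => (`|h z| `^ p)%:E).
      apply/measurable_EFinP; apply: (measurableT_comp (measurable_powR _)).
      exact: measurableT_comp.
    have hp0 z : X z -> (0 <= (`|h z| `^ p)%:E)%E by rewrite lee_fin powR_ge0.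
    rewrite (nu_int _ _ mX mhp hp0).
    exact: integral_slices.
  rewrite -(nuh _ mf) -(nuh _ mg); apply: (fefferman_stein DX delta01 eps0_gt0 df (ht_lebesgue HX) S1 _ _ AX) => //.
  - exact: measurable_funTS.
  - by move=> n P nP; exact: (cube_oscillation DX delta01 eps0_gt0 df osc nP).
  - case: supp => [|[rr [x0 [rr0 Xx0 fB muB]]]]; [by left|right].
    by exists (qball X rho x0 rr); split => //; exact: (qball_measurable DX).
  - by rewrite (nuh _ mf).
(* With r = q / p this integral is the q-th power of the mixed norm of [f]. *)
have fin : (\int[mu2]_x (phi x `^ r * (w2 x)%:E) < +oo)%E.
  rewrite ltey; apply/eqP => E; move: Lf; rewrite /mixed_norm -/r.
  rewrite (_ : \int[mu2]_y _ = \int[mu2]_x (phi x `^ r * (w2 x)%:E))%E// E.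
  by rewrite poweRyr// gt_eqF// invr_gt0.
have ext := extrapolation D2 q'_gt1 w20 mw2 Aw2 r0 N10 mphi mgam phi0 gam0 FS fin.
have G0 : (0 <= \int[mu2]_x (gam x `^ r * (w2 x)%:E))%E.
  by apply: integral_ge0 => y _; rewrite mule_ge0 ?poweR_ge0// lee_fin.
rewrite /mixed_norm -/r -poweR_EFin -poweRM//; last by rewrite lee_fin ltW.
apply: poweR_le; [by rewrite invr_ge0 ltW| |exact: ext].
by apply: integral_ge0 => y _; rewrite mule_ge0 ?poweR_ge0// lee_fin.
Qed.
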